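(* Fix $h\ge0$, $D\in\mathbb R$. There exists $\beta'>0$ such that for every $\beta\in(0,\beta')$: for any integer $n$ and nonnegative integers $h(k),h'(k)$ ($k\in[n]$), $h,h'$, with $H_1=\sum_kh(k)+\sum_kh'(k)+h+h'$, letting $\{(g_{T_k},g_{S_k}):k\in[n]\}$ be i.i.d. centered Gaussian vectors with covariance matrix $\Sigma_1=\begin{pmatrix}A_1^2&C_1^2\\C_1^2&B_1^2\end{pmatrix}$, $$\nu\Big(\prod_kT_k^{h(k)}\prod_lS_l^{h'(l)}T^hS^{h'}\Big)=\Big(\prod_k\mathbb E\big[g_{T_k}^{h(k)}g_{S_k}^{h'(k)}\big]\Big)\nu(T^hS^{h'})+O(N^{-(H_1+1)/2}),$$ with implied constant independent of $N$.
   Context: Fix an integer $\mathcal S\ge1$ and $N\ge2$; $\Sigma_N=\{0,\pm1,\dots,\pm\mathcal S\}^N$. For $\beta>0$, $h\ge0$, $D\in\mathbb R$ and i.i.d. standard Gaussians $(g_{i,j})_{i<j}$, $H_N(\sigma)=\frac{\beta}{\sqrt N}\sum_{i<j}g_{i,j}\sigma_i\sigma_j+D\sum_i\sigma_i^2+h\sum_i\sigma_i$, Gibbs measure $G(\sigma)\propto e^{H_N(\sigma)}$ on $\Sigma_N$. Replicas are i.i.d. samples from $G$ given the disorder; $\langle\cdot\rangle$ is the product Gibbs average, $\nu(f)=\mathbb E\langle f\rangle$. $p,q$: for $\eta\sim N(0,1)$, $\langle\phi\rangle_\eta=\sum_s\phi(s)w_\eta(s)/\sum_sw_\eta(s)$,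 $w_\eta(s)=\exp(\beta\sqrt q\eta s+hs+(D+\frac{\beta^2}{2}(p-q))s^2)$, $s\in\{0,\pm1,\dots,\pm\mathcal S\}$; $(p,q)$ solves $q=\mathbb E\langle s\rangle_\eta^2$, $p=\mathbb E\langle s^2\rangle_\eta$ (unique at high temperature). Basis: $b_i=\langle\sigma_i\rangle$, $\tilde b_i=\langle\sigma_i^2\rangle$; $T_k=\frac1N\sum_i(\sigma^k_i-b_i)b_i$, $T=\frac1N\sum_ib_i^2-q$, $S_k=\frac1N\sum_i((\sigma_i^k)^2-\tilde b_i)$, $S=\frac1N\sum_i\tilde b_i-p$. Constants: $m_j=\langle s^j\rangle_\eta$, expectations over $\eta$: $\mathcal D=\mathbb E[m_4-m_2^2]$, $F=\mathbb E[m_2^2-m_1^2m_2]$, $G=\mathbb E[m_1^2(m_2-m_1^2)]$, $\mathcal E=\mathbb E[m_1(m_3-m_1m_2)]$; $M_1=1-\beta^2(F-3G)$, $M_2=1-\frac{\beta^2}{2}\mathcal D$, $M_3=1-\beta^2(F-G)$, $M=M_1M_2+\beta^4\mathcal E^2$; $A_1^2=\frac{GM_2+\frac{\beta^2}{2}\mathcal E^2}{NMM_3}$, $B_1^2=\frac{\mathcal DM_1-2\beta^2\mathcal E^2}{NM}$, $C_1^2=\frac{\mathcal E}{NM}$. *)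

(* Defs.v *)
From HB Require Import structures.
From mathcomp Require Import all_boot all_order all_algebra.
From mathcomp Require Import all_classical all_reals all_analysis.
From mathcomp Require Import normal_distribution.
Unset Printing Implicit Defensive.
Import Order.TTheory GRing.Theory Num.Theory.
Local Open Scope ring_scope.

Section SK_spin.
Context {R : realType}.

Definition gauss1 (f : R -> R) : R :=
  Rintegral (@lebesgue_measure R) setT (fun x => normal_pdf 0 1 x * f x).

Fixpoint gauss_iter (m : nat) (F : seq R -> R) : R :=
  match m with
  | 0 => F [::]
  | m'.+1 => gauss1 (fun x => gauss_iter m' (fun s => F (x :: s)))
  end.

Variable S : nat.

(** spin values {0, +-1, ..., +-S}, encoded by 'I_(2S+1), a |-> a - S *)
Definition spin := 'I_(S.*2.+1).
Definition sv (a : spin) : R := (a : nat)%:R - S%:R.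

Variables (beta h D : R).

Section Model.
Variable N : nat.
Definition config := {ffun 'I_N -> spin}.

Variable g : 'I_N -> 'I_N -> R.

Definition HN (sigma : config) : R :=
  beta / Num.sqrt (N%:R) *
    (\sum_(i < N) \sum_(j < N | (i < j)%N) g i j * sv (sigma i) * sv (sigma j))
  + D * (\sum_(i < N) sv (sigma i) ^+ 2) + h * (\sum_(i < N) sv (sigma i)).

Definition gw (sigma : config) : R := expR (HN sigma).
Definition Zpart : R := \sum_(sigma : config) gw sigma.

Definition gavg (n : nat) (F : {ffun 'I_n -> config} -> R) : R :=
  \sum_(tau : {ffun 'I_n -> config}) F tau * \prod_(k < n) (gw (tau k) / Zpart).

Definition gavg1 (f : config -> R) : R :=
  \sum_(sigma : config) f sigma * (gw sigma / Zpart).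

Definition b (i : 'I_N) : R := gavg1 (fun sigma => sv (sigma i)).
Definition bt (i : 'I_N) : R := gavg1 (fun sigma => sv (sigma i) ^+ 2).

Variables (p q : R).
Variable n : nat.
Implicit Type tau : {ffun 'I_n -> config}.

Definition Tk tau (k : 'I_n) : R :=
  N%:R^-1 * \sum_(i < N) (sv (tau k i) - b i) * b i.
Definition Tbar : R := N%:R^-1 * (\sum_(i < N) b i ^+ 2) - q.
Definition Sk tau (k : 'I_n) : R :=
  N%:R^-1 * \sum_(i < N) (sv (tau k i) ^+ 2 - bt i).
Definition Sbar : R := N%:R^-1 * (\sum_(i < N) bt i) - p.
End Model.

(** disorder built from a list of N*N i.i.d. Gaussians; g_{i,j} is entry
    i*N+j (entries with i >= j are unused and integrate out) *)
Definition gdis (N : nat) (s : seq R) : 'I_N -> 'I_N -> R :=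
  fun i j => nth 0 s (i * N + j)%N.

Definition nu (N n : nat)
  (F : ('I_N -> 'I_N -> R) -> {ffun 'I_n -> config N} -> R) : R :=
  gauss_iter (N * N) (fun s => gavg N (gdis N s) n (F (gdis N s))).

Section Cavity.
Variables (p q : R).

Definition weta (eta : R) (s : spin) : R :=
  expR (beta * Num.sqrt q * eta * sv s + h * sv s
        + (D + beta ^+ 2 / 2 * (p - q)) * sv s ^+ 2).

Definition mj (j : nat) (eta : R) : R :=
  (\sum_(s : spin) sv s ^+ j * weta eta s) / (\sum_(s : spin) weta eta s).

Definition Dcal : R := gauss1 (fun e => mj 4 e - mj 2 e ^+ 2).
Definition Fc : R := gauss1 (fun e => mj 2 e ^+ 2 - mj 1 e ^+ 2 * mj 2 e).
Definition Gc : R := gauss1 (fun e => mj 1 e ^+ 2 * (mj 2 e - mj 1 e ^+ 2)).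
Definition Ecal : R := gauss1 (fun e => mj 1 e * (mj 3 e - mj 1 e * mj 2 e)).

Definition M1 : R := 1 - beta ^+ 2 * (Fc - 3 * Gc).
Definition M2 : R := 1 - beta ^+ 2 / 2 * Dcal.
Definition M3 : R := 1 - beta ^+ 2 * (Fc - Gc).
Definition Mc : R := M1 * M2 + beta ^+ 4 * Ecal ^+ 2.

Definition A1sq (N : nat) : R :=
  (Gc * M2 + beta ^+ 2 / 2 * Ecal ^+ 2) / (N%:R * Mc * M3).
Definition B1sq (N : nat) : R :=
  (Dcal * M1 - 2 * beta ^+ 2 * Ecal ^+ 2) / (N%:R * Mc).
Definition C1sq (N : nat) : R := Ecal / (N%:R * Mc).
End Cavity.

Definition fixed_point (p q : R) : Prop :=
  q = gauss1 (fun e => mj p q 1 e ^+ 2) /\ p = gauss1 (fun e => mj p q 2 e).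

End SK_spin.

(** A centered Gaussian vector (gT, gS) with covariance [[a, c], [c, bb]] is
    realised as L Z with Z a standard Gaussian vector in R^2 and L L^T equal
    to the covariance matrix. *)
Definition is_cov_factor {R : realType} (L11 L12 L21 L22 a bb c : R) : Prop :=
  L11 ^+ 2 + L12 ^+ 2 = a /\ L11 * L21 + L12 * L22 = c /\ L21 ^+ 2 + L22 ^+ 2 = bb.

Definition gmom {R : realType} (L11 L12 L21 L22 : R) (u v : nat) : R :=
  gauss1 (fun z1 => gauss1 (fun z2 =>
    (L11 * z1 + L12 * z2) ^+ u * (L21 * z1 + L22 * z2) ^+ v)).

(* Main.v *)
Require Import Defs.
From HB Require Import structures.
From mathcomp Require Import all_boot all_order all_algebra.
From mathcomp Require Import all_classical all_reals all_analysis.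
From mathcomp Require Import measurable_realfun normal_distribution perm.
From mathcomp Require Import ring lra zify.
Import Order.TTheory GRing.Theory Num.Theory.
Import numFieldNormedType.Exports.
Local Open Scope ring_scope.

(** With U_kl = N^-1 sum_i (s_i^k s_i^l - q), replaced by p instead of q when
k = l, each factor T_k, S_k, T, S of a mixed moment is a linear form in the
U_kl evaluated on fresh replicas.  The cavity method computes
nu (lam(U) * prod_v lam_v(U)): by site symmetry one copy of lam may be replaced
by its last-site term, and one interpolates between the model and a model whose
last spin decouples and is distributed as the one-site measure at eta.  To
first order the derivative along the path is again a linear combination of
moments nu (U_kl * prod_v lam_v(U)), the remainder being controlled by moment
bounds nu (U_kl^(2r)) = O(N^-r), which follow from the same interpolation by
induction on r when beta is small.  For lam = T_a and lam = S_a this gives a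
2 x 2 linear system (plus a scalar equation with coefficient M_3) whose solution
is Gaussian integration by parts with covariance Sigma_1, up to O(N^-1/2) in the
sqrt N scaling.  Removing the T_k and S_k one at a time leaves the Gaussian
moments times nu (T^h S^h'). *)

(** * Gaussian expectations *)

(** Replacing one form by its last-site term costs a factor sqrt N, so the path has to be expanded
    to second order. The term of order sqrt N vanishes because the fixed-point equations say exactly
    that every U_kl has mean zero at the decoupled site. Relabelling sites breaks the restriction i
    < j on the couplings; site symmetry is therefore derived from the fact that averages depend on
    the Gaussian field only through its covariance. The equations for T_a and S_a do not close by
    themselves: they involve the correlations between the deviation of replica a and those of the
    other replicas. These correlations obey a scalar equation of their own, and eliminating them
    produces the factor M_3 of A_1^2. The condition beta S^2 <= 1/200 has to serve moments of every
    order at once, so each loss that multiplies the top moment is kept independent of the order. The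
    constant C has to be found before N and before the factor of the covariance matrix. Hence the
    sqrt N scaling, in which the covariance does not depend on N. *)

Section Derivatives.
Context {R : realType}.
Implicit Types (f g : R -> R) (x a b c : R).

Lemma der_eq f x a b : is_derive x 1 f a -> a = b -> is_derive x 1 f b.
Proof. by move=> H <-. Qed.

Lemma der_cst x c : is_derive x 1 (fun _ : R => c) 0.
Proof. exact: is_derive_cst. Qed.

Lemma der_id x : is_derive x 1 (fun y : R => y) 1.
Proof. exact: is_derive_id. Qed.

Lemma derD f g x a b : is_derive x 1 f a -> is_derive x 1 g b ->
  is_derive x 1 (fun y => f y + g y) (a + b).
Proof. exact: is_deriveD. Qed.

Lemma derN f x a : is_derive x 1 f a -> is_derive x 1 (fun y => - f y) (- a).
Proof. exact: is_deriveN. Qed.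

Lemma derB f g x a b : is_derive x 1 f a -> is_derive x 1 g b ->
  is_derive x 1 (fun y => f y - g y) (a - b).
Proof. exact: is_deriveB. Qed.

Lemma derM f g x a b : is_derive x 1 f a -> is_derive x 1 g b ->
  is_derive x 1 (fun y => f y * g y) (a * g x + f x * b).
Proof.
move=> hf hg; have H := is_deriveM hf hg.
apply: (is_derive_eq H).
by rewrite /GRing.scale /=; ring.
Qed.

Lemma derZ c f x a : is_derive x 1 f a ->
  is_derive x 1 (fun y => c * f y) (c * a).
Proof.
move=> hf; apply: der_eq (derM _ _ _ _ _ (der_cst x c) hf) _.
by rewrite mul0r add0r.
Qed.

Lemma der_comp f g x a b : is_derive (g x) 1 f a -> is_derive x 1 g b ->
  is_derive x 1 (fun y => f (g y)) (a * b).
Proof. exact: is_derive1_comp. Qed.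

Lemma der_exp f x a : is_derive x 1 f a ->
  is_derive x 1 (fun y => expR (f y)) (expR (f x) * a).
Proof. by move=> hf; apply: der_comp. Qed.

Lemma derX n f x a : is_derive x 1 f a ->
  is_derive x 1 (fun y => f y ^+ n) (n%:R * f x ^+ n.-1 * a).
Proof.
move=> hf; elim: n => [|n IH].
  by apply: der_eq (der_cst x 1) _; rewrite !mul0r.
apply: (@der_eq _ x (a * f x ^+ n + f x * (n%:R * f x ^+ n.-1 * a))).
  rewrite (_ : (fun y => f y ^+ n.+1) = (fun y => f y * f y ^+ n)).
    exact: derM.
  by apply/funext => y; rewrite exprS.
case: n {IH} => [|n] /=; first by rewrite expr0 !mul0r mulr0; ring.
by rewrite -!natr1 exprS; ring.
Qed.

Lemma der_sum (I : Type) (r : seq I) (P : pred I) (f : I -> R -> R) (a : I -> R) x :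
  (forall i, P i -> is_derive x 1 (f i) (a i)) ->
  is_derive x 1 (fun y => \sum_(i <- r | P i) f i y) (\sum_(i <- r | P i) a i).
Proof.
move=> H; elim: r => [|i r IH].
  rewrite big_nil (_ : (fun y => _) = fun=> 0); first exact: der_cst.
  by apply/funext => y; rewrite big_nil.
rewrite big_cons (_ : (fun y => _) = fun y => if P i then f i y + \sum_(i <- r | P i) f i y
   else \sum_(i <- r | P i) f i y).
  by case: ifP => // Pi; apply: derD => //; exact: H.
by apply/funext => y; rewrite big_cons.
Qed.

Lemma derV f x a : is_derive x 1 f a -> f x != 0 ->
  is_derive x 1 (fun y => (f y)^-1) (- a / f x ^+ 2).
Proof.
move=> hf f0.
have [df Df] := hf.
apply: DeriveDef; first exact: derivableV.
by rewrite deriveV // Df /GRing.scale /=; ring.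
Qed.

Lemma der_continuous f x a : is_derive x 1 f a -> {for x, continuous f}.
Proof. by move=> [df _]; apply: differentiable_continuous; apply/derivable1_diffP. Qed.

End Derivatives.
Arguments der_eq {R f x a b}.
Arguments derD {R f g x a b}.
Arguments derN {R f x a}.
Arguments derB {R f g x a b}.
Arguments derM {R f g x a b}.
Arguments derZ {R} c {f x a}.
Arguments der_exp {R f x a}.
Arguments derX {R} n {f x a}.
Arguments derV {R f x a}.
Arguments der_comp {R} f {g x a b}.

(** * Polynomial weights and integrability against the Gaussian density *)

Section GaussOneDim.
Context {R : realType}.
Local Open Scope classical_set_scope.
Implicit Types (f g : R -> R) (x y : R) (k : nat).

Lemma lipschitz_at_continuous f x C :
  (forall h, `|h| <= 1 -> `|f (x + h) - f x| <= C * `|h|) ->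
  {for x, continuous f}.
Proof.
move=> H; apply/cvgrPdist_le => e e0.
have C0 : 0 <= C.
  by have := H 1; rewrite normr1 mulr1 lexx => /(_ isT); apply: le_trans.
have d0 : 0 < Num.min 1 (e / (C + 1)).
  by rewrite lt_min ltr01 divr_gt0 //; lra.
near=> y.
have yx : `|y - x| <= Num.min 1 (e / (C + 1)).
  rewrite distrC; near: y; apply: cvgr_dist_le; [exact: cvg_id|exact: d0].
move: yx; rewrite le_min => /andP[y1 ye].
have := H (y - x) y1; rewrite (addrC x) subrK distrC => /le_trans; apply.
have : (C + 1) * `|y - x| <= e.
  by move: ye; rewrite ler_pdivlMr ?(mulrC _ (C + 1)) //; lra.
by apply: le_trans; rewrite ler_wpM2r // lerDl.
Unshelve. all: by end_near.
Qed.

(** A quadratic error bound in place of a limit: differentiating under an iterated Gaussian integral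
    then amounts to integrating a pointwise bound, without dominated convergence. *)
Lemma quadratic_is_derive f x d C :
  (forall h, `|h| <= 1 -> `|f (x + h) - f x - h * d| <= C * h ^+ 2) ->
  is_derive x 1 f d.
Proof.
move=> H.
have C0 : 0 <= C.
  by have := H 1; rewrite normr1 expr1n mulr1 lexx => /(_ isT); apply: le_trans.
have Hc : h^-1 *: ((f \o shift x) (h *: (1 : R^o)) - f x) @[h --> 0^'] --> (d : R^o).
  apply/cvgrPdist_le => e e0.
  have d0 : 0 < Num.min 1 (e / (C + 1)).
    by rewrite lt_min ltr01 divr_gt0 //; lra.
  near=> h.
  have h0 : h != 0 by near: h; exact: nbhs_dnbhs_neq.
  have hm : `|h| <= Num.min 1 (e / (C + 1)).
    rewrite -[h]subr0 distrC; near: h; apply: cvgr_dist_le; last exact: d0.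
    exact: cvg_within.
  move: hm; rewrite le_min => /andP[h1 he].
  have := H h h1.
  rewrite /= /shift /=.
  rewrite -!/(_ *: _) /GRing.scale /= mulr1 (addrC h) => Hh.
  have -> : d - h^-1 * (f (x + h) - f x) = - (h^-1 * (f (x + h) - f x - h * d)).
    by field.
  rewrite normrN normrM normfV ler_pdivrMl ?normr_gt0 //.
  apply: (le_trans Hh).
  rewrite -real_normK ?num_real // expr2 mulrCA ler_wpM2l //.
  have : (C + 1) * `|h| <= e.
    by move: he; rewrite ler_pdivlMr ?(mulrC _ (C + 1)) //; lra.
  by apply: le_trans; rewrite ler_wpM2r // lerDl.
have dd : derivable f x 1 by apply/cvg_ex; exists d.
apply: DeriveDef => //.
by apply/cvg_lim => //.
Unshelve. all: by end_near.
Qed.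

(** A polynomial weight that is at least 1 everywhere, so bounds with different exponents merge by
    raising an exponent, and multiplicative in [k], so products of functions add exponents. *)
Definition pk k x : R := (1 + x ^+ 2) ^+ k.

Lemma pk_ge1 k x : 1 <= pk k x.
Proof. by rewrite exprn_ege1 // lerDl sqr_ge0. Qed.

Lemma pk_gt0 k x : 0 < pk k x.
Proof. exact: lt_le_trans (pk_ge1 k x). Qed.

Lemma pk_ge0 k x : 0 <= pk k x.
Proof. exact: ltW (pk_gt0 k x). Qed.

Lemma pk_mono k l x : (k <= l)%N -> pk k x <= pk l x.
Proof. by move=> kl; apply: ler_weXn2l => //; rewrite lerDl sqr_ge0. Qed.

Lemma pkD k l x : pk (k + l) x = pk k x * pk l x.
Proof. exact: exprD. Qed.

Lemma abs_le_pk1 x : `|x| <= pk 1 x.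
Proof.
have := sqr_ge0 (`|x| - 1); have := sqr_ge0 `|x|; rewrite /pk expr1 -(real_normK (num_real x)) !expr2; lra.
Qed.

Lemma pk_near k x h : `|h| <= 1 -> pk k (x + h) <= 3 ^+ k * pk k x.
Proof.
move=> h1; have h2 : h ^+ 2 <= 1 by rewrite -real_normK ?num_real // expr_le1.
have x2 := sqr_ge0 x; have xh2 := sqr_ge0 (x + h); have xh := sqr_ge0 (x - h).
rewrite /pk -exprMn lerXn2r // ?nnegrE; [lra|lra|].
move: h2 x2 xh2 xh; rewrite !expr2; lra.
Qed.

Definition tame1 k K f :=
  (forall x, `|f x| <= K * pk k x) /\
  (forall x y, `|f x - f y| <= K * pk k x * pk k y * `|x - y|).

Lemma tame1_K k K f : tame1 k K f -> 0 <= K.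
Proof.
move=> [/(_ 0) H _]; have := le_trans (normr_ge0 _) H.
by rewrite pmulr_lge0 // pk_gt0.
Qed.

Lemma tame1_continuous k K f : tame1 k K f -> continuous f.
Proof.
move=> tf x; have K0 := tame1_K _ _ _ tf; case: tf => _ H.
apply: (@lipschitz_at_continuous f x (K * (3 ^+ k * pk k x) * pk k x)) => h h1.
have := H (x + h) x; rewrite [x + h - x]addrAC subrr add0r => /le_trans; apply.
rewrite ler_wpM2r // ler_wpM2r ?pk_ge0 // ler_wpM2l //; exact: pk_near.
Qed.

Lemma tame1_measurable k K f : tame1 k K f -> measurable_fun setT f.
Proof. by move=> /tame1_continuous; exact: continuous_measurable_fun. Qed.

Lemma pk_le_exp k x : pk k x <= (4 * k.+1)%:R ^+ k * expR (x ^+ 2 / 4).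
Proof.
(* The k-th power of 1 + y <= M exp(y / M) has exponent k y / M; this [M] makes k / M at most
   1/4. *)
set M : R := (4 * k.+1)%:R.
have M0 : 1 <= M by rewrite /M ler1n.
have y0 : 0 <= x ^+ 2 by exact: sqr_ge0.
have h1 : 1 + x ^+ 2 <= M * expR (x ^+ 2 / M).
  apply: (@le_trans _ _ (M * (1 + x ^+ 2 / M))).
    have Mn0 : M != 0 by rewrite gt_eqF //; lra.
    by rewrite mulrDr mulr1 mulrCA divff // mulr1 lerD2r.
  by rewrite ler_wpM2l ?expR_ge1Dx //; lra.
apply: (@le_trans _ _ ((M * expR (x ^+ 2 / M)) ^+ k)).
  by rewrite lerXn2r // nnegrE ?mulr_ge0 ?expR_ge0 ?addr_ge0 // (le_trans ler01).
rewrite exprMn -expRM_natl ler_wpM2l ?exprn_ge0 ?(le_trans ler01) //.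
rewrite ler_expR.
have -> : k%:R * (x ^+ 2 / M) = x ^+ 2 / 4 * (k%:R / k.+1%:R).
  have k0 : k.+1%:R != 0 :> R by rewrite pnatr_eq0.
  by rewrite /M natrM; move: (k.+1%:R) k0 => c c0; field.
by rewrite ler_piMr ?divr_ge0 // ler_pdivrMr ?ltr0n // mul1r ler_nat.
Qed.

Local Notation pdf1 := (@normal_pdf R 0 1).

Lemma pdf1E x : pdf1 x = normal_peak 1 * expR (- (x ^+ 2 / 2)).
Proof.
by rewrite normal_pdfE ?oner_neq0 // /normal_fun subr0 expr1n mulNr.
Qed.

Lemma pdf2E x : @normal_pdf R 0 2 x = normal_peak 2 * expR (- (x ^+ 2 / 8)).
Proof.
rewrite normal_pdfE // /normal_fun subr0 mulNr.
have -> : 2 ^+ 2 *+ 2 = 8 :> R by rewrite -natrX -mulrnA.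
by [].
Qed.

(** Half of the Gaussian exponent pays for the weight: exp(-x^2/2) exp(x^2/4) <= exp(-x^2/8), which
    up to a constant is the density with standard deviation 2. That density dominates every function
    of polynomial growth. *)
Lemma pdf1_pk_le k : exists2 C : R, 0 <= C &
  forall x, pdf1 x * pk k x <= C * @normal_pdf R 0 2 x.
Proof.
exists (normal_peak 1 * (4 * k.+1)%:R ^+ k / normal_peak 2).
  by rewrite !mulr_ge0 ?exprn_ge0 ?invr_ge0 ?normal_peak_ge0.
move=> x; rewrite pdf1E pdf2E [leRHS]mulrA mulfVK ?gt_eqF ?normal_peak_gt0 //.
rewrite -mulrA -[leRHS]mulrA; apply: ler_wpM2l; first exact: normal_peak_ge0.
apply: (@le_trans _ _ (expR (- (x ^+ 2 / 2)) * ((4 * k.+1)%:R ^+ k * expR (x ^+ 2 / 4)))).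
  by apply: ler_wpM2l; [exact: expR_ge0|exact: pk_le_exp].
rewrite mulrCA ler_wpM2l ?exprn_ge0 // -expRD ler_expR.
have : 0 <= x ^+ 2 by exact: sqr_ge0.
lra.
Qed.

Local Notation mu := (@lebesgue_measure R).

Lemma pdf1_integrable k f (C : R) : measurable_fun setT f ->
  (forall x, `|f x| <= C * pk k x) ->
  mu.-integrable setT (EFin \o (fun x => pdf1 x * f x)).
Proof.
move=> mf fC.
have C0 : 0 <= C.
  by have := le_trans (normr_ge0 _) (fC 0); rewrite pmulr_lge0 // pk_gt0.
have [C' C'0 HC'] := pdf1_pk_le k.
apply: (@le_integrable _ _ _ mu setT measurableT _
   (fun x => ((C * C')%:E * (@normal_pdf R 0 2 x)%:E)%E)).
- apply/measurable_EFinP; apply: measurable_funM => //.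
  exact: measurable_normal_pdf.
- move=> x _ /=; rewrite lee_fin !normrM.
  rewrite (ger0_norm C0) (ger0_norm C'0) !(ger0_norm (normal_pdf_ge0 _ _ _)).
  apply: (@le_trans _ _ (pdf1 x * (C * pk k x))).
    by rewrite ler_wpM2l ?normal_pdf_ge0.
  by rewrite mulrCA -mulrA ler_wpM2l.
- by apply: integrableZl => //; exact: integrable_normal_pdf.
Qed.

Lemma tame1_integrable k K f : tame1 k K f ->
  mu.-integrable setT (EFin \o (fun x => pdf1 x * f x)).
Proof.
by move=> tf; apply: (pdf1_integrable k _ K); [exact: tame1_measurable tf|case: tf].
Qed.

End GaussOneDim.

Section GaussIntegral.
Context {R : realType}.
Local Open Scope classical_set_scope.
Implicit Types (f g : R -> R) (x y : R) (k : nat).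
Local Notation mu := (@lebesgue_measure R).
Local Notation pdf1 := (@normal_pdf R 0 1).

Definition gintegrable f :=
  mu.-integrable setT (EFin \o (fun x => pdf1 x * f x)).

Lemma tame1_gintegrable k K f : tame1 k K f -> gintegrable f.
Proof. exact: tame1_integrable. Qed.

Lemma gintegrable_pk k : gintegrable (pk k).
Proof.
apply: (pdf1_integrable k _ 1).
  apply: continuous_measurable_fun => x.
  apply: (@continuous_comp _ _ _ (fun x => 1 + x ^+ 2) (fun x => x ^+ k)).
    by apply: cvgD; [exact: cvg_cst|exact: exprn_continuous].
  exact: exprn_continuous.
by move=> x; rewrite mul1r ger0_norm // pk_ge0.
Qed.

Lemma gauss1D f g : gintegrable f -> gintegrable g ->
  gauss1 (fun x => f x + g x) = gauss1 f + gauss1 g.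
Proof.
move=> hf hg; rewrite /gauss1 -RintegralD //.
by congr Rintegral; apply/funext => x; rewrite mulrDr.
Qed.

Lemma gauss1Z (c : R) f : gintegrable f ->
  gauss1 (fun x => c * f x) = c * gauss1 f.
Proof.
move=> hf; rewrite /gauss1 -RintegralZl //.
by congr Rintegral; apply/funext => x; rewrite mulrCA.
Qed.

Lemma gauss1_le f g : gintegrable f -> gintegrable g ->
  (forall x, f x <= g x) -> gauss1 f <= gauss1 g.
Proof.
move=> hf hg fg; apply: le_Rintegral => // x _.
by rewrite ler_wpM2l ?normal_pdf_ge0.
Qed.

Lemma gauss1_cst (c : R) : gauss1 (fun _ => c) = c.
Proof.
rewrite /gauss1.
under eq_Rintegral do rewrite mulrC.
rewrite RintegralZl //; last exact: integrable_normal_pdf.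
by rewrite /Rintegral integral_normal_pdf mulr1.
Qed.

Lemma gintegrable_cst (c : R) : gintegrable (fun _ => c).
Proof.
apply: (pdf1_integrable 0 _ `|c|) => // x.
by rewrite /pk expr0 mulr1.
Qed.

Lemma gintegrableZ (c : R) f : gintegrable f -> gintegrable (fun x => c * f x).
Proof.
move=> hf; rewrite /gintegrable; set F := (fun x => pdf1 x * f x).
rewrite (_ : _ \o _ = (fun x => (c%:E * (EFin \o F) x)%E)).
  exact: integrableZl.
by apply/funext => x /=; rewrite mulrCA EFinM.
Qed.

Lemma gauss1_ge0 f : (forall x, 0 <= f x) -> 0 <= gauss1 f.
Proof.
by move=> f0; apply: Rintegral_ge0 => x _; rewrite mulr_ge0 ?normal_pdf_ge0.
Qed.

Lemma gauss1_abs_le f g : gintegrable f -> gintegrable g ->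
  (forall x, `|f x| <= g x) -> `|gauss1 f| <= gauss1 g.
Proof.
move=> hf hg fg; rewrite ler_norml; apply/andP; split; last first.
  by apply: gauss1_le => // x; apply: le_trans (fg x); exact: ler_norm.
rewrite lerNl -mulN1r -gauss1Z //.
apply: gauss1_le => //; first exact: gintegrableZ.
by move=> x; rewrite mulN1r; apply: le_trans (fg x); rewrite -normrN ler_norm.
Qed.

Lemma is_derive_pdf1 x : is_derive x 1 pdf1 (- x * pdf1 x).
Proof.
have -> : pdf1 = (fun x => normal_peak 1 * expR (- (x ^+ 2 / 2))).
  by apply/funext => y; exact: pdf1E.
apply: (der_eq (derZ _ (der_exp (derN (derM (derX 2 (der_id x)) (der_cst x _)))))).
by rewrite /= expr1; field.
Qed.

End GaussIntegral.

Section GaussIBP.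
Context {R : realType}.
Local Open Scope classical_set_scope.
Implicit Types (f g : R -> R) (x y : R) (k : nat).
Local Notation mu := (@lebesgue_measure R).
Local Notation pdf1 := (@normal_pdf R 0 1).

Lemma gintegrableD f g : gintegrable f -> gintegrable g ->
  gintegrable (fun x => f x + g x).
Proof.
move=> hf hg; rewrite /gintegrable.
set F := (fun x => pdf1 x * f x); set G := (fun x => pdf1 x * g x).
rewrite (_ : _ \o _ = ((EFin \o F) \+ (EFin \o G))%E); first exact: integrableD.
by apply/funext => x /=; rewrite mulrDr EFinD.
Qed.

Lemma gintegrable_xM k K f : tame1 k K f -> gintegrable (fun x => x * f x).
Proof.
move=> tf; apply: (pdf1_integrable k.+1 _ K).
  by apply: measurable_funM => //; exact: tame1_measurable tf.
move=> x; rewrite normrM -addn1 pkD mulrA mulrC ler_pM //; last exact: abs_le_pk1.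
by case: tf.
Qed.

Lemma int_patch_cvg g : mu.-integrable setT (EFin \o g) ->
  (\int[mu]_x ((g \_ `[- (n%:R : R), n%:R]) x)%:E)%E @[n --> \oo]
    --> (\int[mu]_x (g x)%:E)%E.
Proof.
move=> gi; have mg : measurable_fun setT g.
  by apply/measurable_EFinP; case/integrableP : gi.
have H := @dominated_convergence _ _ R mu setT measurableT
  (fun n x => ((g \_ `[- (n%:R : R), n%:R]) x)%:E) (EFin \o g)
  (abse \o (EFin \o g)).
case: H; last by [].
- move=> n; apply/measurable_EFinP; apply/(measurable_restrictT _ _).1 => //.
  by apply: measurable_funTS.
- by apply/measurable_EFinP.
- apply: aeW => x _ /=.
  apply: cvg_near_cst; near=> n.
  rewrite patchE mem_set //= in_itv /= -ler_norml.
  by near: n; exact: nbhs_infty_ger.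
- exact: integrable_abse.
- apply: aeW => x n _ /=; rewrite lee_fin patchE; case: ifP => // _.
  by rewrite normr0.
Unshelve. all: by end_near.
Qed.

Lemma int_patch_FTC (G g : R -> R) : continuous g ->
  (forall x, is_derive x 1 G (g x)) -> forall n : nat,
  (\int[mu]_x ((g \_ `[- (n.+1%:R : R), n.+1%:R]) x)%:E
    = (G n.+1%:R - G (- n.+1%:R))%:E)%E.
Proof.
move=> cg dG n.
have cG : continuous G by move=> x; exact: der_continuous (dG x).
have n0 : - (n.+1%:R : R) < n.+1%:R.
  by rewrite (lt_le_trans (y := 0)) ?oppr_lt0 ?ltr0n ?ler0n.
rewrite EFinB -(@continuous_FTC2 _ g G _ _ n0).
- by rewrite [RHS]integral_mkcond restrict_EFin.
- exact: continuous_subspaceT.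
- split.
  + by move=> x _; case: (dG x).
  + by apply: cvg_at_right_filter; exact: cG.
  + by apply: cvg_at_left_filter; exact: cG.
- by move=> x _; rewrite derive1E; case: (dG x).
Qed.

(** One spare power of the weight is traded for 1 / (n + 1), so the boundary terms of the
    integration by parts vanish in the limit. *)
Lemma pdf1_decay k : exists2 C : R, 0 <= C &
  forall n : nat, forall x, `|x| = n.+1%:R -> pdf1 x * pk k x <= C * n.+1%:R^-1.
Proof.
have [C C0 HC] := pdf1_pk_le (R := R) k.+1.
exists (C * normal_peak 2); first by rewrite mulr_ge0 ?normal_peak_ge0.
move=> n x xn.
have h : pdf1 x * pk k.+1 x <= C * normal_peak 2.
  by apply: (le_trans (HC x)); rewrite ler_wpM2l // normal_pdf_ub.
rewrite ler_pdivlMr ?ltr0n //; apply: le_trans h.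
rewrite -mulrA ler_wpM2l ?normal_pdf_ge0 // (_ : pk k.+1 x = pk k x * pk 1 x).
  rewrite ler_wpM2l ?pk_ge0 //.
  by rewrite -xn abs_le_pk1.
by rewrite -pkD addn1.
Qed.

(** The derivative of [pdf1 * f] is the density times f' - x f. Its integrals over growing symmetric
    intervals are boundary terms that tend to 0, and they also converge to the full integral. *)
Lemma gauss1_ibp k K f k' K' f' : tame1 k K f -> tame1 k' K' f' ->
  (forall x, is_derive x 1 f (f' x)) ->
  gauss1 (fun x => x * f x) = gauss1 f'.
Proof.
move=> tf tf' df.
have hf := gintegrable_xM _ _ _ tf.
have hf' := tame1_gintegrable _ _ _ tf'.
pose g x := pdf1 x * (f' x + -1 * (x * f x)).
have gi : gintegrable (fun x => f' x + -1 * (x * f x)).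
  by apply: gintegrableD => //; apply: gintegrableZ.
suff : gauss1 (fun x => f' x + -1 * (x * f x)) = 0.
  rewrite gauss1D ?gauss1Z //; last exact: gintegrableZ.
  by move=> h; lra.
pose G x := pdf1 x * f x.
have dG x : is_derive x 1 G (g x).
  apply: (der_eq (derM (is_derive_pdf1 x) (df x))); rewrite /g; ring.
have cg : continuous g.
  move=> x; apply: cvgM; first exact: continuous_normal_pdf.
  apply: cvgD; first exact: (tame1_continuous _ _ _ tf').
  apply: cvgM; first exact: cvg_cst.
  by apply: cvgM; [exact: cvg_id|exact: (tame1_continuous _ _ _ tf)].
have [C C0 HC] := pdf1_decay k.
have K0 := tame1_K _ _ _ tf.
have GC n x : `|x| = n.+1%:R -> `|G x| <= K * (C * n.+1%:R^-1).
  move=> xn; rewrite /G normrM ger0_norm ?normal_pdf_ge0 //.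
  apply: (@le_trans _ _ (pdf1 x * (K * pk k x))).
    by rewrite ler_wpM2l ?normal_pdf_ge0 //; case: tf.
  by rewrite mulrCA ler_wpM2l // HC.
have L1 : (\int[mu]_x ((g \_ `[- (n.+1%:R : R), n.+1%:R]) x)%:E)%E @[n --> \oo]
    --> (\int[mu]_x (g x)%:E)%E.
  by have := int_patch_cvg g gi; rewrite -cvg_shiftS.
have L2 : (\int[mu]_x ((g \_ `[- (n.+1%:R : R), n.+1%:R]) x)%:E)%E @[n --> \oo]
    --> (0 : R)%:E.
  under eq_cvg do rewrite (int_patch_FTC G g cg dG).
  apply: cvg_EFin; first by near=> n.
  apply: (@squeeze_cvgr _ _ _ _ (fun n => - (2 * (K * C) * (n.+1%:R)^-1))
     (fun n => 2 * (K * C) * (n.+1%:R)^-1)).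
  - near=> n; rewrite -ler_norml (le_trans (ler_normB _ _)) //.
    have h1 := GC n n.+1%:R (ger0_norm (ler0n _ _)).
    have h2 := GC n (- n.+1%:R).
    rewrite normrN in h2; have {}h2 := h2 (ger0_norm (ler0n _ _)).
    rewrite (_ : 2 * (K * C) * _ = K * (C * n.+1%:R^-1) + K * (C * n.+1%:R^-1)).
      exact: lerD.
    by move: (n.+1%:R^-1) => i; ring.
  - rewrite -oppr0; apply: cvgN; rewrite -(mulr0 (2 * (K * C))).
    by apply: cvgMr; exact: cvg_harmonic.
  - rewrite -(mulr0 (2 * (K * C))).
    by apply: cvgMr; exact: cvg_harmonic.
have := cvg_unique _ L1 L2.
by rewrite /gauss1 /Rintegral => ->.
Unshelve. all: by end_near.
Qed.

End GaussIBP.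

(** * A class of functions stable under partial Gaussian integration *)

Section Tame.
Context {R : realType}.
Implicit Types (s t : seq R) (F G : seq R -> R) (x y : R) (k m : nat).

Definition pks k s : R := \prod_(x <- s) pk k x.

Definition dist1 s t : R := \sum_(z <- zip s t) `|z.1 - z.2|.

Lemma pks_cons k x s : pks k (x :: s) = pk k x * pks k s.
Proof. exact: big_cons. Qed.

Lemma pks_ge1 k s : 1 <= pks k s.
Proof.
elim: s => [|x s IH]; first by rewrite /pks big_nil.
by rewrite pks_cons mulr_ege1 ?pk_ge1.
Qed.

Lemma pks_gt0 k s : 0 < pks k s.
Proof. exact: lt_le_trans (pks_ge1 k s). Qed.

Lemma pks_ge0 k s : 0 <= pks k s.
Proof. exact: ltW (pks_gt0 k s). Qed.

Lemma pks_mono k l s : (k <= l)%N -> pks k s <= pks l s.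
Proof.
move=> kl; elim: s => [|x s IH]; first by rewrite /pks !big_nil.
by rewrite !pks_cons ler_pM ?pk_ge0 ?pks_ge0 ?pk_mono.
Qed.

Lemma pksD k l s : pks (k + l) s = pks k s * pks l s.
Proof. by rewrite /pks -big_split /=; apply: eq_bigr => x _; rewrite pkD. Qed.

Lemma dist1_ge0 s t : 0 <= dist1 s t.
Proof. by apply: sumr_ge0 => z _. Qed.

Lemma dist1_cons x y s t : dist1 (x :: s) (y :: t) = `|x - y| + dist1 s t.
Proof. exact: big_cons. Qed.

Lemma dist1_refl s : dist1 s s = 0.
Proof.
elim: s => [|x s IH]; first by rewrite /dist1 big_nil.
by rewrite dist1_cons IH subrr normr0 addr0.
Qed.

(* A class on which iterated Gaussian integrals are linear and admit integration
   by parts without Fubini: polynomial growth and a polynomially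
   weighted Lipschitz bound, so that partial integrals stay in the class. *)
Definition tameK m k K F := 0 <= K /\ forall s t, size s = m -> size t = m ->
  `|F s| <= K * pks k s /\ `|F s - F t| <= K * (pks k s * pks k t) * dist1 s t.

Definition tame m F := exists k K, tameK m k K F.

Lemma tameK_mono m k l (K L : R) F : (k <= l)%N -> K <= L ->
  tameK m k K F -> tameK m l L F.
Proof.
move=> kl KL [K0 H]; have L0 := le_trans K0 KL.
split=> // s t sm tm; have [h1 h2] := H s t sm tm; split.
  by apply: (le_trans h1); rewrite ler_pM ?pks_ge0 ?pks_mono.
apply: (le_trans h2); rewrite ler_wpM2r ?dist1_ge0 //.
by rewrite ler_pM ?mulr_ge0 ?pks_ge0 // ler_pM ?pks_ge0 ?pks_mono.
Qed.

Lemma tame2 m F G : tame m F -> tame m G ->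
  exists k K, tameK m k K F /\ tameK m k K G.
Proof.
move=> [k [K H]] [l [L H']]; exists (maxn k l), (Num.max K L); split.
  by apply: tameK_mono H; rewrite ?leq_maxl // le_max lexx.
by apply: tameK_mono H'; rewrite ?leq_maxr // le_max lexx orbT.
Qed.

Lemma tame_ext m F G : (forall s, F s = G s) -> tame m F -> tame m G.
Proof. by move=> /funext ->. Qed.

Lemma tame_cst m (c : R) : tame m (fun _ => c).
Proof.
exists 0%N, `|c|; split => // s t _ _; split.
  by rewrite ler_peMr ?pks_ge1.
by rewrite subrr normr0 !mulr_ge0 ?pks_ge0 ?dist1_ge0.
Qed.

Lemma tame_add m F G : tame m F -> tame m G -> tame m (fun s => F s + G s).
Proof.
move=> tF tG; have [k [K [[K0 hF] [_ hG]]]] := tame2 _ _ _ tF tG.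
exists k, (K + K); split; first by rewrite addr_ge0.
move=> s t sm tm; have [a1 a2] := hF s t sm tm; have [b1 b2] := hG s t sm tm.
split; first by rewrite mulrDl (le_trans (ler_normD _ _)) // lerD.
rewrite opprD addrACA (le_trans (ler_normD _ _)) // !mulrDl lerD //.
Qed.

Lemma tame_mul m F G : tame m F -> tame m G -> tame m (fun s => F s * G s).
Proof.
move=> tF tG; have [k [K [[K0 hF] [_ hG]]]] := tame2 _ _ _ tF tG.
exists (k + k)%N, (K * K + K * K); split; first by rewrite addr_ge0 ?mulr_ge0.
move=> s t sm tm; have [a1 a2] := hF s t sm tm; have [b1 b2] := hG s t sm tm.
have [a3 _] := hF t s tm sm.
split.
  rewrite normrM pksD; apply: (@le_trans _ _ (K * K * (pks k s * pks k s))).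
    by rewrite mulrACA ler_pM.
  by rewrite ler_wpM2r ?mulr_ge0 ?pks_ge0 // lerDl mulr_ge0.
rewrite (_ : F s * G s - F t * G t = (F s - F t) * G s + F t * (G s - G t)); last by ring.
rewrite (le_trans (ler_normD _ _)) // !normrM.
set d := dist1 s t in a2 b2 *; have d0 : 0 <= d by exact: dist1_ge0.
have [p1 q1] := (pks_ge1 k s, pks_ge1 k t).
rewrite !pksD; move: p1 q1 a1 a2 a3 b1 b2; set p := pks k s; set q := pks k t => p1 q1 a1 a2 a3 b1 b2.
have p0 : 0 <= p by exact: le_trans p1.
have q0 : 0 <= q by exact: le_trans q1.
rewrite mulrDl mulrDl; apply: lerD.
  apply: (@le_trans _ _ (K * (p * q) * d * (K * p))); first by rewrite ler_pM.
  rewrite (_ : _ * _ = K * K * (p * p * q) * d); last by ring.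
  rewrite ler_wpM2r // ler_wpM2l ?mulr_ge0 // !mulrA ler_peMr ?mulr_ge0 //.
apply: (@le_trans _ _ ((K * q) * (K * (p * q) * d))); first by rewrite ler_pM.
rewrite (_ : _ * _ = K * K * (q * q * p) * d); last by ring.
rewrite ler_wpM2r // ler_wpM2l ?mulr_ge0 // [leRHS](_ : _ = q * q * p * p); last by ring.
by rewrite ler_peMr ?mulr_ge0.
Qed.

Lemma tame_opp m F : tame m F -> tame m (fun s => - F s).
Proof.
move=> tF; have := tame_mul _ _ _ (tame_cst m (-1)) tF.
by congr tame; apply/funext => s; rewrite mulN1r.
Qed.

Lemma tame_sub m F G : tame m F -> tame m G -> tame m (fun s => F s - G s).
Proof. by move=> tF tG; apply: tame_add => //; exact: tame_opp. Qed.

Lemma tame_scale m (c : R) F : tame m F -> tame m (fun s => c * F s).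
Proof. by move=> tF; apply: tame_mul => //; exact: tame_cst. Qed.

Lemma tame_sum m (I : Type) (r : seq I) (P : pred I) (H : I -> seq R -> R) :
  (forall i, P i -> tame m (H i)) -> tame m (fun s => \sum_(i <- r | P i) H i s).
Proof.
move=> tH; elim: r => [|i r IH].
  by apply: tame_ext (tame_cst m 0) => s; rewrite big_nil.
have [Pi|nPi] := boolP (P i).
  by apply: tame_ext (tame_add _ _ _ (tH i Pi) IH) => s; rewrite big_cons Pi.
by apply: tame_ext IH => s; rewrite big_cons (negbTE nPi).
Qed.

Lemma abs_nth_le s a : `|s`_a| <= pks 1 s.
Proof.
elim: s a => [|x s IH] [|a] /=; rewrite ?normr0 ?pks_ge0 //.
  by rewrite pks_cons -[leLHS]mulr1 ler_pM ?abs_le_pk1 ?pks_ge1.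
by rewrite pks_cons -[leLHS]mul1r ler_pM ?pk_ge1.
Qed.

Lemma dist1_nth s t a : size s = size t -> `|s`_a - t`_a| <= dist1 s t.
Proof.
elim: s t a => [|x s IH] [|y t] [|a] //= => [_|_|[st]|[st]].
- by rewrite subrr normr0 dist1_ge0.
- by rewrite subrr normr0 dist1_ge0.
- by rewrite dist1_cons lerDl dist1_ge0.
- by rewrite dist1_cons (le_trans (IH t a st)) // lerDr.
Qed.

Lemma tame_nth m a : tame m (fun s => s`_a).
Proof.
exists 1%N, 1; split => // s t sm tm; split; first by rewrite mul1r abs_nth_le.
rewrite mul1r; apply: (@le_trans _ _ (1 * dist1 s t)).
  by rewrite mul1r dist1_nth // sm tm.
by rewrite ler_wpM2r ?dist1_ge0 // mulr_ege1 ?pks_ge1.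
Qed.

(** Sums and products do not produce Gibbs weights or trigonometric functions; these enter the class
    as bounded functions that are Lipschitz in finitely many tame quantities. *)
Lemma tame_bounded_lipschitz m (I : Type) (r : seq I) (H : I -> seq R -> R) G (B L : R) :
  0 <= L ->
  (forall i, tame m (H i)) -> (forall s, `|G s| <= B) ->
  (forall s t, `|G s - G t| <= L * \sum_(i <- r) `|H i s - H i t|) -> tame m G.
Proof.
move=> L0 tH GB GL.
have [k [K [K0 HK]]] : exists k K, 0 <= K /\ forall s t, size s = m -> size t = m ->
   \sum_(i <- r) `|H i s - H i t| <= K * (pks k s * pks k t) * dist1 s t.
  elim: r {GL} => [|i r [k [K [K0 IH]]]].
    by exists 0%N, 0; split=> // s t _ _; rewrite big_nil !mul0r.
  have [l [L' [L'0 hi]]] := tH i.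
  exists (maxn k l), (K + L'); split; first exact: addr_ge0.
  move=> s t sm tm; have [_ h] := hi s t sm tm; have h' := IH s t sm tm.
  rewrite big_cons addrC !mulrDl; apply: lerD.
    apply: (le_trans h'); rewrite ler_wpM2r ?dist1_ge0 // ler_wpM2l //.
    by rewrite ler_pM ?pks_ge0 ?pks_mono ?leq_maxl.
  apply: (le_trans h); rewrite ler_wpM2r ?dist1_ge0 // ler_wpM2l //.
  by rewrite ler_pM ?pks_ge0 ?pks_mono ?leq_maxr.
have B0 : 0 <= B by exact: le_trans (GB [::]).
exists k, (B + L * K); split; first by rewrite addr_ge0 ?mulr_ge0.
move=> s t sm tm; split.
  apply: (le_trans (GB s)); rewrite -[leLHS]mulr1 ler_pM ?pks_ge1 //.
  by rewrite lerDl mulr_ge0.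
apply: (le_trans (GL s t)); rewrite !mulrDl -[leLHS]add0r lerD ?mulr_ge0 ?pks_ge0 ?dist1_ge0 //.
by rewrite -!(mulrA L) ler_wpM2l // HK.
Qed.

(** Allows the interpolation angle to sit at the head of the list of Gaussians, so that
    differentiating in the angle is an instance of differentiating in a coordinate. *)
Lemma tame_behead m F : tame m F -> tame m.+1 (fun s => F (behead s)).
Proof.
move=> [k [K [K0 H]]]; exists k, K; split=> // -[//|x s] [//|y t] [sm] [tm] /=.
have [h1 h2] := H s t sm tm; rewrite !pks_cons; split.
  by apply: (le_trans h1); rewrite ler_wpM2l // ler_peMl ?pks_ge0 ?pk_ge1.
apply: (le_trans h2); rewrite ler_pM ?mulr_ge0 ?pks_ge0 ?dist1_ge0 //.
  by rewrite ler_wpM2l // ler_pM ?pks_ge0 // ler_peMl ?pks_ge0 ?pk_ge1.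
by rewrite dist1_cons lerDr.
Qed.

Lemma tameK_cons m k (K : R) F x : tameK m.+1 k K F ->
  tameK m k (K * (pk k x * pk k x)) (fun s => F (x :: s)).
Proof.
move=> [K0 H]; split; first by rewrite !mulr_ge0 ?pk_ge0.
move=> s t sm tm; have [] := H (x :: s) (x :: t); rewrite /= ?sm ?tm //.
rewrite !pks_cons dist1_cons subrr normr0 add0r => h1 h2; split.
  apply: (le_trans h1); rewrite -mulrA ler_wpM2l //.
  by rewrite ler_wpM2r ?pks_ge0 // ler_peMl ?pk_ge0 ?pk_ge1.
by move: h2; rewrite mulrACA !mulrA.
Qed.

Lemma tame_cons m F x : tame m.+1 F -> tame m (fun s => F (x :: s)).
Proof. by move=> [k [K H]]; eexists; eexists; exact: tameK_cons H. Qed.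

End Tame.

(** * Iterated Gaussian integrals: linearity, differentiation, integration by parts *)

Section GaussIter.
Context {R : realType}.
Implicit Types (s t : seq R) (F G : seq R -> R) (x y : R) (k m : nat).

Lemma gauss_iter_ext m F G : (forall s, size s = m -> F s = G s) ->
  gauss_iter m F = gauss_iter m G.
Proof.
elim: m F G => [|m IH] F G FG /=; first exact: FG.
congr gauss1; apply/funext => x; apply: IH => s sm; apply: FG => /=.
by rewrite sm.
Qed.

Definition mpk k : R := gauss1 (pk k).

Lemma mpk_ge1 k : 1 <= mpk k.
Proof.
rewrite -(gauss1_cst (1 : R)); apply: gauss1_le; first exact: gintegrable_cst.
  exact: gintegrable_pk.
by move=> x; exact: pk_ge1.
Qed.

(** Linearity and the bound share one induction: a partial integral in dimension [m] is tame in the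
    remaining variable because differences can be taken inside and bounded there, and this supplies
    the integrability used in dimension [m.+1]. *)
Definition linear_bounded m :=
  (forall F G, tame m F -> tame m G ->
     gauss_iter m (fun s => F s + G s) = gauss_iter m F + gauss_iter m G) /\
  (forall c F, tame m F -> gauss_iter m (fun s => c * F s) = c * gauss_iter m F) /\
  (forall k (B : R) F, tame m F -> (forall s, size s = m -> `|F s| <= B * pks k s) ->
     `|gauss_iter m F| <= B * mpk k ^+ m).

Lemma linear_bounded_tame1 m : linear_bounded m -> forall F, tame m.+1 F ->
  exists k K, tame1 k K (fun x => gauss_iter m (fun s => F (x :: s))).
Proof.
move=> [IHD [IHZ IHB]] F tF; have [k [K [K0 HK]]] := tF.
have H x s : size s = m -> `|F (x :: s)| <= K * pk k x * pks k s.
  move=> sm; have [h _] := HK (x :: s) (x :: s) (congr1 S sm) (congr1 S sm).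
  by move: h; rewrite pks_cons mulrA.
have H2 x y s : size s = m -> `|F (x :: s) + -1 * F (y :: s)|
     <= K * pk k x * pk k y * `|x - y| * pks (k + k) s.
  move=> sm; have [_] := HK (x :: s) (y :: s) (congr1 S sm) (congr1 S sm).
  rewrite !pks_cons dist1_cons dist1_refl addr0 mulN1r => /le_trans; apply.
  rewrite [leLHS](_ : _ = K * pk k x * pk k y * `|x - y| * pks (k + k) s) //.
  by rewrite pksD; ring.
exists k, (K * mpk k ^+ m + K * mpk (k + k) ^+ m).
have M0 l : 0 <= mpk l ^+ m by rewrite exprn_ge0 // (le_trans ler01) ?mpk_ge1.
split=> [x|x y].
  apply: (le_trans (IHB _ _ _ (tame_cons _ _ x tF) (H x))).
  by rewrite mulrAC ler_wpM2r ?pk_ge0 // lerDl mulr_ge0.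
have tc x' : tame m (fun s => F (x' :: s)) by exact: tame_cons.
have -> : gauss_iter m (fun s => F (x :: s)) - gauss_iter m (fun s => F (y :: s))
   = gauss_iter m (fun s => F (x :: s) + -1 * F (y :: s)).
  by rewrite IHD ?IHZ ?mulN1r //; exact: tame_scale.
have tt : tame m (fun s => F (x :: s) + -1 * F (y :: s)).
  by apply: tame_add => //; exact: tame_scale.
apply: (le_trans (IHB _ _ _ tt (H2 x y))).
rewrite [leLHS](_ : _ = K * mpk (k + k) ^+ m * pk k x * pk k y * `|x - y|); last by ring.
by rewrite !ler_wpM2r ?pk_ge0 // lerDr mulr_ge0.
Qed.

Lemma gauss_iter_linear_bounded m : linear_bounded m.
Proof.
elim: m => [|m LB].
  split=> //; split => // k B F _ /(_ [::] erefl).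
  by rewrite /pks big_nil expr0.
have T1 := linear_bounded_tame1 _ LB; have [IHD [IHZ IHB]] := LB.
split; [|split].
- move=> F G tF tG /=.
  have [k [K hF]] := T1 F tF; have [k' [K' hG]] := T1 G tG.
  rewrite -gauss1D; [|exact: tame1_gintegrable hF|exact: tame1_gintegrable hG].
  by congr gauss1; apply/funext => x; rewrite IHD //; exact: tame_cons.
- move=> c F tF /=; have [k [K hF]] := T1 F tF.
  rewrite -gauss1Z; last exact: tame1_gintegrable hF.
  by congr gauss1; apply/funext => x; rewrite IHZ //; exact: tame_cons.
- move=> k B F tF H /=; have [l [L hF]] := T1 F tF.
  apply: (@le_trans _ _ (gauss1 (fun x => B * mpk k ^+ m * pk k x))); last first.
    rewrite gauss1Z; last exact: gintegrable_pk.
    by rewrite exprSr mulrA.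
  apply: gauss1_abs_le; first exact: tame1_gintegrable hF.
    by apply: gintegrableZ; exact: gintegrable_pk.
  move=> x; rewrite mulrAC; apply: IHB; first exact: tame_cons.
  by move=> s sm; have := H (x :: s); rewrite /= sm pks_cons mulrA; apply.
Qed.

Lemma gauss_iterD m F G : tame m F -> tame m G ->
  gauss_iter m (fun s => F s + G s) = gauss_iter m F + gauss_iter m G.
Proof. by move=> tF tG; case: (gauss_iter_linear_bounded m) => H _; apply: H. Qed.

Lemma gauss_iterZ m c F : tame m F ->
  gauss_iter m (fun s => c * F s) = c * gauss_iter m F.
Proof. by move=> tF; case: (gauss_iter_linear_bounded m) => _ [H _]; apply: H. Qed.

Lemma gauss_iter_bound m k (B : R) F : tame m F ->
  (forall s, size s = m -> `|F s| <= B * pks k s) ->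
  `|gauss_iter m F| <= B * mpk k ^+ m.
Proof. by move=> tF HF; case: (gauss_iter_linear_bounded m) => _ [_ H]; apply: H. Qed.

Lemma gauss_iterN m F : tame m F ->
  gauss_iter m (fun s => - F s) = - gauss_iter m F.
Proof.
move=> tF; rewrite -mulN1r -gauss_iterZ //.
by apply: gauss_iter_ext => s _; rewrite mulN1r.
Qed.

Lemma gauss_iterB m F G : tame m F -> tame m G ->
  gauss_iter m (fun s => F s - G s) = gauss_iter m F - gauss_iter m G.
Proof. by move=> tF tG; rewrite gauss_iterD ?gauss_iterN //; exact: tame_opp. Qed.

Lemma gauss_iter_cst m (c : R) : gauss_iter m (fun _ => c) = c.
Proof.
elim: m => //= m IH; rewrite -[RHS]gauss1_cst.
by congr gauss1; apply/funext => x; exact: IH.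
Qed.

Lemma gauss_iter_sum m (I : Type) (r : seq I) (P : pred I) (H : I -> seq R -> R) :
  (forall i, P i -> tame m (H i)) ->
  gauss_iter m (fun s => \sum_(i <- r | P i) H i s) =
  \sum_(i <- r | P i) gauss_iter m (H i).
Proof.
move=> tH; elim: r => [|i r IH].
  rewrite big_nil -[RHS](gauss_iter_cst m); apply: gauss_iter_ext => s _.
  by rewrite big_nil.
rewrite big_cons -IH; have [Pi|nPi] := boolP (P i).
  rewrite -gauss_iterD; [|exact: tH|exact: tame_sum].
  by apply: gauss_iter_ext => s _; rewrite big_cons Pi.
by apply: gauss_iter_ext => s _; rewrite big_cons (negbTE nPi).
Qed.

Lemma gauss_iter_ge0 m F : (forall s, size s = m -> 0 <= F s) -> 0 <= gauss_iter m F.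
Proof.
elim: m F => [|m IH] F F0 /=; first exact: F0.
by apply: gauss1_ge0 => x; apply: IH => s sm; apply: F0; rewrite /= sm.
Qed.

Lemma gauss_iter_le m F G : tame m F -> tame m G ->
  (forall s, size s = m -> F s <= G s) -> gauss_iter m F <= gauss_iter m G.
Proof.
move=> tF tG FG; rewrite -subr_ge0 -gauss_iterB //; apply: gauss_iter_ge0 => s sm.
by rewrite subr_ge0 FG.
Qed.

Lemma gauss_iter_tame1 m F : tame m.+1 F ->
  exists k K, tame1 k K (fun x => gauss_iter m (fun s => F (x :: s))).
Proof. by apply: linear_bounded_tame1; exact: gauss_iter_linear_bounded. Qed.

(** The mean value theorem writes an increment of [F] as [h] times a value of [F'] at a nearby
    point; the weighted Lipschitz bound on [F'] then makes the error quadratic in [h], with a weight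
    in [s] that can be integrated. *)
Lemma is_derive_gauss_iter m F F' : tame m.+1 F -> tame m.+1 F' ->
  (forall x s, size s = m -> is_derive x 1 (fun y => F (y :: s)) (F' (x :: s))) ->
  forall x, is_derive x 1 (fun y => gauss_iter m (fun s => F (y :: s)))
                          (gauss_iter m (fun s => F' (x :: s))).
Proof.
move=> tF tF' dF x.
have [k [K [K0 HK]]] := tF'.
apply: (@quadratic_is_derive _ _ _ _ (K * (3 ^+ k * pk k x) * pk k x * mpk (k + k) ^+ m)).
move=> h h1.
have tc y : tame m (fun s => F (y :: s)) by exact: tame_cons.
have tc' y : tame m (fun s => F' (y :: s)) by exact: tame_cons.
rewrite -gauss_iterZ // -!gauss_iterB //; [|exact: tame_sub|exact: tame_scale].
rewrite [leRHS](_ : _ = K * (3 ^+ k * pk k x) * pk k x * h ^+ 2 * mpk (k + k) ^+ m); last by ring.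
apply: gauss_iter_bound; first by apply: tame_sub; [exact: tame_sub|exact: tame_scale].
move=> s sm.
(* The point [c] depends on [s] in an uncontrolled way. This is harmless: it is used only for a
   pointwise bound at fixed [s], and no function of [c] is ever integrated. *)
have [c hc ->] : exists2 c, `|c| <= `|h| &
    F (x + h :: s) - F (x :: s) = h * F' (x + c :: s).
  have [h0|h0] := leP 0 h.
    have [] := @MVT_segment R (fun y => F (y :: s)) (fun y => F' (y :: s)) x (x + h).
    - by rewrite lerDl.
    - by move=> y _; exact: dF.
    - by apply: continuous_subspaceT => y; exact: der_continuous (dF y s sm).
    move=> c; rewrite in_itv /= => /andP[c1 c2] ->; exists (c - x).
      by rewrite !ger0_norm //; lra.
    by rewrite (addrC x (c - x)) subrK (addrC x h) addrK mulrC.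
  have [] := @MVT_segment R (fun y => F (y :: s)) (fun y => F' (y :: s)) (x + h) x.
  - by lra.
  - by move=> y _; exact: dF.
  - by apply: continuous_subspaceT => y; exact: der_continuous (dF y s sm).
  move=> c; rewrite in_itv /= => /andP[c1 c2] e; exists (c - x).
    by rewrite (ltr0_norm h0) ler0_norm //; lra.
  rewrite (addrC x (c - x)) subrK -opprB e; ring.
rewrite -mulrBr normrM.
have [_] := HK (x + c :: s) (x :: s) (congr1 S sm) (congr1 S sm).
rewrite dist1_cons dist1_refl addr0 !pks_cons addrAC subrr add0r => H2.
rewrite -(real_normK (num_real h)) expr2.
apply: (@le_trans _ _ (`|h| * (K * (3 ^+ k * pk k x * pks k s * (pk k x * pks k s)) * `|h|))).
  apply: ler_wpM2l => //; apply: (le_trans H2).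
  rewrite ler_pM ?mulr_ge0 ?pk_ge0 ?pks_ge0 //.
  rewrite ler_wpM2l // ler_wpM2r ?mulr_ge0 ?pk_ge0 ?pks_ge0 // ler_wpM2r ?pks_ge0 //.
  exact: pk_near (le_trans hc h1).
rewrite le_eqVlt; apply/orP; left; apply/eqP; rewrite pksD; ring.
Qed.

(** For coordinate 0 the inner integral is first differentiated under the sign; any later coordinate
    lies inside the outer integrals and is reached by recursion. The order of integration is never
    exchanged. *)
Lemma gauss_iter_ibp m F F' a : tame m F -> tame m F' -> (a < m)%N ->
  (forall s, size s = m -> is_derive (s`_a) 1 (fun y => F (set_nth 0 s a y)) (F' s)) ->
  gauss_iter m (fun s => s`_a * F s) = gauss_iter m F'.
Proof.
elim: m a F F' => [//|m IH] [|a] F F' tF tF' am dF /=.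
  have [k [K t1]] := gauss_iter_tame1 _ _ tF.
  have [k' [K' t1']] := gauss_iter_tame1 _ _ tF'.
  have d1 : forall x s, size s = m ->
      is_derive x 1 (fun y => F (y :: s)) (F' (x :: s)).
    by move=> x s sm; apply: (dF (x :: s)); rewrite /= sm.
  rewrite -(gauss1_ibp _ _ _ _ _ _ t1 t1' (is_derive_gauss_iter _ _ _ tF tF' d1)).
  by congr gauss1; apply/funext => x; rewrite -gauss_iterZ //; exact: tame_cons.
congr gauss1; apply/funext => x.
apply: (IH a (fun s => F (x :: s)) (fun s => F' (x :: s))) => //; try exact: tame_cons.
move=> s sm; have := dF (x :: s); rewrite /= sm; exact.
Qed.

Lemma gauss_iter_cat m1 m2 F :
  gauss_iter (m1 + m2) F = gauss_iter m1 (fun s => gauss_iter m2 (fun t => F (s ++ t))).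
Proof.
elim: m1 F => [|m1 IH] F //=.
by congr gauss1; apply/funext => x; rewrite IH.
Qed.

End GaussIter.

(** * Replica averages *)

Section Replicas.
Context {R : realType} {T : finType}.
Implicit Types (w : T -> R) (tau : nat -> T) (F G : (nat -> T) -> R) (i j k n : nat).

Definition upd tau j (x : T) : nat -> T := fun i => if i == j then x else tau i.

Definition avj w j F tau : R := \sum_(x : T) w x * F (upd tau j x).

(* [F] may depend on infinitely many replicas; coordinates from [n] on keep the
   values given by [tau]. *)
Fixpoint av w n F tau : R :=
  match n with 0 => F tau | n'.+1 => avj w n' (av w n' F) tau end.

Definition indep F j := forall tau x, F (upd tau j x) = F tau.

Lemma updE tau j x i : upd tau j x i = if i == j then x else tau i.
Proof. by []. Qed.

Lemma updC tau i j x y : i != j -> upd (upd tau i x) j y = upd (upd tau j y) i x.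
Proof.
move=> ij; apply/funext => k; rewrite !updE.
by case: eqVneq => [->|//]; rewrite eq_sym (negbTE ij).
Qed.

Lemma updU tau j x y : upd (upd tau j x) j y = upd tau j y.
Proof. by apply/funext => k; rewrite !updE; case: eqP. Qed.

Lemma avD w n F G tau :
  av w n (fun t => F t + G t) tau = av w n F tau + av w n G tau.
Proof.
elim: n tau => //= n IH tau; rewrite /avj -big_split /=.
by apply: eq_bigr => x _; rewrite IH mulrDr.
Qed.

Lemma avZ w n (c : R) F tau : av w n (fun t => c * F t) tau = c * av w n F tau.
Proof.
elim: n tau => //= n IH tau; rewrite /avj mulr_sumr.
by apply: eq_bigr => x _; rewrite IH mulrCA.
Qed.

Lemma avZr w n (c : R) F tau : av w n (fun t => F t * c) tau = av w n F tau * c.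
Proof. by rewrite mulrC -avZ; congr (av _ _ _ _); apply/funext => t; rewrite mulrC. Qed.

Lemma avN w n F tau : av w n (fun t => - F t) tau = - av w n F tau.
Proof. by rewrite -mulN1r -avZ; congr (av _ _ _ _); apply/funext => t; rewrite mulN1r. Qed.

Lemma avB w n F G tau :
  av w n (fun t => F t - G t) tau = av w n F tau - av w n G tau.
Proof. by rewrite avD avN. Qed.

Lemma av0 w n tau : av w n (fun _ => 0) tau = 0.
Proof. by rewrite -[RHS](mul0r (av w n (fun=> 0) tau)) -avZ; congr (av _ _ _ _); apply/funext => t; rewrite mul0r. Qed.

Lemma av_sum w n (I : Type) (r : seq I) (P : pred I) (H : I -> (nat -> T) -> R) tau :
  av w n (fun t => \sum_(i <- r | P i) H i t) tau = \sum_(i <- r | P i) av w n (H i) tau.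
Proof.
elim: r => [|i r IH].
  by rewrite big_nil -[RHS](av0 w n tau); congr (av _ _ _ _); apply/funext => t; rewrite big_nil.
rewrite big_cons -IH; case: ifP => Pi; rewrite -?avD;
  by congr (av _ _ _ _); apply/funext => t; rewrite big_cons Pi.
Qed.

Lemma av_le w n F G tau : (forall x, 0 <= w x) -> (forall t, F t <= G t) ->
  av w n F tau <= av w n G tau.
Proof.
move=> w0 FG; elim: n tau => //= n IH tau; apply: ler_sum => x _.
by rewrite ler_wpM2l.
Qed.

Lemma av_abs_le w n F G tau : (forall x, 0 <= w x) -> (forall t, `|F t| <= G t) ->
  `|av w n F tau| <= av w n G tau.
Proof.
move=> w0 FG; rewrite ler_norml -avN; apply/andP; split; apply: av_le => // t.
  by rewrite lerNl; apply: le_trans (FG t); rewrite -normrN ler_norm.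
by apply: le_trans (FG t); exact: ler_norm.
Qed.

Lemma avj_indep w j F : \sum_x w x = 1 -> indep F j -> avj w j F = F.
Proof.
move=> w1 iF; apply/funext => tau; rewrite /avj.
by under eq_bigr do rewrite iF; rewrite -mulr_suml w1 mul1r.
Qed.

Lemma indep_avj w j F : indep (avj w j F) j.
Proof. by move=> tau x; apply: eq_bigr => y _; rewrite updU. Qed.

Lemma indep_avj_neq w i j F : i != j -> indep F j -> indep (avj w i F) j.
Proof.
move=> ij iF tau x; apply: eq_bigr => y _.
have ji : j != i by rewrite eq_sym.
by rewrite (updC _ _ _ _ _ ji) iF.
Qed.

Lemma avjC w i j F : avj w i (avj w j F) = avj w j (avj w i F).
Proof.
have [->//|ij] := eqVneq i j; apply/funext => tau; rewrite /avj.
under eq_bigr do rewrite mulr_sumr.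
rewrite exchange_big /=; apply: eq_bigr => y _; rewrite mulr_sumr.
by apply: eq_bigr => x _; rewrite updC // mulrCA.
Qed.

Lemma avj_mulr w j F G : indep G j ->
  avj w j (fun t => F t * G t) = fun t => avj w j F t * G t.
Proof.
move=> iG; apply/funext => tau; rewrite /avj mulr_suml.
by apply: eq_bigr => x _; rewrite iG mulrA.
Qed.

Lemma avj_av w n j F : avj w j (av w n F) = av w n (avj w j F).
Proof. by elim: n => //= n IH; rewrite avjC IH. Qed.

Lemma indep_av w n j F : (n <= j)%N -> indep F j -> indep (av w n F) j.
Proof.
elim: n => //= n IH nj iF; apply: indep_avj_neq; first by rewrite ltn_eqF.
by apply: IH => //; exact: ltnW.
Qed.

(** Integrating replica [j] a second time changes nothing, so an average over any [j < n] may be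
    inserted. This is how conditional means over a fresh replica are formed. *)
Lemma av_avj w n j F : \sum_x w x = 1 -> (j < n)%N -> av w n (avj w j F) = av w n F.
Proof.
move=> w1; elim: n => //= n IH; rewrite ltnS leq_eqVlt => /predU1P[->|/IH -> //].
by rewrite -avj_av (avj_indep w n (avj w n _)) //; exact: indep_avj.
Qed.

Lemma avS w n F : \sum_x w x = 1 -> indep F n -> av w n.+1 F = av w n F.
Proof. by move=> w1 iF /=; rewrite avj_indep //; exact: indep_av. Qed.

Lemma av_extend w n k F : \sum_x w x = 1 ->
  (forall j, (n <= j)%N -> indep F j) -> av w (n + k) F = av w n F.
Proof.
move=> w1 iF; elim: k => [|k IH]; first by rewrite addn0.
by rewrite addnS avS //; apply: iF; exact: leq_addr.
Qed.

Lemma av_cst w n (c : R) tau : \sum_x w x = 1 -> av w n (fun _ => c) tau = c.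
Proof. by move=> w1; elim: n => // n IH; rewrite avS. Qed.

Lemma av1_eq w n k (f : T -> R) tau : \sum_x w x = 1 -> (k < n)%N ->
  av w n (fun t => f (t k)) tau = \sum_x w x * f x.
Proof.
move=> w1 kn; rewrite -(av_avj _ _ _ _ w1 kn) -[RHS](av_cst w n _ tau w1).
by congr (av _ _ _ _); apply/funext => t; apply: eq_bigr => x _; rewrite updE eqxx.
Qed.

Lemma av2_eq w n k l (V : T -> T -> R) tau : \sum_x w x = 1 ->
  (k < n)%N -> (l < n)%N -> k != l ->
  av w n (fun t => V (t k) (t l)) tau = \sum_x w x * \sum_y w y * V x y.
Proof.
move=> w1 kn ln kl; rewrite -(av_avj _ _ _ _ w1 ln).
rewrite -(av1_eq w n k (fun x => \sum_y w y * V x y) tau w1 kn).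
congr (av _ _ _ _); apply/funext => t; apply: eq_bigr => y _.
by rewrite !updE eqxx (negbTE kl).
Qed.

End Replicas.

(** * Gibbs weights and their derivatives *)

Section Gibbs.
Context {R : realType} {T : finType}.
Local Open Scope classical_set_scope.
Implicit Types (H : T -> R) (x y : R).

Definition gibbs H (z : T) : R := expR (H z) / \sum_(z' : T) expR (H z').

Lemma Zgibbs_gt0 (z : T) H : 0 < \sum_(z' : T) expR (H z').
Proof.
by rewrite (bigD1 z) //= ltr_pwDl ?expR_gt0 // sumr_ge0 // => i _; exact: expR_ge0.
Qed.

Lemma gibbs_ge0 H z : 0 <= gibbs H z.
Proof. by rewrite divr_ge0 ?expR_ge0 // sumr_ge0 // => i _; exact: expR_ge0. Qed.

Lemma sum_gibbs (z : T) H : \sum_z' gibbs H z' = 1.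
Proof. by rewrite -mulr_suml divff // gt_eqF // (Zgibbs_gt0 z). Qed.

Lemma gibbs_le1 H z : gibbs H z <= 1.
Proof.
rewrite -(sum_gibbs z H) (bigD1 z) //= lerDl sumr_ge0 // => i _; exact: gibbs_ge0.
Qed.

Lemma is_derive_gibbs (H : R -> T -> R) (H' : T -> R) x z :
  (forall z, is_derive x 1 (H ^~ z) (H' z)) ->
  is_derive x 1 (fun y => gibbs (H y) z)
    (gibbs (H x) z * (H' z - \sum_z' gibbs (H x) z' * H' z')).
Proof.
move=> dH.
have dZ : is_derive x 1 (fun y => \sum_z' expR (H y z'))
    (\sum_z' expR (H x z') * H' z').
  by apply: der_sum => i _; exact: der_exp.
have Z0 : \sum_z' expR (H x z') != 0 by rewrite gt_eqF // (Zgibbs_gt0 z).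
apply: (der_eq (derM (der_exp (dH z)) (derV dZ Z0))).
rewrite /gibbs.
have -> : \sum_z' expR (H x z') / (\sum_(z'0 : T) expR (H x z'0)) * H' z'
  = (\sum_z' expR (H x z') * H' z') / \sum_z' expR (H x z').
  by rewrite mulr_suml; apply: eq_bigr => i _; rewrite mulrAC.
by field.
Qed.

(** Mean value theorem along the segment from [H2] to [H1]: the derivative is a weight at most 1
    times an increment minus its mean, and each of the two is bounded by the l1 distance. *)
Lemma gibbs_lipschitz (H1 H2 : T -> R) z :
  `|gibbs H1 z - gibbs H2 z| <= 2 * \sum_z' `|H1 z' - H2 z'|.
Proof.
pose H y z := H2 z + y * (H1 z - H2 z).
pose d y := gibbs (H y) z * ((H1 z - H2 z) - \sum_z' gibbs (H y) z' * (H1 z' - H2 z')).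
have dH y : is_derive y 1 (fun y => gibbs (H y) z) (d y).
  apply: is_derive_gibbs => z'.
  by apply: (der_eq (derD (der_cst y _) (derM (der_id y) (der_cst y _)))); ring.
have cH : {within `[0, 1], continuous (fun y => gibbs (H y) z)}.
  by apply: continuous_subspaceT => y; exact: der_continuous (dH y).
have [c _] := MVT_segment ler01 (fun y _ => dH y) cH.
rewrite subr0 mulr1.
have -> : H 1 = H1 by apply/funext => z'; rewrite /H mul1r addrC subrK.
have -> : H 0 = H2 by apply/funext => z'; rewrite /H mul0r addr0.
move=> ->; rewrite /d normrM ger0_norm ?gibbs_ge0 //.
rewrite -[leRHS]mul1r ler_pM ?gibbs_ge0 ?gibbs_le1 //.
rewrite (le_trans (ler_normB _ _)) // mulrDl mul1r lerD //.
  by rewrite (bigD1 z) //= lerDl sumr_ge0.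
rewrite (le_trans (ler_norm_sum _ _ _)) // ler_sum // => i _.
by rewrite normrM ger0_norm ?gibbs_ge0 // ler_piMl ?gibbs_le1.
Qed.

Lemma tame_gibbs m (H : seq R -> T -> R) z : (forall z, tame m (H ^~ z)) ->
  tame m (fun s => gibbs (H s) z).
Proof.
move=> tH; apply: (@tame_bounded_lipschitz R m T (index_enum T) (fun z s => H s z) _ 1 2) => //.
  by move=> s; rewrite ger0_norm ?gibbs_ge0 ?gibbs_le1.
by move=> s t; exact: gibbs_lipschitz.
Qed.

Lemma tame_av m (H : seq R -> T -> R) n (F : seq R -> (nat -> T) -> R) tau :
  (forall z, tame m (H ^~ z)) -> (forall t, tame m (F ^~ t)) ->
  tame m (fun s => av (gibbs (H s)) n (F s) tau).
Proof.
move=> tH tF; elim: n tau => //= n IH tau.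
by apply: tame_sum => z _; apply: tame_mul; [exact: tame_gibbs|exact: IH].
Qed.

(** Logarithmic derivative of the [n]-replica Gibbs weight in the direction [c]. The mean of [c],
    which comes from the partition functions, is carried by the extra replica [n], so the result is
    again a replica average. *)
Definition tilt (n : nat) (c : T -> R) (t : nat -> T) : R :=
  \sum_(k < n) c (t k) - n%:R * c (t n).

Lemma av_replica_top (w : T -> R) n (F : (nat -> T) -> R) (c : T -> R) (tau : nat -> T) (x : T) :
  av w n (fun t => F t * c (t n)) (upd tau n x) = av w n F (upd tau n x) * c x.
Proof.
rewrite -avZr.
have [m mn] : exists m, (m <= n)%N /\ m = n by exists n.
have gen : forall m, (m <= n)%N -> forall t, t n = x ->
    av w m (fun t => F t * c (t n)) t = av w m (fun t => F t * c x) t.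
  elim=> [|l IH] ln t tn /=; first by rewrite tn.
  apply: eq_bigr => y _; congr (_ * _); apply: IH; first exact: ltnW.
  by rewrite updE gtn_eqF.
by apply: gen; rewrite // updE eqxx.
Qed.

Lemma is_derive_av (H : R -> T -> R) (H' : T -> R) x n F tau :
  (forall z, is_derive x 1 (H ^~ z) (H' z)) -> indep F n ->
  is_derive x 1 (fun y => av (gibbs (H y)) n F tau)
    (av (gibbs (H x)) n.+1 (fun t => F t * tilt n H' t) tau).
Proof.
move=> dH iF; set w := gibbs (H x).
have w1 : \sum_z w z = 1 by exact: (sum_gibbs (tau 0%N)).
set h := \sum_z w z * H' z.
(* The induction keeps the mean [h] explicit, because [F] may depend on the replicas [k] met on the
   way; it is independent of replica [n], which takes over the mean at the end. *)
have gen : forall k t, is_derive x 1 (fun y => av (gibbs (H y)) k F t)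
    (av w k (fun t => F t * \sum_(l < k) H' (t l)) t - k%:R * h * av w k F t).
  elim=> [|k IH] t /=.
    by apply: (der_eq (der_cst x _)); rewrite big_ord0 mulr0 !mul0r subr0.
  apply: (der_eq (der_sum _ _ _ _ _ x (fun z _ =>
     derM (is_derive_gibbs H H' x z dH) (IH (upd t k z))))).
  rewrite /avj mulr_sumr -sumrB; apply: eq_bigr => z _; rewrite -/w -/h.
  have -> : av w k (fun t0 => F t0 * \sum_(l < k.+1) H' (t0 l)) (upd t k z) =
     av w k (fun t0 => F t0 * \sum_(l < k) H' (t0 l)) (upd t k z) +
     av w k F (upd t k z) * H' z.
    rewrite -(av_replica_top w k F H') -avD; congr (av _ _ _ _).
    by apply/funext => u; rewrite big_ord_recr /= mulrDr.
  rewrite -natr1; ring.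
apply: (der_eq (gen n tau)).
rewrite /tilt.
have -> : (fun t => F t * (\sum_(k < n) H' (t k) - n%:R * H' (t n))) =
  (fun t => F t * \sum_(k < n) H' (t k) - n%:R * (F t * H' (t n))).
  by apply/funext => t; ring.
rewrite avB avZ avS //; last first.
  move=> t z; rewrite iF; congr (_ * _); apply: eq_bigr => i _.
  by rewrite updE ltn_eqF.
congr (_ - _); rewrite -mulrA; congr (_ * _) => /=.
rewrite /avj /h mulr_suml; apply: eq_bigr => z _.
rewrite av_replica_top (indep_av _ _ _ _ (leqnn n) iF); ring.
Qed.

End Gibbs.

Arguments av : simpl never.

(** * Interpolation *)

Section Qsum.
Context {R : realType}.
Implicit Types (V U : nat -> nat -> R) (n : nat).

(* The weights left by two derivatives of an [n]-replica Gibbs average; replicas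
   [n] and [n.+1] come from differentiating the partition function. *)
Definition Qsum n V : R :=
  \sum_(k < n) (\sum_(l < n.+1) V k l - n.+1%:R * V k n.+1)
  - n%:R * (\sum_(l < n.+1) V n l - n.+1%:R * V n n.+1).

Lemma Qsum_ext n V U : (forall k l, (k < n.+2)%N -> (l < n.+2)%N -> V k l = U k l) ->
  Qsum n V = Qsum n U.
Proof.
move=> VU; rewrite /Qsum; congr (_ - _ * _).
  apply: eq_bigr => k _; have kn : (k < n.+2)%N by have := ltn_ord k; lia.
  congr (_ - _ * _); last by rewrite VU.
  by apply: eq_bigr => l _; rewrite VU //; have := ltn_ord l; lia.
congr (_ - _ * _); last by rewrite VU.
by apply: eq_bigr => l _; rewrite VU //; have := ltn_ord l; lia.
Qed.

Lemma QsumD n V U : Qsum n (fun k l => V k l + U k l) = Qsum n V + Qsum n U.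
Proof.
have row k : \sum_(l < n.+1) (V k l + U k l) - n.+1%:R * (V k n.+1 + U k n.+1) =
  (\sum_(l < n.+1) V k l - n.+1%:R * V k n.+1) + (\sum_(l < n.+1) U k l - n.+1%:R * U k n.+1).
  by rewrite big_split /=; ring.
rewrite /Qsum (eq_bigr _ (fun (k : 'I_n) _ => row k)) row big_split /=; ring.
Qed.

Lemma QsumZ n (c : R) V : Qsum n (fun k l => c * V k l) = c * Qsum n V.
Proof.
have row k : \sum_(l < n.+1) (c * V k l) - n.+1%:R * (c * V k n.+1) =
  c * (\sum_(l < n.+1) V k l - n.+1%:R * V k n.+1).
  by rewrite -mulr_sumr; ring.
by rewrite /Qsum (eq_bigr _ (fun (k : 'I_n) _ => row k)) row -mulr_sumr; ring.
Qed.

Lemma QsumB n V U : Qsum n (fun k l => V k l - U k l) = Qsum n V - Qsum n U.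
Proof.
rewrite -mulN1r -QsumZ -QsumD; congr Qsum.
by apply/funext => k; apply/funext => l; rewrite mulN1r.
Qed.

Lemma Qsum_sum n (I : Type) (r : seq I) (P : pred I) (W : I -> nat -> nat -> R) :
  Qsum n (fun k l => \sum_(i <- r | P i) W i k l) = \sum_(i <- r | P i) Qsum n (W i).
Proof.
elim: r => [|i r IH].
  rewrite big_nil -[RHS](mul0r (Qsum n (fun _ _ => 0))) -QsumZ; apply: Qsum_ext => k l _ _.
  by rewrite big_nil mul0r.
rewrite big_cons -IH; case: ifP => Pi; rewrite -?QsumD;
  by apply: Qsum_ext => k l _ _; rewrite big_cons Pi.
Qed.

Lemma Qsum_diag n (f : nat -> R) :
  Qsum n (fun k l => if k == l then f k else 0) = \sum_(k < n) f k - n%:R * f n.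
Proof.
rewrite /Qsum ltn_eqF // mulr0 subr0; congr (_ - _ * _); last first.
  rewrite big_ord_recr /= eqxx big1 ?add0r // => l _.
  by rewrite gtn_eqF.
apply: eq_bigr => k _; rewrite ltn_eqF ?mulr0 ?subr0; last by rewrite ltnS ltnW.
rewrite (bigD1 (widen_ord (leqnSn n) k)) //= eqxx big1 ?addr0 // => l lk.
by case: eqP => // e; case/eqP: lk; apply/val_inj.
Qed.

(** The second tilt acts on [n.+1] replicas because the first has already introduced replica [n]:
    the pattern of a derivative followed by a Gaussian integration by parts. *)
Lemma tilt_mul {T : finType} n (f h : T -> R) (t : nat -> T) :
  tilt n f t * tilt n.+1 h t = Qsum n (fun k l => f (t k) * h (t l)).
Proof.
rewrite /tilt /Qsum mulrBl; congr (_ - _).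
  rewrite mulr_suml; apply: eq_bigr => k _.
  by rewrite mulrBr mulr_sumr; ring.
by rewrite -mulrA mulrBr mulr_sumr; congr (_ * (_ - _)); ring.
Qed.

(** Each row has total weight 2 (n + 1), and there are [n] rows plus one row taken [n] times: 4 n (n
    + 1), rounded up. With n = 2 this is the 36 of the moment bounds. *)
Lemma Qsum_abs_le n V (B : R) : (forall k l, (k < n.+2)%N -> (l < n.+2)%N -> `|V k l| <= B) ->
  `|Qsum n V| <= (4 * n.+1 * n.+1)%:R * B.
Proof.
move=> VB; have B0 : 0 <= B by exact: le_trans (VB 0%N 0%N isT isT).
have sumc N (x : R) : N%:R * x = \sum_(k < N) x by rewrite sumr_const card_ord mulr_natl.
have row k : (k < n.+2)%N ->
    `|\sum_(l < n.+1) V k l - n.+1%:R * V k n.+1| <= (2 * n.+1)%:R * B.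
  move=> kn; rewrite mul2n -addnn natrD mulrDl (le_trans (ler_normB _ _)) // lerD //.
    rewrite (le_trans (ler_norm_sum _ _ _)) // sumc.
    by rewrite ler_sum // => l _; rewrite VB //; have := ltn_ord l; lia.
  by rewrite normrM normr_nat ler_wpM2l // VB.
rewrite /Qsum (le_trans (ler_normB _ _)) //.
apply: (@le_trans _ _ (n%:R * ((2 * n.+1)%:R * B) + n%:R * ((2 * n.+1)%:R * B))).
  rewrite lerD //; last by rewrite normrM normr_nat ler_wpM2l // row.
  rewrite (le_trans (ler_norm_sum _ _ _)) // [leRHS]sumc.
  by rewrite ler_sum // => k _; rewrite row //; have := ltn_ord k; lia.
rewrite -mulrDl mulrA -natrD -natrM ler_wpM2r // ler_nat; nia.
Qed.

End Qsum.

Section TameTrigo.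
Context {R : realType}.
Local Open Scope classical_set_scope.

Lemma lipschitz1_of_derive (f f' : R -> R) : (forall x : R, is_derive x 1 f (f' x)) ->
  (forall x : R, `|f' x| <= 1) -> forall x y : R, `|f x - f y| <= `|x - y|.
Proof.
move=> df b; have cf : continuous f by move=> x; exact: der_continuous (df x).
have H : forall x y, y <= x -> `|f x - f y| <= `|x - y|.
  move=> x y yx.
  have [c _ ->] := MVT_segment yx (fun z _ => df z) (continuous_subspaceT cf).
  by rewrite normrM ler_piMl.
move=> x y; have [/H//|/ltW /H] := leP y x.
by rewrite distrC (distrC y x).
Qed.

Lemma tame_sin m a : tame m (fun s : seq R => sin s`_a).
Proof.
apply: (@tame_bounded_lipschitz R m unit [:: tt] (fun _ s => s`_a) _ 1 1) => //.
- by move=> _; exact: tame_nth.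
- by move=> s; rewrite ler_norml sin_geN1 sin_le1.
- move=> s t; rewrite big_seq1 mul1r.
  apply: (lipschitz1_of_derive _ _ (fun x => is_derive_sin x)) => x.
  by rewrite ler_norml cos_geN1 cos_le1.
Qed.

Lemma tame_cos m a : tame m (fun s : seq R => cos s`_a).
Proof.
apply: (@tame_bounded_lipschitz R m unit [:: tt] (fun _ s => s`_a) _ 1 1) => //.
- by move=> _; exact: tame_nth.
- by move=> s; rewrite ler_norml cos_geN1 cos_le1.
- move=> s t; rewrite big_seq1 mul1r.
  apply: (lipschitz1_of_derive _ _ (fun x => is_derive_cos x)) => x.
  by rewrite normrN ler_norml sin_geN1 sin_le1.
Qed.

End TameTrigo.

Section Path.
Context {R : realType} {T : finType}.
Variables (tau0 : nat -> T) (m : nat) (c1 c0 c2 : nat -> T -> R) (W0 W2 : T -> R).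
Implicit Types (F : (nat -> T) -> R) (th : R) (s : seq R) (x y : T) (n a : nat).

(* The interpolation parameter is an angle, so that sin^2 + cos^2 = 1 keeps the
   variance fixed and no square root has to be differentiated at 0. *)
Definition Hpath th s x : R :=
  \sum_(a < m) s`_a * (sin th * c1 a x + cos th * c0 a x + c2 a x)
  + (cos th ^+ 2 * W0 x + W2 x).

Definition ex th n F : R :=
  gauss_iter m (fun s => av (gibbs (Hpath th s)) n F tau0).

Definition Cov (c : nat -> T -> R) x y : R := \sum_(a < m) c a x * c a y.

Definition depn n F := forall j, (n <= j)%N -> indep F j.

(** Weight of the derivative with respect to sin^2. Growing sin^2 trades the covariance of [c0] for
    that of [c1], with the factor 1/2 usual for Gaussian interpolation. The diagonal term is the
    loss of the potential [W0], whose coefficient is cos^2; its factor 2 undoes the 1/2. *)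
Definition Qpath n (t : nat -> T) : R :=
  2^-1 * Qsum n (fun k l => Cov c1 (t k) (t l) - Cov c0 (t k) (t l)
                            - (if k == l then 2 * W0 (t k) else 0)).

(** The three families are carried by disjoint sets of Gaussians, so the fields are independent and
    their cross covariances vanish. *)
Hypothesis c10 : forall a x y, c1 a x * c0 a y = 0.
Hypothesis c12 : forall a x y, c1 a x * c2 a y = 0.
Hypothesis c02 : forall a x y, c0 a x * c2 a y = 0.

Lemma Hpath_derive th s x : is_derive th 1 (fun t => Hpath t s x)
  (\sum_(a < m) s`_a * (cos th * c1 a x - sin th * c0 a x)
   + (- (2 * sin th * cos th) * W0 x)).
Proof.
apply: (der_eq (derD (der_sum _ _ _ _ _ th (fun (a : 'I_m) _ =>
   derZ _ (derD (derD (derM (is_derive_sin th) (der_cst th _))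
                      (derM (is_derive_cos th) (der_cst th _))) (der_cst th _))))
   (derD (derM (derX 2 (is_derive_cos th)) (der_cst th _)) (der_cst th _)))).
congr (_ + _); first by apply: eq_bigr => a _; ring.
by rewrite /= expr1; ring.
Qed.

Lemma tame_Hpath x : tame m.+1 (fun u => Hpath u`_0 (behead u) x).
Proof.
apply: tame_add.
  apply: tame_sum => a _; apply: tame_mul; first exact: (tame_behead _ _ (tame_nth m a)).
  apply: tame_add; last exact: tame_cst.
  by apply: tame_add; (apply: tame_mul; last exact: tame_cst);
    [exact: tame_sin|exact: tame_cos].
apply: tame_add; last exact: tame_cst.
apply: tame_mul; last exact: tame_cst.
by apply: tame_mul; exact: tame_cos.
Qed.

Lemma tame_tilt k n (H : seq R -> T -> R) t : (forall x, tame k (H ^~ x)) ->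
  tame k (fun s => tilt n (H s) t).
Proof.
move=> tH; apply: tame_sub; first by apply: tame_sum => i _; exact: tH.
by apply: tame_scale; exact: tH.
Qed.

Lemma tame_Hpath_fix th x : tame m (fun s => Hpath th s x).
Proof.
apply: tame_add; last exact: tame_cst.
by apply: tame_sum => a _; apply: tame_mul; [exact: tame_nth|exact: tame_cst].
Qed.

Lemma tame_av_path th n F : tame m (fun s => av (gibbs (Hpath th s)) n F tau0).
Proof.
apply: (tame_av _ _ _ (fun _ => F)) => [x|t]; first exact: tame_Hpath_fix.
exact: tame_cst.
Qed.

Lemma indep_tilt n (c : T -> R) j : (n < j)%N -> indep (tilt n c) j.
Proof.
move=> nj t x; rewrite /tilt updE ltn_eqF //; congr (_ - _).
by apply: eq_bigr => i _; rewrite updE ltn_eqF // (ltn_trans _ nj).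
Qed.

Lemma exD th n F G : ex th n (fun t => F t + G t) = ex th n F + ex th n G.
Proof.
rewrite /ex -gauss_iterD; try exact: tame_av_path.
by apply: gauss_iter_ext => s _; rewrite avD.
Qed.

Lemma exZ th n (c : R) F : ex th n (fun t => c * F t) = c * ex th n F.
Proof.
rewrite /ex -gauss_iterZ; try exact: tame_av_path.
by apply: gauss_iter_ext => s _; rewrite avZ.
Qed.

Lemma ex_ext th n F G : (forall t, F t = G t) -> ex th n F = ex th n G.
Proof. by move=> /funext ->. Qed.

Lemma ex_sum th n (I : Type) (r : seq I) (P : pred I) (H : I -> (nat -> T) -> R) :
  ex th n (fun t => \sum_(i <- r | P i) H i t) = \sum_(i <- r | P i) ex th n (H i).
Proof.
rewrite /ex -gauss_iter_sum; last by move=> i _; exact: tame_av_path.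
by apply: gauss_iter_ext => s _; rewrite av_sum.
Qed.

Lemma path_ibp th n F a : (a < m)%N -> depn n F ->
  gauss_iter m (fun s => s`_a * av (gibbs (Hpath th s)) n F tau0) =
  ex th n.+1 (fun t => F t *
     tilt n (fun x => sin th * c1 a x + cos th * c0 a x + c2 a x) t).
Proof.
move=> am dF; apply: gauss_iter_ibp => //; [exact: tame_av_path|exact: tame_av_path|].
move=> s sm.
set y0 := s`_a; set g := fun x => sin th * c1 a x + cos th * c0 a x + c2 a x.
have := @is_derive_av R T (fun y : R => Hpath th (set_nth 0 s a y)) g y0 n F tau0.
have -> : Hpath th (set_nth 0 s a y0) = Hpath th s.
  congr Hpath; apply: (@eq_from_nth _ 0); first by rewrite size_set_nth sm; lia.
  by move=> i _; rewrite nth_set_nth /=; case: eqP => // ->.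
apply; last exact: dF.
move=> x.
apply: (der_eq (derD (der_sum _ _ _ _ (fun b : 'I_m => if b == a :> nat then g x else 0) y0 _)
  (der_cst y0 _))).
  move=> b _; rewrite (_ : (fun z => _) = fun z : R =>
    (if b == a :> nat then z else s`_b) * (sin th * c1 b x + cos th * c0 b x + c2 b x)).
    case: eqP => [->|_].
      by apply: (der_eq (derM (der_id y0) (der_cst y0 _))); rewrite /g; ring.
    exact: der_cst.
  by apply/funext => y; rewrite nth_set_nth.
rewrite addr0 (bigD1 (Ordinal am)) //= eqxx big1 ?addr0 // => b ba.
by case: eqP => // e; case/eqP: ba; apply/val_inj.
Qed.

(** Differentiating in the angle tilts by cos c1 - sin c0, and integrating by parts in each Gaussian
    tilts again by sin c1 + cos c0 + c2. Only the products c1 c1 and c0 c0 survive, with common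
    factor sin cos. *)
Lemma is_derive_ex th n F : depn n F ->
  is_derive th 1 (fun t => ex t n F)
    (2 * sin th * cos th * ex th n.+2 (fun t => F t * Qpath n t)).
Proof.
move=> dF.
(* Entry 0 of [u] is the angle, the remaining entries are the Gaussians. *)
pose H' (u : seq R) x := \sum_(a < m) (behead u)`_a * (cos u`_0 * c1 a x - sin u`_0 * c0 a x)
   + (- (2 * sin u`_0 * cos u`_0) * W0 x).
have tH' x : tame m.+1 (H' ^~ x).
  apply: tame_add.
    apply: tame_sum => a _; apply: tame_mul; first exact: (tame_behead _ _ (tame_nth m a)).
    by apply: tame_sub; (apply: tame_mul; last exact: tame_cst);
      [exact: tame_cos|exact: tame_sin].
  apply: tame_mul; last exact: tame_cst.
  apply: tame_opp; apply: tame_mul; last exact: tame_cos.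
  by apply: tame_mul; [exact: tame_cst|exact: tame_sin].
have := @is_derive_gauss_iter R m
  (fun u => av (gibbs (Hpath u`_0 (behead u))) n F tau0)
  (fun u => av (gibbs (Hpath u`_0 (behead u))) n.+1 (fun t => F t * tilt n (H' u) t) tau0).
move=> /(_ _ _ _ th) /= D; apply: (der_eq (D _ _ _)) => {D}.
- apply: (tame_av _ _ _ (fun _ => F)) => [x|t]; first exact: tame_Hpath.
  exact: tame_cst.
- apply: (tame_av _ _ _ (fun u t => F t * tilt n (H' u) t)) => [x|t]; first exact: tame_Hpath.
  by apply: tame_scale; exact: tame_tilt.
- move=> z s sm; apply: is_derive_av; last exact: dF.
  by move=> x; exact: Hpath_derive.
set g := fun (a : nat) x => cos th * c1 a x - sin th * c0 a x.
set gam := fun (a : nat) x => sin th * c1 a x + cos th * c0 a x + c2 a x.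
have dg a : depn n.+1 (fun t => F t * tilt n (g a) t).
  by move=> j nj t x; rewrite dF ?indep_tilt // ltnW.
have tiltE s t : tilt n (H' (th :: s)) t =
   \sum_(a < m) s`_a * tilt n (g a) t + (- (2 * sin th * cos th)) * tilt n W0 t.
  rewrite /tilt /H' /=; under eq_bigr do rewrite -/(g _ _).
  rewrite big_split /= exchange_big /= -mulr_sumr.
  under eq_bigr do rewrite -mulr_sumr.
  have -> : \sum_(a < m) s`_a * (\sum_(k < n) g a (t k) - n%:R * g a (t n)) =
     \sum_(a < m) s`_a * \sum_(k < n) g a (t k) - n%:R * \sum_(a < m) s`_a * g a (t n).
    rewrite mulr_sumr -sumrB; apply: eq_bigr => a _; ring.
  ring.
transitivity (\sum_(a < m) ex th n.+2 (fun t => F t * tilt n (g a) t * tilt n.+1 (gam a) t)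
  + - (2 * sin th * cos th) * ex th n.+2 (fun t => F t * tilt n W0 t)).
  have -> : ex th n.+2 (fun t => F t * tilt n W0 t) = ex th n.+1 (fun t => F t * tilt n W0 t).
    apply: gauss_iter_ext => s _; rewrite avS //; first exact: (sum_gibbs (tau0 0%N)).
    by move=> t x; rewrite dF ?indep_tilt // ltnW.
  under [in RHS]eq_bigr => a _ do rewrite -(path_ibp th n.+1 _ a (ltn_ord a) (dg a)).
  rewrite -gauss_iter_sum; last first.
    by move=> a _; apply: tame_mul; [exact: tame_nth|exact: tame_av_path].
  rewrite /ex -gauss_iterZ; last exact: tame_av_path.
  rewrite -gauss_iterD; [|apply: tame_sum => a _|apply: tame_scale; exact: tame_av_path].
    apply: gauss_iter_ext => s _.
    under [X in X + _]eq_bigr => a _ do rewrite -avZ.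
    rewrite -av_sum -avZ -avD; congr (av _ _ _ _); apply/funext => t.
    rewrite tiltE mulrDr mulr_sumr; congr (_ + _); last by ring.
    by apply: eq_bigr => a _; ring.
  by apply: tame_mul; [exact: tame_nth|exact: tame_av_path].
rewrite -ex_sum -!exZ -exD; apply: ex_ext => t.
rewrite /Qpath QsumB QsumB Qsum_diag.
have -> : \sum_(k < n) 2 * W0 (t k) - n%:R * (2 * W0 (t n)) = 2 * tilt n W0 t.
  by rewrite /tilt -mulr_sumr; ring.
have -> : \sum_(a < m) F t * tilt n (g a) t * tilt n.+1 (gam a) t =
  F t * (sin th * cos th) * (Qsum n (fun k l => Cov c1 (t k) (t l))
      - Qsum n (fun k l => Cov c0 (t k) (t l))).
  under eq_bigr do rewrite -mulrA tilt_mul.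
  rewrite -mulr_sumr -mulrA; congr (_ * _).
  rewrite -Qsum_sum -QsumB -QsumZ.
  apply: Qsum_ext => k l _ _; rewrite /Cov -sumrB mulr_sumr; apply: eq_bigr => a _.
  rewrite /g /gam.
  have e1 := c10 a (t k) (t l); have e2 := c10 a (t l) (t k).
  have e3 := c12 a (t k) (t l); have e4 := c02 a (t k) (t l).
  transitivity (sin th * cos th * (c1 a (t k) * c1 a (t l) - c0 a (t k) * c0 a (t l))
    + (cos th * cos th * (c1 a (t k) * c0 a (t l)) - sin th * sin th * (c1 a (t l) * c0 a (t k))
    + cos th * (c1 a (t k) * c2 a (t l)) - sin th * (c0 a (t k) * c2 a (t l)))); first by ring.
  rewrite e1 e2 e3 e4; ring.
by field.
Qed.

End Path.

(** * Calculus in the variable sin^2 along the path *)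

Section SinSquare.
Context {R : realType}.
Local Open Scope classical_set_scope.
Implicit Types (phi psi : R -> R) (th K : R).

(** [psi] is the derivative of [phi] with respect to sin^2, written without dividing by 2 sin cos,
    which vanishes at both ends of the path. *)
Definition sc_derive phi psi :=
  forall th : R, is_derive th 1 phi (2 * sin th * cos th * psi th).

Definition quarter th := 0 <= th <= pi / 2.

Lemma quarter0 : quarter 0.
Proof. by rewrite /quarter lexx divr_ge0 // pi_ge0. Qed.

Lemma quarter1 : quarter (pi / 2).
Proof. by rewrite /quarter lexx andbT divr_ge0 // pi_ge0. Qed.

Lemma quarter_sc th : quarter th -> 0 <= 2 * sin th * cos th.
Proof.
move=> /andP[h0 h1]; have pi0 := pi_ge0 R; rewrite !mulr_ge0 //.
  by apply: sin_ge0_pi; apply/andP; split; lra.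
by apply: cos_ge0_pihalf; apply/andP; split; lra.
Qed.

Lemma sc_derive_sin2 : sc_derive (fun th => sin th ^+ 2) (fun _ => 1).
Proof. by move=> th; apply: (der_eq (derX 2 (is_derive_sin th))); rewrite expr1; ring. Qed.

Lemma sc_deriveD phi psi phi' psi' : sc_derive phi psi -> sc_derive phi' psi' ->
  sc_derive (fun th => phi th + phi' th) (fun th => psi th + psi' th).
Proof. by move=> h h' th; apply: (der_eq (derD (h th) (h' th))); ring. Qed.

Lemma sc_deriveZ (c : R) phi psi : sc_derive phi psi ->
  sc_derive (fun th => c * phi th) (fun th => c * psi th).
Proof. by move=> h th; apply: (der_eq (derZ c (h th))); ring. Qed.

Lemma sc_homo phi psi : sc_derive phi psi ->
  (forall th, quarter th -> 0 <= psi th) ->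
  forall a b, 0 <= a -> a <= b -> b <= pi / 2 -> phi a <= phi b.
Proof.
move=> d p a b a0 ab b1.
have c : continuous phi by move=> th; exact: der_continuous (d th).
apply: (@ger0_derive1_ndecr R phi 0 (pi / 2)) => //.
- by move=> x _; case: (d x).
- move=> x; rewrite in_itv /= => /andP[x0 x1].
  have qx : quarter x by rewrite /quarter !ltW.
  by rewrite derive1E; case: (d x) => _ ->; rewrite mulr_ge0 ?quarter_sc ?p.
- exact: continuous_subspaceT.
Qed.

Lemma sin2_bound th : 0 <= sin th ^+ 2 <= 1.
Proof.
rewrite sqr_ge0 /= -(cos2Dsin2 th) lerDr sqr_ge0 //.
Qed.

Lemma sc_bound phi psi K a b : sc_derive phi psi ->
  (forall th, quarter th -> `|psi th| <= K) ->
  0 <= a -> a <= b -> b <= pi / 2 ->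
  `|phi b - phi a| <= K.
Proof.
move=> d p a0 ab b1.
have K0 : 0 <= K by exact: le_trans (p _ quarter0).
have h1 := sc_homo _ _ (sc_deriveD _ _ _ _ d (sc_deriveZ K _ _ sc_derive_sin2)).
have h2 := sc_homo _ _ (sc_deriveD _ _ _ _ (sc_deriveZ (-1) _ _ d) (sc_deriveZ K _ _ sc_derive_sin2)).
have {}h1 := h1 _ a b a0 ab b1; have {}h2 := h2 _ a b a0 ab b1.
have /h1 {}h1 : forall th, quarter th -> 0 <= psi th + K * 1.
  by move=> th /p; rewrite ler_norml mulr1 => /andP[+ _]; lra.
have /h2 {}h2 : forall th, quarter th -> 0 <= -1 * psi th + K * 1.
  by move=> th /p; rewrite ler_norml mulr1 => /andP[_ +]; lra.
have /andP[sa0 sa1] := sin2_bound a; have /andP[sb0 sb1] := sin2_bound b.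
rewrite ler_norml; apply/andP; split; nra.
Qed.

(** After subtracting psi(0) sin^2 the derivative is psi - psi(0), which the first-order bound keeps
    below [K]. The sharper K / 2 of Taylor's formula is of no use here. *)
Lemma sc_taylor2 phi psi psi2 K : sc_derive phi psi -> sc_derive psi psi2 ->
  (forall th, quarter th -> `|psi2 th| <= K) ->
  `|phi (pi / 2) - phi 0 - psi 0| <= K.
Proof.
move=> d d2 p.
have d' := sc_deriveD _ _ _ _ d (sc_deriveZ (- psi 0) _ _ sc_derive_sin2).
have := sc_bound _ _ K 0 (pi / 2) d' _ (lexx 0) _ (lexx _).
rewrite sin_pihalf sin0 expr1n expr0n /= mulr0 mulr1 addr0 => h.
rewrite addrAC; apply: h; last by rewrite divr_ge0 // pi_ge0.
move=> th /andP[th0 th1].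
exact: (sc_bound _ _ K 0 th d2 p).
Qed.

(** phi exp(K sin^2) is nondecreasing, so values along the path are bounded by the value at pi / 2:
    moments are brought back to the true model, where site symmetry holds. *)
Lemma sc_gronwall phi psi K : sc_derive phi psi -> 0 <= K ->
  (forall th, 0 <= phi th) ->
  (forall th, quarter th -> `|psi th| <= K * phi th) ->
  forall th, quarter th -> phi th <= expR K * phi (pi / 2).
Proof.
move=> d K0 phi0 p th /andP[th0 th1].
have dg : sc_derive (fun th => phi th * expR (K * sin th ^+ 2))
   (fun th => (psi th + K * phi th) * expR (K * sin th ^+ 2)).
  move=> x; apply: (der_eq (derM (d x) (der_exp (derZ K (sc_derive_sin2 x))))); ring.
have := sc_homo _ _ dg _ th (pi / 2) th0 th1 (lexx _).
rewrite sin_pihalf expr1n mulr1 => h.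
apply: (@le_trans _ _ (phi th * expR (K * sin th ^+ 2))).
  rewrite ler_peMr // -[leLHS]expR0 ler_expR mulr_ge0 //.
  by case/andP: (sin2_bound th).
rewrite mulrC [leRHS]mulrC mulrC; apply: h => x /p.
rewrite ler_norml => /andP[h1 _].
by rewrite mulr_ge0 ?expR_ge0 //; lra.
Qed.

End SinSquare.

Section CovarianceInvariance.
Context {R : realType} {T : finType}.
Variable tau0 : nat -> T.
Implicit Types (F : (nat -> T) -> R) (c : nat -> T -> R) (W : T -> R).

Definition lin_ham m c W (s : seq R) (x : T) : R := \sum_(a < m) s`_a * c a x + W x.

Definition gst m c W n F : R :=
  gauss_iter m (fun s => av (gibbs (lin_ham m c W s)) n F tau0).

(** The two fields are put on disjoint blocks of m + m' Gaussians and joined by a path. The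
    derivative is a [Qsum] of covariance differences, hence zero. This replaces the statement that a
    Gaussian law is determined by its covariance. *)
Lemma gst_cov m c m' c' W n F : depn n F ->
  (forall x y, Cov m c x y = Cov m' c' x y) ->
  gst m c W n F = gst m' c' W n F.
Proof.
move=> dF CC.
pose d1 a := if (a < m)%N then c a else fun _ => 0.
pose d0 a := if (a < m)%N then fun _ => 0 else c' (a - m)%N.
pose d2 (a : nat) (x : T) : R := 0.
pose Z (x : T) : R := 0.
pose phi th := ex tau0 (m + m') d1 d0 d2 Z W th n F.
have C1 x y : Cov (m + m') d1 x y = Cov m c x y.
  rewrite /Cov big_split_ord /= [X in _ + X]big1 ?addr0 => [|i _]; last first.
    by rewrite /d1 /= ltnNge leq_addr /= mul0r.
  by apply: eq_bigr => i _; rewrite /d1 ltn_ord.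
have C0 x y : Cov (m + m') d0 x y = Cov m' c' x y.
  rewrite /Cov big_split_ord /= big1 ?add0r => [|i _]; last by rewrite /d0 ltn_ord mul0r.
  by apply: eq_bigr => i _; rewrite /d0 ltnNge leq_addr /= addKn.
have dphi : sc_derive phi (fun _ => 0).
  move=> th; apply: (der_eq (is_derive_ex tau0 (m + m') d1 d0 d2 Z W _ _ _ th n F dF)).
  - by move=> a x y; rewrite /d1 /d0; case: ifP; rewrite ?mulr0 ?mul0r.
  - by move=> a x y; rewrite mulr0.
  - by move=> a x y; rewrite mulr0.
  - rewrite (@ex_ext _ _ _ _ _ _ _ _ _ _ _ _ (fun t => 0 * F t)) ?exZ ?mul0r //.
    move=> t; rewrite mul0r /Qpath (@Qsum_ext _ _ _ (fun k l => 0 * 0)) ?QsumZ ?mul0r ?mulr0 //.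
    by move=> k l _ _; rewrite C1 C0 CC subrr /Z mulr0 if_same; ring.
have e1 : phi (pi / 2) = gst m c W n F.
  rewrite /phi /ex gauss_iter_cat /gst; apply: gauss_iter_ext => s sm.
  rewrite -[RHS](gauss_iter_cst m'); apply: gauss_iter_ext => t tm.
  congr (av _ _ _ _); congr gibbs; apply/funext => x.
  rewrite /Hpath /lin_ham sin_pihalf cos_pihalf /Z mulr0 add0r; congr (_ + _).
  rewrite big_split_ord /= [X in _ + X]big1 ?addr0 => [|i _]; last first.
    by rewrite /d1 ltnNge leq_addr /= /d2 mulr0 mul0r !addr0 mulr0.
  apply: eq_bigr => i _.
  by rewrite /d1 /d0 /d2 ltn_ord nth_cat sm ltn_ord mul1r mulr0 !addr0.
have e0 : phi 0 = gst m' c' W n F.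
  rewrite /phi /ex gauss_iter_cat /gst -[RHS](gauss_iter_cst m).
  apply: gauss_iter_ext => s sm; apply: gauss_iter_ext => t tm.
  congr (av _ _ _ _); congr gibbs; apply/funext => x.
  rewrite /Hpath /lin_ham sin0 cos0 /Z mulr0 add0r; congr (_ + _).
  rewrite big_split_ord /= big1 ?add0r => [|i _]; last first.
    by rewrite /d0 ltn_ord /d2 mulr0 mul0r !addr0 mulr0.
  apply: eq_bigr => i _.
  rewrite /d1 /d0 /d2 ltnNge leq_addr /= addKn mul0r mul1r add0r addr0.
  by rewrite nth_cat sm ltnNge leq_addr /= addKn.
have := sc_bound _ _ 0 0 (pi / 2) dphi _ (lexx 0) _ (lexx _).
rewrite e0 e1 => h; apply/eqP; rewrite -subr_eq0 -normr_le0; apply: h.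
  by move=> th _; rewrite normr0.
by rewrite divr_ge0 // pi_ge0.
Qed.

End CovarianceInvariance.

(** * The cavity path *)

Section Reindex.
Context {R : realType}.

Lemma sum_divmod (n N : nat) (F : nat -> nat -> R) :
  \sum_(a < n * N) F (a %/ N)%N (a %% N)%N = \sum_(i < n) \sum_(j < N) F i j.
Proof.
elim: n => [|n IH]; first by rewrite !big_ord0.
rewrite big_ord_recr /= -IH mulSnr big_split_ord /=; congr (_ + _).
apply: eq_bigr => j _; have N0 : (0 < N)%N by case: (N) j => // -[].
by rewrite divnMDl // divn_small // addn0 modnMDl modn_small.
Qed.

Lemma gibbs_bij {T T' : finType} (f : T' -> T) (H : T -> R) x : bijective f ->
  gibbs (fun y => H (f y)) x = gibbs H (f x).
Proof.
move=> bf; rewrite /gibbs; congr (_ / _).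
by rewrite [RHS](reindex f) //; exact: onW_bij.
Qed.

Lemma av_bij {T : finType} (f : T -> T) (H : T -> R) n (F : (nat -> T) -> R) tau :
  bijective f ->
  av (gibbs H) n F (fun k => f (tau k)) =
  av (gibbs (fun y => H (f y))) n (fun t => F (fun k => f (t k))) tau.
Proof.
move=> bf; elim: n tau => [//|n IH] tau.
rewrite /av -/av /avj [LHS](reindex f) /=; last exact: onW_bij.
apply: eq_bigr => x _; rewrite (gibbs_bij f H x bf) -IH; congr (_ * av _ _ _ _).
by apply/funext => k; rewrite !updE; case: eqP.
Qed.

Lemma gibbs_prod {T1 T2 : finType} (A : T1 -> R) (B : T2 -> R) a b :
  gibbs (fun x : T1 * T2 => A x.1 + B x.2) (a, b) = gibbs A a * gibbs B b.
Proof.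
rewrite /gibbs /= expRD mulf_div; congr (_ / _).
rewrite big_distrl /=; under [RHS]eq_bigr do rewrite big_distrr /=.
rewrite pair_bigA /=; apply: eq_bigr => x _; exact: expRD.
Qed.

Lemma av_prod {T1 T2 : finType} (w1 : T1 -> R) (w2 : T2 -> R) n
  (f : (nat -> T1) -> R) (g : (nat -> T2) -> R) (tau : nat -> T1 * T2) :
  av (fun x => w1 x.1 * w2 x.2) n (fun t => f (fun k => (t k).1) * g (fun k => (t k).2)) tau
  = av w1 n f (fun k => (tau k).1) * av w2 n g (fun k => (tau k).2).
Proof.
elim: n tau => [//|n IH] tau; rewrite /av -/av /avj.
rewrite big_distrl /=; under [RHS]eq_bigr do rewrite big_distrr /=.
rewrite pair_bigA /=; apply: eq_bigr => x _; rewrite IH.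
have e1 : (fun k => (upd tau n x k).1) = upd (fun k => (tau k).1) n x.1.
  by apply/funext => k; rewrite !updE; case: eqP.
have e2 : (fun k => (upd tau n x k).2) = upd (fun k => (tau k).2) n x.2.
  by apply/funext => k; rewrite !updE; case: eqP.
by rewrite e1 e2 mulrACA.
Qed.

Lemma av_split {T T1 T2 : finType} (join : T1 * T2 -> T) (split : T -> T1 * T2)
  (H : T -> R) (A : T1 -> R) (B : T2 -> R) n f g (F : (nat -> T) -> R) tau :
  cancel join split -> cancel split join ->
  (forall x, H x = A (split x).1 + B (split x).2) ->
  (forall t, F t = f (fun k => (split (t k)).1) * g (fun k => (split (t k)).2)) ->
  av (gibbs H) n F tau =
  av (gibbs A) n f (fun k => (split (tau k)).1) *
  av (gibbs B) n g (fun k => (split (tau k)).2).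
Proof.
move=> js sj HE FE.
rewrite -(av_prod _ _ _ _ _ (fun k => split (tau k))).
have -> : (fun x : T1 * T2 => gibbs A x.1 * gibbs B x.2) =
          gibbs (fun x => H (join x)).
  apply/funext => -[a b]; rewrite -[LHS]/(gibbs A a * gibbs B b) -gibbs_prod.
  apply: (congr1 (fun K => gibbs K (a, b))).
  by apply/funext => x; rewrite HE js.
have gen : forall t, av (gibbs H) n F t = av (gibbs (fun x => H (join x))) n
   (fun t => f (fun k => (t k).1) * g (fun k => (t k).2)) (fun k => split (t k)).
  elim: n => [|n IH] t; first exact: FE.
  rewrite /av -/av /avj (reindex join) /=; last by apply: onW_bij; exists split.
  apply: eq_bigr => x _; rewrite IH (gibbs_bij join H x); last by exists split.
  congr (_ * av _ _ _ _).
  by apply/funext => k; rewrite !updE; case: eqP.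
exact: gen.
Qed.

End Reindex.

Section SKModel.
Context {R : realType}.
Variables (S : nat) (beta h D p q : R) (M : nat).
Local Notation N := M.+1.
Local Notation cfg := (config S N).
Local Notation last := (@ord_max M).
Implicit Types (x y : cfg) (t : nat -> cfg) (n k l : nat).

Definition sp x (i : 'I_N) : R := sv S (x i).

Definition cfg0 : nat -> cfg := fun _ => [ffun=> ord0].

Definition csk (a : nat) x : R :=
  if (a %/ N < a %% N)%N then
    beta / Num.sqrt N%:R * sp x (inord (a %/ N)) * sp x (inord (a %% N)) else 0.

Definition Wsk x : R := D * \sum_i sp x i ^+ 2 + h * \sum_i sp x i.

Definition nuN n (F : (nat -> cfg) -> R) : R := gst cfg0 (N * N) csk Wsk n F.

(* Gaussian 0 drives the decoupled last spin; Gaussian [b.+1] is the coupling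
   [b = i * N + j], which is switched off at angle 0 when [j] is the last site. *)
Definition k1 (a : nat) x : R :=
  if a is b.+1 then (if (b %% N == M)%N then csk b x else 0) else 0.
Definition k0 (a : nat) x : R :=
  if a is 0 then beta * Num.sqrt q * sp x last else 0.
Definition k2 (a : nat) x : R :=
  if a is b.+1 then (if (b %% N == M)%N then 0 else csk b x) else 0.
(** For equal replicas the couplings of the last spin have covariance close to beta^2 p times the
    squared spins, the decoupled field has beta^2 q. Half of the difference, as a potential on the
    squared spin, restores the balance and gives the potential in [weta]. *)
Definition W0 x : R := beta ^+ 2 / 2 * (p - q) * sp x last ^+ 2.

Definition nuc th n (F : (nat -> cfg) -> R) : R :=
  ex cfg0 (N * N).+1 k1 k0 k2 W0 Wsk th n F.

Lemma nuc_pi2 n F : nuc (pi / 2) n F = nuN n F.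
Proof.
rewrite /nuc /ex /nuN /gst; move: (N * N)%N => K /=; rewrite -[RHS]gauss1_cst; congr gauss1; apply/funext => z.
apply: gauss_iter_ext => s _; congr (av _ _ _ _); congr gibbs; apply/funext => x.
rewrite /Hpath /lin_ham sin_pihalf cos_pihalf big_ord_recl /= expr0n /= !mul0r add0r.
rewrite mulr0 !addr0 mulr0 add0r; congr (_ + _); apply: eq_bigr => a _ /=.
by rewrite add0n mul1r addr0; case: ifP; rewrite ?addr0 ?add0r.
Qed.

Lemma Cov_csk x y : Cov (N * N) csk x y =
  beta ^+ 2 / N%:R *
    \sum_(i < N) \sum_(j < N | (i < j)%N) (sp x i * sp y i) * (sp x j * sp y j).
Proof.
have sN : Num.sqrt N%:R ^+ 2 = N%:R :> R by rewrite sqr_sqrtr.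
rewrite /Cov (sum_divmod N N (fun i j : nat => (if (i < j)%N then
    beta / Num.sqrt N%:R * sp x (inord i) * sp x (inord j) else 0) *
    (if (i < j)%N then beta / Num.sqrt N%:R * sp y (inord i) * sp y (inord j) else 0))).
rewrite mulr_sumr; apply: eq_bigr => i _; rewrite mulr_sumr [RHS]big_mkcond /=.
apply: eq_bigr => j _; rewrite !inord_val; case: ifP => _; last by rewrite mul0r.
have : Num.sqrt N%:R != 0 :> R by rewrite gt_eqF // sqrtr_gt0.
by move: sN; move: (Num.sqrt _) => c <- c0; field.
Qed.

(** Exhibits the covariance of the couplings as a function of symmetric sums over the sites,
    although the couplings themselves are ordered pairs. *)
Lemma sum_pairs_lt (f : 'I_N -> R) :
  2 * \sum_(i < N) \sum_(j < N | (i < j)%N) f i * f j = (\sum_i f i) ^+ 2 - \sum_i f i ^+ 2.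
Proof.
have e1 : (\sum_i f i) ^+ 2 = \sum_i \sum_j f i * f j.
  by rewrite expr2 mulr_suml; apply: eq_bigr => i _; rewrite mulr_sumr.
have e2 : \sum_i \sum_j f i * f j = \sum_(i < N) \sum_(j < N | (i < j)%N) f i * f j +
   \sum_(i < N) \sum_(j < N | (j < i)%N) f i * f j + \sum_i f i ^+ 2.
  rewrite -!big_split /=; apply: eq_bigr => i _.
  rewrite (bigD1 i) //= (bigID (fun j : 'I_N => (i < j)%N)) /= -expr2 addrC; congr (_ + _ + _).
    apply: eq_bigl => j; case: ltnP => h'; rewrite ?andbF // andbT.
    by move: h'; apply: contraTneq => ->; rewrite ltnn.
  by apply: eq_bigl => j; rewrite -leqNgt ltn_neqAle -val_eqE.
have e3 : \sum_(i < N) \sum_(j < N | (j < i)%N) f i * f j = \sum_(i < N) \sum_(j < N | (i < j)%N) f i * f j.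
  rewrite (exchange_big_dep xpredT) //=.
  by apply: eq_bigr => i _; apply: eq_bigr => j _; rewrite mulrC.
rewrite e1 e2 e3; ring.
Qed.

Definition swapcfg (i : 'I_N) x : cfg := [ffun j => x (tperm i last j)].

Lemma swapcfgK i : involutive (swapcfg i).
Proof. by move=> x; apply/ffunP => j; rewrite !ffunE tpermK. Qed.

(** A swap may send a coupling with i < j to one with i > j, so the Hamiltonian changes as a
    function of the Gaussians. Its covariance does not, and [gst_cov] concludes. *)
Lemma nuN_swap i n F : depn n F ->
  nuN n (fun t => F (fun k => swapcfg i (t k))) = nuN n F.
Proof.
move=> dF; have bf : bijective (swapcfg i) by exists (swapcfg i); exact: swapcfgK.
have rs (G : 'I_N -> R) : \sum_j G (tperm i last j) = \sum_j G j.
  by rewrite [RHS](reindex_inj (@perm_inj _ (tperm i last))).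
transitivity (gst cfg0 (N * N) (fun a x => csk a (swapcfg i x)) Wsk n F); last first.
  apply: gst_cov => // x y; have n2 : (2 : R) != 0 by [].
  apply: (mulfI n2).
  rewrite (_ : Cov _ (fun a x => _) x y = Cov (N * N) csk (swapcfg i x) (swapcfg i y)) //.
  rewrite !Cov_csk !(mulrCA 2) !sum_pairs_lt; congr (_ * (_ ^+ 2 - _)).
    rewrite -[RHS](rs (fun j => sp x j * sp y j)); apply: eq_bigr => j _.
    by rewrite /sp !ffunE.
  rewrite -[RHS](rs (fun j => (sp x j * sp y j) ^+ 2)); apply: eq_bigr => j _.
  by rewrite /sp !ffunE.
rewrite /nuN /gst; apply: gauss_iter_ext => s _.
have -> : lin_ham (N * N) (fun a x => csk a (swapcfg i x)) Wsk s =
  (fun x => lin_ham (N * N) csk Wsk s (swapcfg i x)).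
  apply/funext => x; rewrite /lin_ham; congr (_ + _); rewrite /Wsk.
  congr (_ * _ + _ * _).
    rewrite -[LHS](rs (fun j => sp x j ^+ 2)); apply: eq_bigr => j _.
    by rewrite /sp !ffunE.
  by rewrite -[LHS](rs (fun j => sp x j)); apply: eq_bigr => j _; rewrite /sp !ffunE.
have c0E : cfg0 = (fun k => swapcfg i (cfg0 k)).
  by apply/funext => k; apply/ffunP => j; rewrite !ffunE.
have sw2 : (fun y => lin_ham (N * N) csk Wsk s (swapcfg i (swapcfg i y))) =
   lin_ham (N * N) csk Wsk s by apply/funext => y; rewrite swapcfgK.
rewrite [in RHS]c0E.
rewrite (av_bij (swapcfg i) (fun x => lin_ham (N * N) csk Wsk s (swapcfg i x)) n F cfg0 bf).
by rewrite sw2.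
Qed.

Definition qq k l : R := if k == l then p else q.
Definition es (i : 'I_N) k l t : R := sp (t k) i * sp (t l) i - qq k l.
(* [X] is sqrt N times the overlap fluctuation U_kl, and [dl] is 1 / sqrt N. *)
Definition dl : R := (Num.sqrt N%:R)^-1.
Definition X k l t : R := dl * \sum_i es i k l t.
Definition Xm k l t : R := dl * \sum_(i | i != last) es i k l t.
Definition el k l t : R := es last k l t.

Lemma X_Xm k l t : X k l t = Xm k l t + dl * el k l t.
Proof. by rewrite /X (bigD1 last) //= addrC mulrDr. Qed.

Lemma dl_gt0 : 0 < dl.
Proof. by rewrite invr_gt0 sqrtr_gt0. Qed.

Lemma dl2 : dl ^+ 2 = N%:R^-1.
Proof. by rewrite exprVn sqr_sqrtr. Qed.

Lemma dl_le1 : dl <= 1.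
Proof. by rewrite invf_le1 ?sqrtr_gt0 // -[leLHS]sqrtr1 ler_wsqrtr // ler1n. Qed.

Hypothesis q0 : 0 <= q.

Definition Qcav n t : R := beta ^+ 2 / 2 *
  Qsum n (fun k l => sp (t k) last * sp (t l) last * (Xm k l t - dl * qq k l)).

(** The covariance of the couplings to the last site is governed by the overlap of the other sites;
    subtracting its target leaves a fluctuation of size [dl]. The term [dl * qq] in [Qcav] appears
    because [Xm] centres N - 1 sites while the normalisation is by N. *)
Lemma Qpath_cavity n t : Qpath (N * N).+1 k1 k0 W0 n t = dl * Qcav n t.
Proof.
have sN : Num.sqrt N%:R ^+ 2 = N%:R :> R by rewrite sqr_sqrtr.
have C1 x y : Cov (N * N).+1 k1 x y =
   beta ^+ 2 / N%:R * (sp x last * sp y last) * \sum_(i | i != last) sp x i * sp y i.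
  rewrite /Cov big_ord_recl (_ : k1 ord0 x = 0) // mul0r add0r.
  pose G (i j : nat) : R := if (j == M) && (i < j)%N then
    beta / Num.sqrt N%:R * sp x (inord i) * sp x (inord j) *
    (beta / Num.sqrt N%:R * sp y (inord i) * sp y (inord j)) else 0.
  transitivity (\sum_(a < N * N) G (a %/ N)%N (a %% N)%N).
    apply: eq_bigr => a _; rewrite lift0 /= /csk /G.
    by case: ifP => _ /=; rewrite ?mul0r //; case: ifP; rewrite ?mul0r.
  rewrite sum_divmod mulr_sumr [RHS]big_mkcond /=; apply: eq_bigr => i _; rewrite /G.
  rewrite (bigD1 last) //= big1 ?addr0 => [|j jl]; last first.
    by rewrite (_ : (j == M :> nat) = false) //; apply/negbTE; rewrite -val_eqE in jl.
  rewrite eqxx /= !inord_val (_ : inord M = last); last by apply/val_inj; rewrite /= inordK.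
  have -> : (i < M)%N = (i != last) by rewrite ltn_neqAle -ltnS ltn_ord andbT.
  case: ifP => // _.
  have : Num.sqrt N%:R != 0 :> R by rewrite gt_eqF // sqrtr_gt0.
  by move: sN; move: (Num.sqrt _) => c <- c0; field.
have C0 x y : Cov (N * N).+1 k0 x y = beta ^+ 2 * q * (sp x last * sp y last).
  rewrite /Cov big_ord_recl big1 ?addr0 => [|i _]; last by rewrite lift0 mul0r.
  rewrite (_ : k0 ord0 x = beta * Num.sqrt q * sp x last) // (_ : k0 ord0 y = beta * Num.sqrt q * sp y last) //.
  by rewrite -[in RHS](sqr_sqrtr q0); ring.
rewrite /Qpath /Qcav [RHS]mulrCA [RHS]mulrA -!QsumZ; apply: Qsum_ext => k l _ _.
rewrite C1 C0 /W0.
have -> : Xm k l t = dl * \sum_(i | i != last) sp (t k) i * sp (t l) i - dl * M%:R * qq k l.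
  rewrite /Xm /es sumrB mulrBr sumr_const; congr (_ - _).
  rewrite (_ : #|_| = M) ?mulr_natl -?mulrA ?mulr_natl //.
  transitivity #|predC1 last|; last by rewrite cardC1 card_ord.
  by apply: eq_card => i; rewrite !inE.
set s := \sum_(i | _) _.
have d2 := dl2.
have N0 : (N%:R : R) != 0 by rewrite pnatr_eq0.
rewrite (_ : 2^-1 * _ = beta ^+ 2 / 2 * (sp (t k) last * sp (t l) last) *
   (N%:R^-1 * s - qq k l)); last first.
  rewrite /qq; case: eqP => [->|_]; first by field.
  by rewrite subr0; field.
rewrite (_ : dl * s - _ - _ = dl * (s - N%:R * qq k l)); last by rewrite -natr1; ring.
rewrite -d2 [in RHS](_ : beta ^+ 2 / 2 * _ * _ =
  beta ^+ 2 / 2 * (sp (t k) last * sp (t l) last) * (dl ^+ 2 * (s - N%:R * qq k l))); last by ring.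
by congr (_ * _); rewrite mulrBr mulrA d2 mulVf // mul1r.
Qed.

End SKModel.

(** * Decoupling of the last spin at angle 0 *)

Section CavitySplit.
Context {R : realType}.
Variables (S : nat) (beta h D p q : R) (M : nat).
Local Notation N := M.+1.
Local Notation cfg := (config S N).
Local Notation last := (@ord_max M).
Local Notation cskM := (@csk R S beta M).
Local Notation spM := (@sp R S M).
Implicit Types (t : nat -> cfg) (n : nat).

Definition one_field (s : spin S) : R := beta * Num.sqrt q * sv S s.
Definition one_pot (s : spin S) : R :=
  h * sv S s + (D + beta ^+ 2 / 2 * (p - q)) * sv S s ^+ 2.

Definition E1 n (g : (nat -> spin S) -> R) : R :=
  gst (fun _ => ord0) 1 (fun _ => one_field) one_pot n g.

Definition nolast (f : (nat -> cfg) -> R) :=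
  forall t t', (forall k i, i != last -> t k i = t' k i) -> f t = f t'.

Definition joinc (u : config S M * spin S) : cfg :=
  [ffun i => if unlift last i is Some j then u.1 j else u.2].

Definition splitc (x : cfg) : config S M * spin S :=
  ([ffun j => x (lift last j)], x last).

Lemma joincK : cancel joinc splitc.
Proof.
move=> [a b]; rewrite /splitc /joinc; congr pair.
  by apply/ffunP => j; rewrite !ffunE liftK.
by rewrite ffunE unlift_none.
Qed.

Lemma splitcK : cancel splitc joinc.
Proof.
move=> x; apply/ffunP => i; rewrite ffunE /=; case: unliftP => [j ->|-> //].
by rewrite ffunE.
Qed.

Definition HA (s : seq R) (x : cfg) : R :=
  \sum_(a < N * N) s`_a * (if (a %% N == M)%N then 0 else cskM a x)
  + (D * \sum_(i | i != last) spM x i ^+ 2 + h * \sum_(i | i != last) spM x i).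

(** State of the other sites. The last spin is frozen at the arbitrary value [ord0], which neither
    [HA] nor an [f] with [nolast] can see. *)
Definition rest_state n (f : (nat -> cfg) -> R) : R :=
  gauss_iter (N * N) (fun s => av (gibbs (fun u => HA s (joinc (u, ord0)))) n
    (fun tau => f (fun k => joinc (tau k, ord0))) (fun k => (splitc (cfg0 S M k)).1)).

Lemma HA_nolast s (x x' : cfg) : (forall i, i != last -> x i = x' i) -> HA s x = HA s x'.
Proof.
move=> xx; rewrite /HA; congr (_ + (_ * _ + _ * _)).
- apply: eq_bigr => a _; case: ifPn => // aM; congr (_ * _); rewrite /csk /sp.
  case: ifP => // lt.
  have aN : (a %% N < N)%N by rewrite ltn_mod.
  by rewrite !xx // -val_eqE /= inordK //; lia.
- by apply: eq_bigr => i il; rewrite /sp xx.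
- by apply: eq_bigr => i il; rewrite /sp xx.
Qed.

Lemma joinc_split (x : cfg) s i : i != last -> joinc ((splitc x).1, s) i = x i.
Proof.
move=> il; rewrite ffunE /=; case: unliftP => [j ->|e]; first by rewrite ffunE.
by rewrite e eqxx in il.
Qed.

Lemma nuc0_rest n f g : nolast f ->
  nuc S beta h D p q M 0 n (fun t => f t * g (fun k => t k last)) =
  rest_state n f * E1 n g.
Proof.
move=> nf; rewrite /nuc /ex /E1 /gst /rest_state.
set G := fun s => av (gibbs (fun u => HA s (joinc (u, ord0)))) n
    (fun tau => f (fun k => joinc (tau k, ord0))) (fun k => (splitc (cfg0 S M k)).1).
have tG : tame (N * N) G.
  apply: (tame_av _ _ _ (fun _ tau => f (fun k => joinc (tau k, ord0)))) => [u|tau]; last exact: tame_cst.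
  apply: tame_add; last exact: tame_cst.
  by apply: tame_sum => a _; apply: tame_mul; [exact: tame_nth|exact: tame_cst].
set Fz := fun u : seq R => av (gibbs (lin_ham 1 (fun _ => one_field) one_pot u)) n g (fun _ => ord0).
have tFz : tame 1 Fz.
  apply: (tame_av _ _ _ (fun _ => g)) => [u|tau]; last exact: tame_cst.
  apply: tame_add; last exact: tame_cst.
  by apply: tame_sum => a _; apply: tame_mul; [exact: tame_nth|exact: tame_cst].
transitivity (gauss1 (fun z => gauss_iter (N * N) G * Fz [:: z])); last first.
  have [k [K tk]] := gauss_iter_tame1 _ _ tFz.
  by rewrite gauss1Z //; exact: tame1_gintegrable tk.
congr gauss1; apply/funext => z; rewrite -/(gauss_iter _ _) mulrC -gauss_iterZ //.
apply: gauss_iter_ext => s _; rewrite mulrC.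
rewrite (av_split joinc splitc _ (fun u => HA s (joinc (u, ord0)))
  (lin_ham 1 (fun _ => one_field) one_pot [:: z]) n
  (fun tau => f (fun k => joinc (tau k, ord0))) g); last 4 first.
- exact: joincK.
- exact: splitcK.
- move=> x; rewrite (HA_nolast s _ x); last by move=> i il; exact: joinc_split.
  rewrite /Hpath /lin_ham big_ord1 /= sin0 cos0 big_ord_recl.
  rewrite [k1 _ _ _ _ _]/= [k2 _ _ _ _ _]/= [k0 _ _ _ _ _ _]/= !mul1r mulr0 add0r addr0.
  have -> : \sum_(i < N * N) (z :: s)`_(lift ord0 i) * (0 * k1 S beta M (lift ord0 i) x +
      1 * k0 S beta q M (lift ord0 i) x + k2 S beta M (lift ord0 i) x) =
     \sum_(a < N * N) s`_a * (if (a %% N == M)%N then 0 else cskM a x).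
    by apply: eq_bigr => i _; rewrite lift0 /= mul0r mulr0 !add0r.
  rewrite /HA /W0 /Wsk /one_field /one_pot (bigD1 last) //= [\sum_i spM x i](bigD1 last) //=.
  rewrite expr1n.
  rewrite /sp; ring.
- move=> t; congr (_ * _); apply: nf => k i il.
  by rewrite joinc_split.
rewrite /G /Fz; congr (_ * av _ _ _ _).
by apply/funext => k; rewrite /= ffunE.
Qed.

Lemma E1_cst n (c : R) : E1 n (fun _ => c) = c.
Proof.
rewrite /E1 /gst -[RHS](gauss_iter_cst 1); apply: gauss_iter_ext => s _.
by rewrite av_cst //; exact: (sum_gibbs (ord0 : spin S)).
Qed.

(** Taking [g = 1] in [nuc0_rest] identifies the factor of the other sites with the path average of
    [f] itself. *)
Lemma nuc0_split n f g : nolast f ->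
  nuc S beta h D p q M 0 n (fun t => f t * g (fun k => t k last)) =
  nuc S beta h D p q M 0 n f * E1 n g.
Proof.
move=> nf; rewrite nuc0_rest //; congr (_ * _).
have := nuc0_rest n f (fun _ => 1) nf; rewrite E1_cst mulr1 => <-.
by apply: ex_ext => t; rewrite mulr1.
Qed.

End CavitySplit.

Section GstFacts.
Context {R : realType} {T : finType}.
Variable tau0 : nat -> T.
Implicit Types (F G : (nat -> T) -> R).

Lemma ex_le m c1 c0 c2 (W0 W2 : T -> R) th n F G : (forall t, F t <= G t) ->
  ex tau0 m c1 c0 c2 W0 W2 th n F <= ex tau0 m c1 c0 c2 W0 W2 th n G.
Proof.
move=> FG; apply: gauss_iter_le; [exact: tame_av_path|exact: tame_av_path|].
by move=> s _; apply: av_le => // x; exact: gibbs_ge0.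
Qed.

Lemma ex_cst m c1 c0 c2 (W0 W2 : T -> R) th n (c : R) :
  ex tau0 m c1 c0 c2 W0 W2 th n (fun _ => c) = c.
Proof.
rewrite -[RHS](gauss_iter_cst m); apply: gauss_iter_ext => s _.
by rewrite av_cst //; exact: (sum_gibbs (tau0 0%N)).
Qed.

Lemma ex_extend m c1 c0 c2 (W0 W2 : T -> R) th n k F : depn n F ->
  ex tau0 m c1 c0 c2 W0 W2 th (n + k) F = ex tau0 m c1 c0 c2 W0 W2 th n F.
Proof.
move=> dF; apply: gauss_iter_ext => s _.
by rewrite av_extend //; exact: (sum_gibbs (tau0 0%N)).
Qed.

Lemma ex_pair m c1 c0 c2 (W0 W2 : T -> R) th n n' k l k' l' (V : T -> T -> R) :
  (k < n)%N -> (l < n)%N -> (k' < n')%N -> (l' < n')%N -> (k == l) = (k' == l') ->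
  ex tau0 m c1 c0 c2 W0 W2 th n (fun t => V (t k) (t l)) =
  ex tau0 m c1 c0 c2 W0 W2 th n' (fun t => V (t k') (t l')).
Proof.
move=> kn ln kn' ln' kl; apply: gauss_iter_ext => s _.
have w1 := sum_gibbs (tau0 0%N) (Hpath m c1 c0 c2 W0 W2 th s).
have [e|ne] := eqVneq k l.
  have /eqP e' : k' == l' by rewrite -kl e.
  rewrite -e -e'; rewrite (av1_eq _ _ _ (fun x => V x x)) //.
  by rewrite (av1_eq _ _ _ (fun x => V x x)).
by rewrite !av2_eq // -kl.
Qed.

End GstFacts.

Section NucFacts.
Context {R : realType}.
Variables (S : nat) (beta h D p q : R).
Hypothesis q0 : 0 <= q.
Local Notation cfg M := (config S M.+1).
Local Notation nuc M := (nuc S beta h D p q M).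
Local Notation nuN M := (nuN S beta h D M).
Implicit Types (M n : nat) (th : R).

Lemma nuc_le M th n (F G : (nat -> cfg M) -> R) :
  (forall t, F t <= G t) -> nuc M th n F <= nuc M th n G.
Proof. exact: ex_le. Qed.

Lemma nuc_cst M th n (c : R) : nuc M th n (fun _ => c) = c.
Proof. exact: ex_cst. Qed.

Lemma nucD M th n (F G : (nat -> cfg M) -> R) :
  nuc M th n (fun t => F t + G t) = nuc M th n F + nuc M th n G.
Proof. exact: exD. Qed.

Lemma nucZ M th n (c : R) (F : (nat -> cfg M) -> R) :
  nuc M th n (fun t => c * F t) = c * nuc M th n F.
Proof. exact: exZ. Qed.

Lemma nuc_ext M th n (F G : (nat -> cfg M) -> R) :
  (forall t, F t = G t) -> nuc M th n F = nuc M th n G.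
Proof. exact: ex_ext. Qed.

Lemma nucB M th n (F G : (nat -> cfg M) -> R) :
  nuc M th n (fun t => F t - G t) = nuc M th n F - nuc M th n G.
Proof. by rewrite -mulN1r -nucZ -nucD; apply: nuc_ext => t; rewrite mulN1r. Qed.

Lemma nuc_sum M th n (I : Type) (r : seq I) (P : pred I) (H : I -> (nat -> cfg M) -> R) :
  nuc M th n (fun t => \sum_(i <- r | P i) H i t) = \sum_(i <- r | P i) nuc M th n (H i).
Proof. exact: ex_sum. Qed.

Lemma nuc_abs M th n (F G : (nat -> cfg M) -> R) :
  (forall t, `|F t| <= G t) -> `|nuc M th n F| <= nuc M th n G.
Proof.
move=> FG; rewrite ler_norml -mulN1r -nucZ; apply/andP; split; apply: nuc_le => t.
  by rewrite mulN1r lerNl; apply: le_trans (FG t); rewrite -normrN ler_norm.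
by apply: le_trans (FG t); exact: ler_norm.
Qed.

Lemma nuc_extend M th n k (F : (nat -> cfg M) -> R) : depn n F ->
  nuc M th (n + k) F = nuc M th n F.
Proof. exact: ex_extend. Qed.

Lemma nuc_pair M th n n' k l k' l' (V : cfg M -> cfg M -> R) :
  (k < n)%N -> (l < n)%N -> (k' < n')%N -> (l' < n')%N -> (k == l) = (k' == l') ->
  nuc M th n (fun t => V (t k) (t l)) = nuc M th n' (fun t => V (t k') (t l')).
Proof. exact: ex_pair. Qed.

Lemma nuc_derive M n (F : (nat -> cfg M) -> R) : depn n F ->
  sc_derive (fun th => nuc M th n F)
            (fun th => dl M * nuc M th n.+2 (fun t => F t * Qcav S beta p q M n t)).
Proof.
move=> dF th; rewrite -nucZ.
have -> : nuc M th n.+2 (fun t => dl M * (F t * Qcav S beta p q M n t)) =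
  ex (cfg0 S M) (M.+1 * M.+1).+1 (k1 S beta M) (k0 S beta q M) (k2 S beta M)
    (W0 S beta p q M) (Wsk S h D M) th n.+2
    (fun t => F t * Qpath (M.+1 * M.+1).+1 (k1 S beta M) (k0 S beta q M) (W0 S beta p q M) n t).
  by apply: nuc_ext => t; rewrite Qpath_cavity //; ring.
apply: is_derive_ex; last exact: dF.
- by move=> [|a] x y; rewrite /= ?mulr0 ?mul0r.
- by move=> [|a] x y; rewrite /= ?mulr0 ?mul0r //; case: ifP; rewrite ?mulr0 ?mul0r.
- by move=> [|a] x y; rewrite /= ?mulr0 ?mul0r.
Qed.

Lemma depn_Qcav M n (F : (nat -> cfg M) -> R) : depn n F ->
  depn n.+2 (fun t => F t * Qcav S beta p q M n t).
Proof.
move=> dF j nj t x; rewrite dF; last by lia.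
congr (_ * _); rewrite /Qcav; congr (_ * _); apply: Qsum_ext => k l kn ln.
have u a : (a < n.+2)%N -> upd t j x a = t a by move=> an; rewrite updE ltn_eqF //; lia.
by rewrite /Xm /es !u.
Qed.

Lemma depn_X M n k l : (k < n)%N -> (l < n)%N -> depn n (@X R S p q M k l).
Proof.
move=> kn ln j nj t x; rewrite /X /es !updE !ltn_eqF //; lia.
Qed.

Lemma depn_Xm M n k l : (k < n)%N -> (l < n)%N -> depn n (@Xm R S p q M k l).
Proof.
move=> kn ln j nj t x; rewrite /Xm /es !updE !ltn_eqF //; lia.
Qed.

Lemma depn_el M n k l : (k < n)%N -> (l < n)%N -> depn n (@el R S p q M k l).
Proof.
move=> kn ln j nj t x; rewrite /el /es !updE !ltn_eqF //; lia.
Qed.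

Lemma depnM {T : finType} n (F G : (nat -> T) -> R) : depn n F -> depn n G ->
  depn n (fun t => F t * G t).
Proof. by move=> dF dG j nj t x; rewrite dF ?dG. Qed.

Lemma depnX {T : finType} n k (F : (nat -> T) -> R) : depn n F -> depn n (fun t => F t ^+ k).
Proof. by move=> dF j nj t x; rewrite dF. Qed.

Definition site_sym M (f : (nat -> cfg M) -> R) :=
  forall i t, f (fun k => swapcfg S M i (t k)) = f t.

Lemma X_site_sym M k l : site_sym M (X S p q M k l).
Proof.
move=> i t; rewrite /X; congr (_ * _).
rewrite [RHS](reindex_inj (@perm_inj _ (tperm i ord_max))) /=.
by apply: eq_bigr => j _; rewrite /es /sp !ffunE.
Qed.

(** By symmetry the N sites contribute equally to [X], and N terms with prefactor 1 / sqrt N leave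
    sqrt N. *)
Lemma nuN_site M n k l (f : (nat -> cfg M) -> R) :
  (k < n)%N -> (l < n)%N -> depn n f -> site_sym M f ->
  nuN M n (fun t => X S p q M k l t * f t) =
  Num.sqrt M.+1%:R * nuN M n (fun t => el S p q M k l t * f t).
Proof.
move=> kn ln df sf; rewrite -!(nuc_pi2 S beta h D p q).
have -> : nuc M (pi / 2) n (fun t => X S p q M k l t * f t) =
  dl M * \sum_(i < M.+1) nuc M (pi / 2) n (fun t => es S p q M i k l t * f t).
  rewrite -nuc_sum -nucZ; apply: nuc_ext => t.
  by rewrite /X -mulr_suml mulrA.
have E i : nuc M (pi / 2) n (fun t => es S p q M i k l t * f t) =
   nuc M (pi / 2) n (fun t => el S p q M k l t * f t).
  rewrite !nuc_pi2 -(nuN_swap S beta h D M i n (fun t => el S p q M k l t * f t)).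
    congr gauss_iter; apply/funext => s; congr (av _ _ _ _); apply/funext => t; rewrite sf; congr (_ * _).
    by rewrite /el /es /sp !ffunE tpermR.
  by apply: depnM => //; exact: depn_el.
rewrite (eq_bigr _ (fun i _ => E i)).
set c := nuc M _ _ _; rewrite (_ : \sum_i c = M.+1%:R * c); last first.
  by rewrite sumr_const card_ord mulr_natl.
rewrite mulrA.
congr (_ * _); rewrite /dl.
have : Num.sqrt M.+1%:R ^+ 2 = M.+1%:R :> R by rewrite sqr_sqrtr.
have : Num.sqrt M.+1%:R != 0 :> R by rewrite gt_eqF // sqrtr_gt0.
by move: (Num.sqrt _) => r r0 <-; field.
Qed.

End NucFacts.

(** * The one-site measure and consequences of the fixed-point equations *)

Section OneSite.
Context {R : realType}.
Variables (S : nat) (beta h D p q : R).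
Local Notation E1 := (E1 S beta h D p q).

Definition w1 (e : R) : spin S -> R :=
  gibbs (lin_ham 1 (fun _ => one_field S beta q) (one_pot S beta h D p q) [:: e]).

Lemma E1_gauss1 n g : E1 n g = gauss1 (fun e => av (w1 e) n g (fun _ => ord0)).
Proof. by []. Qed.

Lemma mj_w1 j e : mj S beta h D p q j e = \sum_s w1 e s * sv S s ^+ j.
Proof.
have we s : weta S beta h D p q e s =
  expR (lin_ham 1 (fun _ => one_field S beta q) (one_pot S beta h D p q) [:: e] s).
  rewrite /weta /lin_ham big_ord1 /= /one_field /one_pot; congr expR; ring.
rewrite /mj /w1 /gibbs; under eq_bigr do rewrite we.
under [X in _ / X]eq_bigr do rewrite we.
rewrite mulr_suml; apply: eq_bigr => s _. by rewrite [RHS]mulrC mulrA.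
Qed.

Lemma sum_w1 e : \sum_s w1 e s = 1.
Proof. exact: (sum_gibbs (ord0 : spin S)). Qed.

Hypothesis fp : fixed_point S beta h D p q.

(** The fixed-point equations in replica form: given eta, distinct replicas are independent and
    produce m_1^2, equal ones produce m_2. *)
Lemma E1_pair n k l : (k < n)%N -> (l < n)%N ->
  E1 n (fun t => sv S (t k) * sv S (t l)) = qq p q k l.
Proof.
move=> kn ln; rewrite E1_gauss1 /qq; case: fp => eq ep; case: eqVneq => [<-|kl].
  rewrite [RHS]ep; congr gauss1; apply/funext => e.
  by rewrite (av1_eq _ _ _ (fun x => sv S x * sv S x)) ?sum_w1 // mj_w1.
rewrite [RHS]eq; congr gauss1; apply/funext => e.
rewrite (av2_eq (w1 e) n k l (fun x y => sv S x * sv S y) _ (sum_w1 e) kn ln kl).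
rewrite mj_w1 expr2.
rewrite mulr_suml; apply: eq_bigr => x _; rewrite -mulrA; congr (_ * _).
by rewrite mulr_sumr; apply: eq_bigr => y _; rewrite mulrCA.
Qed.

Lemma abs_sv (s : spin S) : `|sv S s| <= S%:R :> R.
Proof.
rewrite ler_norml /sv; apply/andP; split.
  by rewrite lerBrDr addNr ler0n.
by rewrite lerBlDr -natrD ler_nat -ltnS addnn; exact: ltn_ord.
Qed.

Lemma E1_abs n g (B : R) : (forall t, `|g t| <= B) -> `|E1 n g| <= B.
Proof.
move=> gB; have B0 : 0 <= B by exact: le_trans (gB (fun _ => ord0)).
have tg : tame 1 (fun u => av (gibbs (lin_ham 1 (fun _ => one_field S beta q) (one_pot S beta h D p q) u)) n g (fun _ => ord0)).
  apply: (tame_av _ _ _ (fun _ => g)) => [u|tau]; last exact: tame_cst.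
  apply: tame_add; last exact: tame_cst.
  by apply: tame_sum => a _; apply: tame_mul; [exact: tame_nth|exact: tame_cst].
have b u : `|av (gibbs (lin_ham 1 (fun _ => one_field S beta q) (one_pot S beta h D p q) u)) n g (fun _ => ord0)| <= B.
  rewrite -[leRHS](av_cst (gibbs (lin_ham 1 (fun _ => one_field S beta q) (one_pot S beta h D p q) u)) n B (fun _ => ord0)); last exact: (sum_gibbs (ord0 : spin S)).
  by apply: av_abs_le => //; exact: gibbs_ge0.
have := gauss_iter_bound 1 0 B _ tg.
rewrite /mpk (_ : pk 0 = fun _ => 1); last by apply/funext => x; rewrite /pk expr0.
rewrite gauss1_cst expr1n mulr1; apply => s _.
by apply: (le_trans (b s)); rewrite ler_peMr // pks_ge1.
Qed.

Lemma q_ge0 : 0 <= q.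
Proof. by case: fp => -> _; apply: gauss1_ge0 => x; exact: sqr_ge0. Qed.

Lemma abs_svM (s s' : spin S) : `|sv S s * sv S s'| <= S%:R ^+ 2 :> R.
Proof. by rewrite normrM expr2 ler_pM ?abs_sv. Qed.

(** Bounds p and q for any solution of the fixed-point equations, so that the smallness condition on
    beta involves [S] only. *)
Lemma abs_qq k l : `|qq p q k l| <= S%:R ^+ 2.
Proof.
rewrite -(@E1_pair (maxn k l).+1 k l) ?ltnS ?leq_maxl ?leq_maxr //.
by apply: E1_abs => t; exact: abs_svM.
Qed.

Lemma abs_es M i k l (t : nat -> config S M.+1) : `|es S p q M i k l t| <= 2 * S%:R ^+ 2.
Proof.
rewrite mulrDl mul1r (le_trans (ler_normB _ _)) // lerD ?abs_qq //; exact: abs_svM.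
Qed.

Lemma abs_Xt M k l (t : nat -> config S M.+1) :
  `|dl M * (Xm S p q M k l t - dl M * qq p q k l)| <= 2 * S%:R ^+ 2.
Proof.
have d0 : 0 <= dl M :> R by exact: ltW (dl_gt0 M).
have -> : dl M * (Xm S p q M k l t - dl M * qq p q k l) =
  M.+1%:R^-1 * (\sum_(i | i != ord_max) es S p q M i k l t - qq p q k l).
  by rewrite -dl2 /Xm; ring.
rewrite normrM ger0_norm ?invr_ge0 //.
rewrite ler_pdivrMl ?ltr0n // (le_trans (ler_normB _ _)) //.
have -> : M.+1%:R * (2 * S%:R ^+ 2) = \sum_(i < M.+1) (2 * S%:R ^+ 2) :> R.
  by rewrite sumr_const card_ord mulr_natl.
rewrite [leRHS](bigD1 ord_max) //= addrC lerD //; last first.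
  by apply: (le_trans (abs_qq k l)); rewrite ler_peMl // ?exprn_ge0 // ler1n.
by rewrite (le_trans (ler_norm_sum _ _ _)) // ler_sum // => i _; exact: abs_es.
Qed.

Hypothesis beta0 : 0 < beta.
Hypothesis betaS : beta * S%:R ^+ 2 <= 200%:R^-1.

Lemma betaS2 : beta ^+ 2 * (S%:R ^+ 2 * S%:R ^+ 2) <= 200^-1 ^+ 2.
Proof.
have a0 : 0 <= S%:R ^+ 2 :> R by rewrite exprn_ge0.
have -> : beta ^+ 2 * (S%:R ^+ 2 * S%:R ^+ 2) = (beta * S%:R ^+ 2) ^+ 2 by ring.
have x0 : 0 <= beta * S%:R ^+ 2 by rewrite mulr_ge0 // ltW.
have c0 : 0 <= 200%:R^-1 :> R by rewrite invr_ge0 ler0n.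
by move: betaS x0 c0; move: (_ * _) (_^-1) => x c xc x0 c0; rewrite lerXn2r.
Qed.

(** The factors are beta^2 / 2, the total weight 36, and S^2 times 2 S^2 for an entry: 36 beta^2
    S^4, far below 1/2. *)
Lemma Qcav2_gronwall M (t : nat -> config S M.+1) :
  `|dl M * Qcav S beta p q M 2 t| <= 2^-1.
Proof.
rewrite /Qcav mulrCA -QsumZ normrM ger0_norm; last first.
  by rewrite divr_ge0 // sqr_ge0.
have H : forall k l, (k < 4)%N -> (l < 4)%N -> `|dl M * (sp S M (t k) ord_max * sp S M (t l) ord_max *
   (Xm S p q M k l t - dl M * qq p q k l))| <= S%:R ^+ 2 * (2 * S%:R ^+ 2).
  by move=> k l _ _; rewrite mulrCA normrM ler_pM ?abs_svM ?abs_Xt.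
have := Qsum_abs_le 2 _ _ H.
set Q := Qsum _ _; move=> HQ.
have b2 : 0 <= beta ^+ 2 / 2 by rewrite divr_ge0 // sqr_ge0.
apply: (le_trans (ler_wpM2l b2 HQ)).
have := betaS2; rewrite (_ : (4 * 3 * 3)%:R = 36) //; move: (S%:R ^+ 2) => a; lra.
Qed.

End OneSite.

(** * Moment bounds *)

Section PowerBounds.
Context {R : realType}.

Lemma pow_increment (B : R) m : 0 <= B -> exists2 C, 0 <= C &
  forall x y : R, `|y| <= B -> `|(x + y) ^+ m.+1 - x ^+ m.+1| <= C * `|y| * (1 + `|x|) ^+ m.
Proof.
move=> B0; elim: m => [|m [C C0 IH]].
  by exists 1 => // x y _; rewrite !expr1 expr0 mulr1 mul1r addrAC subrr add0r.
exists ((1 + B) * C + 1); first by rewrite !addr_ge0 ?mulr_ge0 ?addr_ge0.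
move=> x y yB; rewrite (_ : (x + y) ^+ m.+2 - _ =
  (x + y) * ((x + y) ^+ m.+1 - x ^+ m.+1) + y * x ^+ m.+1); last by rewrite !(exprS _ m.+1); ring.
have x0 : 0 <= `|x| by [].
have h1 : `|x + y| <= (1 + B) * (1 + `|x|).
  apply: (le_trans (ler_normD _ _)); rewrite mulrDl mul1r mulrDr mulr1.
  have : 0 <= B * `|x| by rewrite mulr_ge0.
  lra.
rewrite (le_trans (ler_normD _ _)) // !normrM normrX.
rewrite (_ : _ * _ * (1 + `|x|) ^+ m.+1 = (1 + B) * (1 + `|x|) * (C * `|y| * (1 + `|x|) ^+ m)
  + `|y| * (1 + `|x|) ^+ m.+1); last by rewrite exprS; ring.
apply: lerD; first by apply: ler_pM => //; exact: IH.
by rewrite ler_wpM2l // lerXn2r // ?nnegrE ?addr_ge0 // lerDr.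
Qed.

Lemma pow_1D (x : R) r : (1 + `|x|) ^+ (2 * r) <= 2 ^+ (2 * r) * (1 + x ^+ (2 * r)).
Proof.
have ev : x ^+ (2 * r) = `|x| ^+ (2 * r).
  by rewrite -normrX ger0_norm // exprM exprn_ge0 // sqr_ge0.
rewrite ev; have [x1|x1] := leP `|x| 1.
  apply: (@le_trans _ _ (2 ^+ (2 * r))).
    by rewrite lerXn2r // ?nnegrE ?addr_ge0 //; lra.
  by rewrite ler_peMr ?exprn_ge0 // lerDl exprn_ge0.
apply: (@le_trans _ _ ((2 * `|x|) ^+ (2 * r))).
  by rewrite lerXn2r // ?nnegrE ?addr_ge0 ?mulr_ge0 //; lra.
by rewrite exprMn ler_wpM2l ?exprn_ge0 // lerDr.
Qed.

(** Young's inequality with constant 1 for every exponent: the absorption argument cannot afford a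
    loss that grows with the order. *)
Lemma young_pow (a b : R) m : 0 <= a -> 0 <= b -> a ^+ m * b <= a ^+ m.+1 + b ^+ m.+1.
Proof.
move=> a0 b0; have [ab|/ltW ba] := leP a b.
  apply: (@le_trans _ _ (b ^+ m.+1)); last by rewrite lerDr exprn_ge0.
  by rewrite exprSr ler_wpM2r // lerXn2r // nnegrE.
apply: (@le_trans _ _ (a ^+ m.+1)); last by rewrite lerDl exprn_ge0.
by rewrite exprSr ler_wpM2l // exprn_ge0.
Qed.

Lemma even_pow_norm (x : R) r : `|x| ^+ (2 * r) = x ^+ (2 * r).
Proof. by rewrite -normrX ger0_norm // exprM exprn_ge0 // sqr_ge0. Qed.

Lemma even_pow_ge0 (x : R) r : 0 <= x ^+ (2 * r).
Proof. by rewrite exprM exprn_ge0 // sqr_ge0. Qed.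

Lemma expR_half_le2 : expR (2^-1 : R) <= 2.
Proof.
have := expR_ge1Dx (- 2^-1 : R); rewrite expRN.
have e0 := expR_gt0 (2^-1 : R).
by rewrite -(ler_pM2r e0) mulVf ?gt_eqF // => h'; lra.
Qed.

(** The factor 2 is the same for every [r]; whatever depends on the order is pushed into the
    additive constant. This keeps the condition on beta independent of the order of the moment. *)
Lemma pow_shift (r : nat) (B : R) : 0 <= B -> exists2 C, 0 <= C &
  forall x y : R, `|y| <= B -> (x + y) ^+ (2 * r) <= 2 * x ^+ (2 * r) + C.
Proof.
(* With this [L], the case |x| >= L B gives the factor (1 + 1/L)^(2r) <= exp(2r / L) <= exp(1/2) <=
   2. *)
move=> B0; pose L : R := (4 * r).+1%:R.
exists (((L + 1) * B) ^+ (2 * r)); first by rewrite exprn_ge0 ?mulr_ge0 ?addr_ge0.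
have ev (z : R) : z ^+ (2 * r) = `|z| ^+ (2 * r).
  by rewrite -normrX ger0_norm // exprM exprn_ge0 // sqr_ge0.
have L0 : 0 < L by rewrite ltr0n.
move=> x y yB; rewrite (ev (x + y)) (ev x).
have [big|small] := leP (L * B) `|x|.
  apply: (@le_trans _ _ ((`|x| * (1 + L^-1)) ^+ (2 * r))).
    rewrite lerXn2r ?nnegrE ?mulr_ge0 ?addr_ge0 ?invr_ge0 ?(ltW L0) //.
    apply: (le_trans (ler_normD _ _)); rewrite mulrDr mulr1 lerD //.
    by apply: (le_trans yB); rewrite ler_pdivlMr // mulrC.
  rewrite exprMn mulrC; apply: (@le_trans _ _ (2 * `|x| ^+ (2 * r))); last first.
    by rewrite lerDl exprn_ge0 ?mulr_ge0 ?addr_ge0 ?(ltW L0).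
  rewrite ler_wpM2r ?exprn_ge0 //.
  apply: (@le_trans _ _ (expR (2^-1))).
    apply: (@le_trans _ _ (expR L^-1 ^+ (2 * r))).
      rewrite lerXn2r ?nnegrE ?addr_ge0 ?invr_ge0 ?expR_ge0 ?(ltW L0) //.
      exact: expR_ge1Dx.
    rewrite -expRM_natl ler_expR ler_pdivrMr // /L.
    rewrite -(ler_pM2l (x := 2)) // mulrA divff // mul1r -natrM ler_nat; lia.
  exact: expR_half_le2.
apply: (@le_trans _ _ (((L + 1) * B) ^+ (2 * r))).
  rewrite lerXn2r ?nnegrE ?mulr_ge0 ?addr_ge0 ?(ltW L0) //.
  apply: (le_trans (ler_normD _ _)); rewrite mulrDl mul1r lerD // ltW //.
by rewrite lerDr mulr_ge0 ?exprn_ge0.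
Qed.

Lemma gronwall_arith (C u v y : R) : u <= 2 * v + C -> v <= y -> 2 * u <= 4 * y + 2 * C.
Proof. lra. Qed.

Lemma pair_arith (C u v y : R) : u <= y -> v <= 2 * y + C -> u + v <= 3 * y + C.
Proof. lra. Qed.

Lemma absorb_arith (u v A B : R) : u <= 4^-1 * (u + v) + A + B ->
  v <= 4^-1 * (u + v) + A + B -> u + v <= 4 * (A + B).
Proof. lra. Qed.

Lemma coef_arith (a b c : R) : b * (a * a) <= c -> b / 2 * 36%:R * (2 * a * a) <= 36 * c.
Proof. lra. Qed.

(** The coefficient of [y] on the left is 36 * 16 * 12 / 200^2, about 0.17, against the allowed 1/4:
    this estimate fixes the size of the constant 200. *)
Lemma quarter_arith (y C1 C2 : R) : 0 <= y -> 0 <= C1 -> 0 <= C2 ->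
  36 * (200%:R^-1 ^+ 2) * (16 * (3 * (4 * y + C1) + C2)) <= 4^-1 * y + (16 * C1 + C2).
Proof.
move=> y0 C10 C20; rewrite (_ : 200%:R^-1 ^+ 2 = 100%:R^-1 * 400%:R^-1); last by field.
lra.
Qed.

End PowerBounds.

Section Moments.
Context {R : realType}.
Variables (S : nat) (beta h D p q : R).
Hypothesis fp : fixed_point S beta h D p q.
Hypothesis beta0 : 0 < beta.
Hypothesis betaS : beta * S%:R ^+ 2 <= 200%:R^-1.
Local Notation cfg M := (config S M.+1).
Local Notation nuc M := (nuc S beta h D p q M).
Local Notation nuN M := (nuN S beta h D M).
Local Notation Xs M := (@X R S p q M).
Local Notation Xsm M := (@Xm R S p q M).
Local Notation els M := (@el R S p q M).
Local Notation Be := (2 * S%:R ^+ 2 : R).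
Let q0 : 0 <= q := q_ge0 _ _ _ _ _ _ fp.

Lemma Be_ge0 : 0 <= Be. Proof. by rewrite mulr_ge0 // exprn_ge0. Qed.

Lemma dl_el M k l t : `|dl M * els M k l t| <= dl M * Be.
Proof.
by rewrite normrM ger0_norm ?(ltW (dl_gt0 _)) // ler_wpM2l ?(ltW (dl_gt0 _)) // (abs_es _ _ _ _ _ _ fp).
Qed.

Lemma dl_el_Be M k l t : `|dl M * els M k l t| <= Be.
Proof. by apply: (le_trans (dl_el _ _ _ _)); rewrite ler_piMl ?Be_ge0 // dl_le1. Qed.

Lemma nuc_gronwall M th (F : (nat -> cfg M) -> R) : quarter th -> depn 2 F ->
  (forall t, 0 <= F t) -> nuc M th 2 F <= 2 * nuc M (pi / 2) 2 F.
Proof.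
move=> qt dF F0.
have N0 th' : 0 <= nuc M th' 2 F by rewrite -(nuc_cst S beta h D p q M th' 2 0) nuc_le.
apply: (@le_trans _ _ (expR 2^-1 * nuc M (pi / 2) 2 F)); last first.
  by rewrite ler_wpM2r // expR_half_le2.
apply: (sc_gronwall _ _ _ (nuc_derive S beta h D p q q0 M 2 F dF)) => // th' _.
rewrite -nucZ -nucZ -[Z in _ <= Z](nuc_extend S beta h D p q M th' 2 2); last first.
  by move=> j nj t x; rewrite dF.
apply: nuc_abs => t; rewrite mulrCA normrM mulrC (ger0_norm (F0 t)) ler_wpM2r //.
exact: (Qcav2_gronwall _ _ _ _ _ _ fp).
Qed.

Lemma nuc_Xm_pair M th n k l r : (k < n)%N -> (l < n)%N ->
  nuc M th n (fun t => Xsm M k l t ^+ r) =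
  nuc M th 2 (fun t => Xsm M 0 (k != l) t ^+ r).
Proof.
move=> kn ln.
pose V (x y : cfg M) := (dl M * \sum_(i | i != ord_max) (sp S M x i * sp S M y i - qq p q k l)) ^+ r.
transitivity (nuc M th n (fun t => V (t k) (t l))); first exact: nuc_ext.
transitivity (nuc M th 2 (fun t => V (t 0%N) (t (k != l)))).
  by apply: nuc_pair => //; case: (k == l).
by apply: nuc_ext => t; rewrite /V /Xm /es /qq; case: (k == l).
Qed.

(** The diagonal and off-diagonal moments are carried together, since the path derivative for either
    pair involves all pairs of replicas. *)
Let Y M r := nuc M (pi / 2) 2 (fun t => Xs M 0 1 t ^+ (2 * r)) +
             nuc M (pi / 2) 2 (fun t => Xs M 0 0 t ^+ (2 * r)).

(** Of the factor 4, one 2 is Gronwall back to the true model, the other is [pow_shift], which puts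
    the last site back into the overlap. *)
Lemma nuc_Xm_bound r : exists2 C, 0 <= C & forall M th n k l, quarter th ->
  (k < n)%N -> (l < n)%N ->
  nuc M th n (fun t => Xsm M k l t ^+ (2 * r)) <= 4 * Y M r + C.
Proof.
have [C C0 HC] := pow_shift r _ Be_ge0.
exists (2 * C); first by rewrite mulr_ge0.
move=> M th n k l qt kn ln; rewrite nuc_Xm_pair //.
set b : nat := k != l; have b2 : (b < 2)%N by rewrite /b; case: (k == l).
apply: (@le_trans _ _ (2 * nuc M (pi / 2) 2 (fun t => Xsm M 0 b t ^+ (2 * r)))).
  apply: nuc_gronwall => //; last by move=> t; exact: even_pow_ge0.
  by apply: depnX; exact: depn_Xm.
have h1 : nuc M (pi / 2) 2 (fun t => Xsm M 0 b t ^+ (2 * r)) <=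
   2 * nuc M (pi / 2) 2 (fun t => Xs M 0 b t ^+ (2 * r)) + C.
  rewrite -[Z in _ + Z](nuc_cst S beta h D p q M (pi / 2) 2 C) -nucZ -nucD.
  apply: nuc_le => t; have -> : Xsm M 0 b t = Xs M 0 b t + - (dl M * els M 0 b t).
    by rewrite X_Xm addrK.
  by apply: HC; rewrite normrN dl_el_Be.
have h2 : nuc M (pi / 2) 2 (fun t => Xs M 0 b t ^+ (2 * r)) <= Y M r.
  have N0 c : 0 <= nuc M (pi / 2) 2 (fun t => Xs M 0 c t ^+ (2 * r)).
    rewrite -(nuc_cst S beta h D p q M (pi / 2) 2 0); apply: nuc_le => t.
    exact: even_pow_ge0.
  by rewrite /Y /b; case: (k == l) => /=; [rewrite lerDr|rewrite lerDl]; exact: N0.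
exact: gronwall_arith h1 h2.
Qed.

Lemma E1_el n k l : (k < n)%N -> (l < n)%N ->
  E1 S beta h D p q n (fun t => sv S (t k) * sv S (t l) - qq p q k l) = 0.
Proof.
move=> kn ln; rewrite /E1 /gst.
have -> : gauss_iter 1 (fun s => av (gibbs (lin_ham 1 (fun _ => one_field S beta q)
    (one_pot S beta h D p q) s)) n (fun t => sv S (t k) * sv S (t l) - qq p q k l) (fun _ => ord0))
  = E1 S beta h D p q n (fun t => sv S (t k) * sv S (t l)) + - qq p q k l.
  rewrite /E1 /gst /=.
  rewrite -[- qq p q k l in RHS]gauss1_cst -gauss1D //; last 2 first.
  - have [K1 [K2 tk]] : exists K1 K2, tame1 K1 K2 (fun x : R => av (gibbs (lin_ham 1 (fun _ => one_field S beta q)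
      (one_pot S beta h D p q) [:: x])) n (fun t => sv S (t k) * sv S (t l)) (fun _ => ord0)).
      apply: (gauss_iter_tame1 0 (fun u => av (gibbs (lin_ham 1 (fun _ => one_field S beta q)
      (one_pot S beta h D p q) u)) n (fun t => sv S (t k) * sv S (t l)) (fun _ => ord0))).
      apply: (tame_av _ _ _ (fun _ t => sv S (t k) * sv S (t l))) => [u|tau]; last exact: tame_cst.
      apply: tame_add; last exact: tame_cst.
      by apply: tame_sum => a _; apply: tame_mul; [exact: tame_nth|exact: tame_cst].
    exact: tame1_gintegrable tk.
  - exact: gintegrable_cst.
  congr gauss1; apply/funext => x; rewrite avD av_cst //.
  exact: (sum_gibbs (ord0 : spin S)).
by rewrite E1_pair // subrr.
Qed.

(** At angle 0 the last-site term is centred and independent of [Xm], so only the derivative counts.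
    It carries [dl], and Young's inequality turns its extra overlap into moments of order 2r + 2
    with a small coefficient. *)
Lemma moment_step_path r : exists2 C, 0 <= C & forall M k l, (k < 2)%N -> (l < 2)%N ->
  `|nuN M 2 (fun t => els M k l t * Xsm M k l t ^+ (2 * r).+1)|
   <= dl M * (4^-1 * Y M r.+1 + C).
Proof.
have [C1 C10 H1] := nuc_Xm_bound r.+1.
have [C2 C20 H2] := pow_shift r.+1 _ Be_ge0.
exists (16 * C1 + C2); first by rewrite addr_ge0 ?mulr_ge0.
move=> M k l k2 l2.
set F := fun t => els M k l t * Xsm M k l t ^+ (2 * r).+1.
have dF : depn 2 F by apply: depnM; [exact: depn_el|apply: depnX; exact: depn_Xm].
have Fs : nuc M 0 2 F = 0.
  rewrite /F (nuc_ext S beta h D p q M 0 2 _ (fun t => Xsm M k l t ^+ (2 * r).+1 *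
    (fun u => sv S (u k) * sv S (u l) - qq p q k l) (fun a => t a ord_max))); last first.
    by move=> t; rewrite mulrC.
  rewrite (nuc0_split S beta h D p q M 2 (fun t => Xsm M k l t ^+ (2 * r).+1)
    (fun u => sv S (u k) * sv S (u l) - qq p q k l)).
    by rewrite E1_el // mulr0.
  move=> t t' tt; rewrite /Xm; congr ((_ * _) ^+ _); apply: eq_bigr => i il.
  by rewrite /es /sp !tt.
have dd := nuc_derive S beta h D p q q0 M 2 F dF.
have := sc_bound _ _ (dl M * (4^-1 * Y M r.+1 + (16 * C1 + C2))) 0 (pi / 2) dd _ (lexx 0) _ (lexx _).
rewrite Fs subr0 nuc_pi2; apply; last by rewrite divr_ge0 // pi_ge0.
move=> th qt; have d0 := dl_gt0 M (R := R).
rewrite normrM (gtr0_norm d0) ler_wpM2l ?(ltW d0) //.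
pose Xt a b t := Xsm M a b t - dl M * qq p q a b.
have a0 : 0 <= S%:R ^+ 2 :> R by rewrite exprn_ge0.
have b2 : 0 <= beta ^+ 2 / 2 by rewrite mulr_ge0 ?sqr_ge0 ?invr_ge0.
have c0 : 0 <= beta ^+ 2 / 2 * 36%:R * (Be * S%:R ^+ 2).
  by apply: mulr_ge0; [exact: mulr_ge0|apply: mulr_ge0 => //; exact: mulr_ge0].
(* The largest entry in [Qsum] is bounded by the sum over all 16 pairs of replicas, which explains
   the 16 in [quarter_arith]. *)
pose G t := beta ^+ 2 / 2 * 36%:R * (Be * S%:R ^+ 2) *
   (\sum_(a < 4) \sum_(b < 4) (Xsm M k l t ^+ (2 * r.+1) + Xt a b t ^+ (2 * r.+1))).
apply: (@le_trans _ _ (nuc M th 4 G)).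
  apply: nuc_abs => t; rewrite /F /G /Qcav.
  have sum_ge a b : (a < 4)%N -> (b < 4)%N ->
     `|Xt a b t| <= \sum_(a < 4) \sum_(b < 4) `|Xt a b t|.
    move=> a4 b4; rewrite (bigD1 (Ordinal a4)) //= (bigD1 (Ordinal b4)) //= -addrA lerDl.
    by rewrite addr_ge0 ?sumr_ge0 // => i _; rewrite sumr_ge0.
  have HQ : `|Qsum 2 (fun a b => sp S M (t a) ord_max * sp S M (t b) ord_max *
       (Xsm M a b t - dl M * qq p q a b))| <= 36%:R * (S%:R ^+ 2 * \sum_(a < 4) \sum_(b < 4) `|Xt a b t|).
    apply: Qsum_abs_le => a b a4 b4.
    by rewrite normrM ler_pM ?abs_svM // sum_ge.
  rewrite (normrM (els M k l t * _)) (normrM (els M k l t)) (normrM (beta ^+ 2 / 2)) (ger0_norm b2).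
  apply: (@le_trans _ _ (Be * `|Xsm M k l t| ^+ (2 * r).+1 * (beta ^+ 2 / 2 *
    (36%:R * (S%:R ^+ 2 * \sum_(a < 4) \sum_(b < 4) `|Xt a b t|))))).
    apply: ler_pM; [by rewrite mulr_ge0|by rewrite mulr_ge0| |by rewrite ler_wpM2l].
    by apply: ler_pM; rewrite ?(abs_es _ _ _ _ _ _ fp) // normrX.
  have -> : Be * `|Xsm M k l t| ^+ (2 * r).+1 * (beta ^+ 2 / 2 *
    (36%:R * (S%:R ^+ 2 * \sum_(a < 4) \sum_(b < 4) `|Xt a b t|))) =
    beta ^+ 2 / 2 * 36%:R * (Be * S%:R ^+ 2) *
    (`|Xsm M k l t| ^+ (2 * r).+1 * \sum_(a < 4) \sum_(b < 4) `|Xt a b t|) by ring.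
  apply: ler_wpM2l => //.
  rewrite mulr_sumr; apply: ler_sum => a _; rewrite mulr_sumr; apply: ler_sum => b _.
  rewrite -(even_pow_norm (Xsm M k l t)) -(even_pow_norm (Xt a b t)) mulnS.
  exact: young_pow.
have GE : nuc M th 4 G = beta ^+ 2 / 2 * 36%:R * (Be * S%:R ^+ 2) *
   (\sum_(a < 4) \sum_(b < 4) (nuc M th 4 (fun t => Xsm M k l t ^+ (2 * r.+1)) +
      nuc M th 4 (fun t => Xt a b t ^+ (2 * r.+1)))).
  rewrite /G nucZ nuc_sum; congr (_ * _); apply: eq_bigr => a _.
  by rewrite nuc_sum; apply: eq_bigr => b _; rewrite nucD.
have B1 : nuc M th 4 (fun t => Xsm M k l t ^+ (2 * r.+1)) <= 4 * Y M r.+1 + C1.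
  by apply: H1 => //; [exact: ltn_trans k2 _|exact: ltn_trans l2 _].
have B2 (a b : 'I_4) : nuc M th 4 (fun t => Xt a b t ^+ (2 * r.+1)) <= 2 * (4 * Y M r.+1 + C1) + C2.
  apply: (@le_trans _ _ (2 * nuc M th 4 (fun t => Xsm M a b t ^+ (2 * r.+1)) + C2)).
    rewrite -[Z in _ + Z](nuc_cst S beta h D p q M th 4 C2) -nucZ -nucD.
    apply: nuc_le => t; apply: H2; rewrite normrN normrM (gtr0_norm d0).
    apply: (@le_trans _ _ (1 * S%:R ^+ 2)); last by rewrite ler_wpM2r // ler1n.
    by rewrite ler_pM ?(ltW d0) ?dl_le1 // (abs_qq _ _ _ _ _ _ fp).
  apply: lerD; last exact: lexx.
  apply: ler_wpM2l; first exact: ler0n.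
  have Hab := H1 M th 4 a b qt (ltn_ord a) (ltn_ord b).
  exact: Hab.
have B3 : \sum_(a < 4) \sum_(b < 4) (nuc M th 4 (fun t => Xsm M k l t ^+ (2 * r.+1)) +
      nuc M th 4 (fun t => Xt a b t ^+ (2 * r.+1))) <= 16 * (3 * (4 * Y M r.+1 + C1) + C2).
  apply: (@le_trans _ _ (\sum_(a < 4) \sum_(b < 4) (3 * (4 * Y M r.+1 + C1) + C2))).
    apply: ler_sum => a _; apply: ler_sum => b _.
    exact: pair_arith B1 (B2 a b).
  by rewrite !sumr_const !card_ord -mulrnA -[leLHS]mulr_natl.
have bS := betaS2 _ _ beta0 betaS.
have Y0 : 0 <= Y M r.+1.
  rewrite addr_ge0 // -(nuc_cst S beta h D p q M (pi / 2) 2 0) nuc_le // => t;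
    exact: even_pow_ge0.
rewrite GE; apply: (le_trans (ler_wpM2l c0 B3)).
have cb : beta ^+ 2 / 2 * 36%:R * (Be * S%:R ^+ 2) <= 36 * (200%:R^-1 ^+ 2).
  exact: coef_arith bS.
move: (Y M r.+1) Y0 => Yr Y0.
apply: (@le_trans _ _ (36 * (200%:R^-1 ^+ 2) * (16 * (3 * (4 * Yr + C1) + C2)))).
  by rewrite ler_wpM2r // !mulr_ge0 ?addr_ge0 ?mulr_ge0 ?addr_ge0 ?mulr_ge0.
exact: quarter_arith.
Qed.

(** One factor [X] becomes sqrt N times the last-site term. Passing from [X] to [Xm] in the
    remaining power costs only the moment of order 2r, known by induction, and the path contributes
    a quarter of [Y]. Adding the two pairs, half of [Y] is absorbed on the left. *)
Lemma moments_bounded r : exists2 C, 0 <= C & forall M, Y M r <= C.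
Proof.
elim: r => [|r [C C0 IH]].
  by exists 2 => // M; rewrite /Y !(nuc_ext S beta h D p q M _ _ _ (fun _ => 1)) // ?nuc_cst.
have [C1 C10 H1] := moment_step_path r.
have [C2 C20 H2] := pow_increment Be (2 * r) Be_ge0.
pose C3 := C2 * Be * (2 ^+ (2 * r)) * (1 + C).
have C30 : 0 <= C3 by rewrite !mulr_ge0 ?exprn_ge0 ?addr_ge0.
exists (4 * (C1 + Be * C3)).
  by apply: mulr_ge0 => //; apply: addr_ge0 => //; apply: mulr_ge0 => //; exact: Be_ge0.
move=> M; have d0 := dl_gt0 M (R := R).
have sd : Num.sqrt M.+1%:R * dl M = 1 :> R by rewrite /dl mulfV // gt_eqF // sqrtr_gt0.
have key k l : (k < 2)%N -> (l < 2)%N ->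
    (nuc M (pi / 2) 2 (fun t => Xs M k l t ^+ (2 * r)) <= C) ->
    nuc M (pi / 2) 2 (fun t => Xs M k l t ^+ (2 * r.+1)) <= 4^-1 * Y M r.+1 + C1 + Be * C3.
  move=> k2 l2 HC.
  rewrite (nuc_ext S beta h D p q M _ 2 _ (fun t => Xs M k l t * Xs M k l t ^+ (2 * r).+1)); last first.
    by move=> t; rewrite -exprS mulnS.
  rewrite nuc_pi2 nuN_site //; last 2 first.
  - by apply: depnX; exact: depn_X.
  - by move=> i t; rewrite X_site_sym.
  rewrite -(nuc_pi2 S beta h D p q).
  have -> : nuc M (pi / 2) 2 (fun t => els M k l t * Xs M k l t ^+ (2 * r).+1) =
    nuc M (pi / 2) 2 (fun t => els M k l t * Xsm M k l t ^+ (2 * r).+1) +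
    nuc M (pi / 2) 2 (fun t => els M k l t * (Xs M k l t ^+ (2 * r).+1 - Xsm M k l t ^+ (2 * r).+1)).
    by rewrite -nucD; apply: nuc_ext => t; ring.
  rewrite mulrDr; apply: lerD.
    rewrite nuc_pi2; apply: (le_trans (ler_norm _)); rewrite normrM ger0_norm ?sqrtr_ge0 //.
    apply: (le_trans (ler_wpM2l (sqrtr_ge0 _) (H1 M k l k2 l2))).
    by rewrite mulrA sd mul1r.
  (* Removing the last site moves [X] by O([dl]), which compensates the factor sqrt N. *)
  have h2 : `|nuc M (pi / 2) 2 (fun t => els M k l t * (Xs M k l t ^+ (2 * r).+1 - Xsm M k l t ^+ (2 * r).+1))|
     <= nuc M (pi / 2) 2 (fun t => dl M * (Be * (C2 * Be * 2 ^+ (2 * r))) * (1 + Xs M k l t ^+ (2 * r))).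
    apply: nuc_abs => t; rewrite normrM (distrC (Xs M k l t ^+ _)).
    have -> : Xsm M k l t = Xs M k l t + - (dl M * els M k l t) by rewrite X_Xm addrK.
    have b1 : `|- (dl M * els M k l t)| <= Be by rewrite normrN dl_el_Be.
    have b2 := H2 (Xs M k l t) _ b1.
    apply: (@le_trans _ _ (Be * (C2 * (dl M * Be) * (2 ^+ (2 * r) * (1 + Xs M k l t ^+ (2 * r)))))).
      apply: ler_pM; [exact: normr_ge0|exact: normr_ge0|exact: (abs_es _ _ _ _ _ _ fp)|].
      apply: (le_trans b2); apply: ler_pM; rewrite ?mulr_ge0 ?exprn_ge0 ?addr_ge0 //.
        by rewrite ler_wpM2l // normrN dl_el.
      exact: pow_1D.
    rewrite le_eqVlt; apply/orP; left; apply/eqP; ring.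
  apply: (le_trans (ler_norm _)); rewrite normrM ger0_norm ?sqrtr_ge0 //.
  apply: (le_trans (ler_wpM2l (sqrtr_ge0 _) h2)).
  rewrite nucZ nucD nuc_cst (_ : _ * _ = Num.sqrt M.+1%:R * dl M * (Be * (C2 * Be * 2 ^+ (2 * r)) *
    (1 + nuc M (pi / 2) 2 (fun t => Xs M k l t ^+ (2 * r))))); last by ring.
  rewrite sd mul1r /C3 -mulrA ler_wpM2l ?Be_ge0 // ler_wpM2l ?lerD2l //.
  by rewrite !mulr_ge0 ?exprn_ge0.
have N0 k l : 0 <= nuc M (pi / 2) 2 (fun t => Xs M k l t ^+ (2 * r)).
  rewrite -(nuc_cst S beta h D p q M (pi / 2) 2 0); apply: nuc_le => t.
  exact: even_pow_ge0.
have K1 := key 0%N 1%N isT isT; have K2 := key 0%N 0%N isT isT.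
have := IH M; rewrite /Y => HY.
have {}K1 := K1 (le_trans (_ : _ <= _) HY); have {}K2 := K2 (le_trans (_ : _ <= _) HY).
have {}K1 := K1 ltac:(by rewrite lerDl N0); have {}K2 := K2 ltac:(by rewrite lerDr N0).
exact: absorb_arith K1 K2.
Qed.

Lemma nuc_Xm_moments r : exists2 C, 0 <= C & forall M th n k l, quarter th ->
  (k < n)%N -> (l < n)%N ->
  nuc M th n (fun t => Xsm M k l t ^+ (2 * r)) <= C.
Proof.
have [C C0 H] := nuc_Xm_bound r; have [C' C'0 H'] := moments_bounded r.
exists (4 * C' + C); first by rewrite addr_ge0 ?mulr_ge0.
move=> M th n k l qt kn ln; apply: (le_trans (H M th n k l qt kn ln)).
by rewrite lerD2r; apply: ler_wpM2l => //; exact: H'.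
Qed.

End Moments.

(** * Cavity expansion of products of linear forms *)

Section OrderDelta.
Context {R : realType}.
Implicit Types (u v : nat -> R).

Definition Od (u : nat -> R) := exists2 C, 0 <= C & forall M, `|u M| <= C * dl M.

Lemma Od_ext u v : (forall M, u M = v M) -> Od u -> Od v.
Proof. by move=> uv [C C0 H]; exists C => // M; rewrite -uv. Qed.

Lemma Od_add u v : Od u -> Od v -> Od (fun M => u M + v M).
Proof.
move=> [C C0 H] [C' C'0 H']; exists (C + C'); first by rewrite addr_ge0.
by move=> M; rewrite mulrDl (le_trans (ler_normD _ _)) // lerD.
Qed.

Lemma Od_bmul (w : nat -> R) (B : R) u : (forall M, `|w M| <= B) -> Od u ->
  Od (fun M => w M * u M).
Proof.
move=> wB [C C0 H]; have B0 : 0 <= B by exact: le_trans (wB 0%N).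
exists (B * C); first by rewrite mulr_ge0.
by move=> M; rewrite normrM -mulrA ler_pM.
Qed.

Lemma Od_scale (c : R) u : Od u -> Od (fun M => c * u M).
Proof. exact: (Od_bmul (fun _ => c) `|c|). Qed.

Lemma Od_opp u : Od u -> Od (fun M => - u M).
Proof. by move=> Ou; apply: Od_ext (Od_scale (-1) _ Ou) => M; rewrite mulN1r. Qed.

Lemma Od_sub u v : Od u -> Od v -> Od (fun M => u M - v M).
Proof. by move=> Ou Ov; apply: Od_add => //; exact: Od_opp. Qed.

Lemma Od0 : Od (fun _ => 0).
Proof. by exists 0 => // M; rewrite normr0 mul0r. Qed.

Lemma Od_sum (I : Type) (r : seq I) (P : pred I) (u : I -> nat -> R) :
  (forall i, P i -> Od (u i)) -> Od (fun M => \sum_(i <- r | P i) u i M).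
Proof.
move=> Ou; elim: r => [|i r IH]; first by apply: Od_ext Od0 => M; rewrite big_nil.
have [Pi|nPi] := boolP (P i).
  by apply: Od_ext (Od_add _ _ (Ou i Pi) IH) => M; rewrite big_cons Pi.
by apply: Od_ext IH => M; rewrite big_cons (negbTE nPi).
Qed.

Lemma Od_Qsum n (V : nat -> nat -> nat -> R) :
  (forall k l, (k < n.+2)%N -> (l < n.+2)%N -> Od (V k l)) ->
  Od (fun M => Qsum n (fun k l => V k l M)).
Proof.
move=> OV; have row k : (k < n.+2)%N -> Od (fun M => \sum_(l < n.+1) V k l M - n.+1%:R * V k n.+1 M).
  move=> kn; apply: Od_sub; last by apply: Od_scale; exact: OV.
  by apply: Od_sum => l _; apply: OV => //; have := ltn_ord l; lia.
apply: Od_sub; last by apply: Od_scale; exact: row.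
by apply: Od_sum => k _; apply: row; have := ltn_ord k; lia.
Qed.

End OrderDelta.

Section BoundedFamilies.
Context {R : realType}.
Variables (S : nat) (beta h D p q : R).
Hypothesis fp : fixed_point S beta h D p q.
Hypothesis beta0 : 0 < beta.
Hypothesis betaS : beta * S%:R ^+ 2 <= 200%:R^-1.
Local Notation cfg M := (config S M.+1).
Local Notation nuc M := (nuc S beta h D p q M).
Local Notation nuN M := (nuN S beta h D M).
Let q0 : 0 <= q := q_ge0 _ _ _ _ _ _ fp.

Definition fam := forall M, (nat -> cfg M) -> R.

(** Bounds on all even moments, uniform in N, the angle and the number of replicas. Having all
    orders makes the class closed under products: order 2r of a product uses order 4r of its
    factors. *)
Definition mb n (F : fam) := forall r, exists2 C, 0 <= C & forall M th n',
  quarter th -> (n <= n')%N -> nuc M th n' (fun t => F M t ^+ (2 * r)) <= C.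

Lemma mb_mono n n' F : (n <= n')%N -> mb n F -> mb n' F.
Proof.
move=> nn bF r; have [C C0 H] := bF r; exists C => // M th m qt nm.
by apply: H => //; exact: leq_trans nm.
Qed.

Lemma mb_ext n (F G : fam) : (forall M t, F M t = G M t) -> mb n F -> mb n G.
Proof.
move=> FG bF r; have [C C0 H] := bF r; exists C; first exact: C0.
move=> M th m qt nm.
rewrite -(nuc_ext S beta h D p q M th m (fun t => F M t ^+ (2 * r))); first exact: H.
by move=> t; rewrite FG.
Qed.

Lemma mb_bounded n (F : fam) (B : R) : (forall M t, `|F M t| <= B) -> mb n F.
Proof.
move=> FB r; have B0 : 0 <= B by exact: le_trans (FB 0%N (cfg0 S 0)).
exists (B ^+ (2 * r)); first by rewrite exprn_ge0.
move=> M th n' _ _; rewrite -[leRHS](nuc_cst S beta h D p q M th n'); apply: nuc_le => t.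
by rewrite -even_pow_norm lerXn2r // nnegrE.
Qed.

Lemma mb_cst n (c : R) : mb n (fun M t => c).
Proof. exact: (mb_bounded n _ `|c|). Qed.

Lemma even_pow_add (x y : R) r :
  (x + y) ^+ (2 * r) <= 2 ^+ (2 * r) * (x ^+ (2 * r) + y ^+ (2 * r)).
Proof.
have gen (a b : R) : 0 <= a -> a <= b -> (a + b) ^+ (2 * r) <= 2 ^+ (2 * r) * b ^+ (2 * r).
  move=> a0 ab; have b0 := le_trans a0 ab.
  by rewrite -exprMn lerXn2r // ?nnegrE ?addr_ge0 ?mulr_ge0 // mulr2n mulrDl mul1r lerD2r.
rewrite -even_pow_norm; apply: (@le_trans _ _ ((`|x| + `|y|) ^+ (2 * r))).
  by rewrite lerXn2r // ?nnegrE ?addr_ge0 // ler_normD.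
rewrite -(even_pow_norm x) -(even_pow_norm y).
have [xy|/ltW yx] := leP `|x| `|y|.
  apply: (le_trans (gen _ _ (normr_ge0 x) xy)).
  by rewrite ler_wpM2l ?exprn_ge0 // lerDr exprn_ge0.
rewrite addrC; apply: (le_trans (gen _ _ (normr_ge0 y) yx)).
by rewrite ler_wpM2l ?exprn_ge0 // lerDl exprn_ge0.
Qed.

Lemma even_pow_mul (x y : R) r :
  (x * y) ^+ (2 * r) <= x ^+ (2 * (2 * r)) + y ^+ (2 * (2 * r)).
Proof.
have e (z : R) : z ^+ (2 * (2 * r)) = (z ^+ (2 * r)) ^+ 2 by rewrite mulnC exprM.
rewrite exprMn !e; move: (x ^+ (2 * r)) (y ^+ (2 * r)) => a b.
have := sqr_ge0 (a - b); have := sqr_ge0 a; have := sqr_ge0 b; rewrite !expr2; nra.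
Qed.

Lemma mb_add n (F G : fam) : mb n F -> mb n G -> mb n (fun M t => F M t + G M t).
Proof.
move=> bF bG r; have [C C0 HC] := bF r; have [C' C'0 HC'] := bG r.
exists (2 ^+ (2 * r) * (C + C')); first by rewrite mulr_ge0 ?addr_ge0 ?exprn_ge0.
move=> M th n' qt nn.
apply: (@le_trans _ _ (nuc M th n' (fun t => 2 ^+ (2 * r) * (F M t ^+ (2 * r) + G M t ^+ (2 * r))))).
  by apply: nuc_le => t; exact: even_pow_add.
rewrite nucZ nucD; apply: ler_wpM2l; first by rewrite exprn_ge0.
by apply: lerD; [exact: HC|exact: HC'].
Qed.

Lemma mb_mul n (F G : fam) : mb n F -> mb n G -> mb n (fun M t => F M t * G M t).
Proof.
move=> bF bG r; have [C C0 HC] := bF (2 * r)%N; have [C' C'0 HC'] := bG (2 * r)%N.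
exists (C + C'); first by rewrite addr_ge0.
move=> M th n' qt nn.
apply: (@le_trans _ _ (nuc M th n' (fun t => F M t ^+ (2 * (2 * r)) + G M t ^+ (2 * (2 * r))))).
  by apply: nuc_le => t; exact: even_pow_mul.
by rewrite nucD; apply: lerD; [exact: HC|exact: HC'].
Qed.

Lemma mb_scale n (u : nat -> R) (B : R) (F : fam) : (forall M, `|u M| <= B) -> mb n F ->
  mb n (fun M t => u M * F M t).
Proof.
move=> uB bF; apply: (mb_mul n (fun M t => u M) F _ bF).
by apply: (mb_bounded n _ B) => M t; exact: uB.
Qed.

Lemma mb_dl n (F : fam) : mb n F -> mb n (fun M t => dl M * F M t).
Proof.
apply: (mb_scale n _ 1) => M; rewrite ger0_norm ?dl_le1 //; exact: ltW (dl_gt0 M).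
Qed.

Lemma mb_sum n (I : Type) (r : seq I) (P : pred I) (F : I -> fam) :
  (forall i, P i -> mb n (F i)) -> mb n (fun M t => \sum_(i <- r | P i) F i M t).
Proof.
move=> bF; elim: r => [|i r IH].
  by apply: mb_ext (mb_cst n 0) => M t; rewrite big_nil.
have [Pi|nPi] := boolP (P i).
  by apply: mb_ext (mb_add _ _ _ (bF i Pi) IH) => M t; rewrite big_cons Pi.
by apply: mb_ext IH => M t; rewrite big_cons (negbTE nPi).
Qed.

Lemma mb_Xm n k l : (k < n)%N -> (l < n)%N -> mb n (fun M t => Xm S p q M k l t).
Proof.
move=> kn ln r; have [C C0 H] := nuc_Xm_moments _ _ _ _ _ _ fp beta0 betaS r.
exists C => // M th n' qt nn; apply: H => //; [exact: leq_trans nn|exact: leq_trans nn].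
Qed.

Lemma mb_el n k l : mb n (fun M t => el S p q M k l t).
Proof. by apply: (mb_bounded n _ (2 * S%:R ^+ 2)) => M t; exact: (abs_es _ _ _ _ _ _ fp). Qed.

Lemma mb_Qcav n : mb n.+2 (fun M t => Qcav S beta p q M n t).
Proof.
have b k l : (k < n.+2)%N -> (l < n.+2)%N -> mb n.+2 (fun M t =>
    sp S M (t k) ord_max * sp S M (t l) ord_max * (Xm S p q M k l t - dl M * qq p q k l)).
  move=> kn ln; apply: mb_mul.
    by apply: (mb_bounded _ _ (S%:R ^+ 2)) => M t; exact: abs_svM.
  apply: mb_add; first exact: mb_Xm.
  apply: (mb_ext _ (fun M t => dl M * - qq p q k l)); first by move=> M t; rewrite mulrN.
  by apply: mb_dl; exact: mb_cst.
apply: (mb_scale _ (fun _ => beta ^+ 2 / 2) _ _ (fun _ => lexx _)).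
have row k : (k < n.+2)%N -> mb n.+2 (fun M t => \sum_(l < n.+1)
    sp S M (t k) ord_max * sp S M (t l) ord_max * (Xm S p q M k l t - dl M * qq p q k l)
   - n.+1%:R * (sp S M (t k) ord_max * sp S M (t n.+1) ord_max * (Xm S p q M k n.+1 t - dl M * qq p q k n.+1))).
  move=> kn; apply: mb_add.
    by apply: mb_sum => l _; apply: b => //; have := ltn_ord l; lia.
  apply: (mb_ext _ _ _ _ (mb_scale _ (fun _ => - n.+1%:R) _ _ (fun _ => lexx _) (b k n.+1 kn _))) => //.
  by move=> M t; rewrite mulNr.
apply: mb_add.
  by apply: mb_sum => k _; apply: row; have := ltn_ord k; lia.
apply: (mb_ext _ _ _ _ (mb_scale _ (fun _ => - n%:R) _ _ (fun _ => lexx _) (row n _))) => //.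
by move=> M t; rewrite mulNr.
Qed.

Lemma mb_nuc n (F : fam) : mb n F -> exists2 C, 0 <= C & forall M th n',
  quarter th -> (n <= n')%N -> `|nuc M th n' (F M)| <= C.
Proof.
move=> bF; have [C C0 H] := bF 1%N; exists (1 + C); first by rewrite addr_ge0.
move=> M th n' qt nn.
apply: (@le_trans _ _ (nuc M th n' (fun t => 1 + F M t ^+ (2 * 1)))).
  apply: nuc_abs => t; rewrite muln1 -real_normK ?num_real //.
  by move: `|F M t| => a; nra.
by rewrite nucD nuc_cst lerD2l; apply: H.
Qed.

Lemma Od_dl n n' th (F : fam) : quarter th -> (n <= n')%N -> mb n F ->
  Od (fun M => dl M * nuc M th n' (F M)).
Proof.
move=> qt nn /mb_nuc[C C0 H]; exists C => // M.
have d0 := ltW (dl_gt0 M (R := R)).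
by rewrite normrM (ger0_norm d0) [leRHS]mulrC; apply: ler_wpM2l => //; exact: H.
Qed.

Lemma path_first_order n (F : fam) : (forall M, depn n (F M)) -> mb n F ->
  Od (fun M => nuN M n (F M) - nuc M 0 n (F M)).
Proof.
move=> dF bF; have bQ : mb n.+2 (fun M t => F M t * Qcav S beta p q M n t).
  by apply: mb_mul; [apply: mb_mono bF; lia|exact: mb_Qcav].
have [C C0 H] := mb_nuc _ _ bQ; exists C => // M.
rewrite -(nuc_pi2 S beta h D p q).
apply: (sc_bound _ _ (C * dl M) 0 (pi / 2) (nuc_derive S beta h D p q q0 M n (F M) (dF M))) => //.
  move=> th qt; have d0 := ltW (dl_gt0 M (R := R)).
  by rewrite normrM (ger0_norm d0) [leRHS]mulrC; apply: ler_wpM2l => //; exact: H.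
by rewrite divr_ge0 // pi_ge0.
Qed.

(** Each derivative brings a factor [dl] and two replicas, hence [n.+4] and a remainder of order
    [dl ^+ 2], still negligible after multiplication by sqrt N. *)
Lemma path_second_order n (F : fam) : (forall M, depn n (F M)) -> mb n F ->
  exists2 C, 0 <= C & forall M, `|nuN M n (F M) - nuc M 0 n (F M)
     - dl M * nuc M 0 n.+2 (fun t => F M t * Qcav S beta p q M n t)| <= C * dl M ^+ 2.
Proof.
move=> dF bF; have bQ : mb n.+4 (fun M t => F M t * Qcav S beta p q M n t * Qcav S beta p q M n.+2 t).
  apply: mb_mul; last exact: mb_Qcav.
  by apply: mb_mul; [apply: mb_mono bF; lia|apply: mb_mono (mb_Qcav n); lia].
have [C C0 H] := mb_nuc _ _ bQ; exists C => // M.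
rewrite -(nuc_pi2 S beta h D p q).
have d1 := nuc_derive S beta h D p q q0 M n (F M) (dF M).
have d2 := nuc_derive S beta h D p q q0 M n.+2 _ (depn_Qcav S beta p q q0 M n _ (dF M)).
apply: (sc_taylor2 _ _ _ _ d1 (sc_deriveZ (dl M) _ _ d2)) => th qt.
have dd := ltW (dl_gt0 M (R := R)).
rewrite !(normrM (dl M)) (ger0_norm dd) mulrA -expr2 [leRHS]mulrC.
by apply: ler_wpM2l; [exact: sqr_ge0|exact: H].
Qed.

End BoundedFamilies.

Section Forms.
Context {R : realType}.
Implicit Types (V U : nat -> nat -> R).

(* A linear form in the U_kl, as a list of pairs (coefficient, (k, l)). *)
Definition form : Type := seq (R * (nat * nat)).

Definition ev (lam : form) V : R := \sum_(x <- lam) x.1 * V x.2.1 x.2.2.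

Definition PV (f : seq form) V : R := \prod_(lam <- f) ev lam V.

Definition fok n (lam : form) := all (fun x => (x.2.1 < n)%N && (x.2.2 < n)%N) lam.

Lemma ev_nil V : ev [::] V = 0.
Proof. exact: big_nil. Qed.

Lemma ev_cons x lam V : ev (x :: lam) V = x.1 * V x.2.1 x.2.2 + ev lam V.
Proof. exact: big_cons. Qed.

Lemma PV_cons lam f V : PV (lam :: f) V = ev lam V * PV f V.
Proof. exact: big_cons. Qed.

Lemma PV_nil V : PV [::] V = 1.
Proof. exact: big_nil. Qed.

Lemma ev_ext n lam V U : fok n lam ->
  (forall k l, (k < n)%N -> (l < n)%N -> V k l = U k l) -> ev lam V = ev lam U.
Proof.
move=> ok VU; elim: lam ok => [|x lam IH] /=; first by rewrite !ev_nil.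
by move=> /andP[/andP[h1 h2] ok]; rewrite !ev_cons VU // IH.
Qed.

Lemma PV_ext n f V U : all (fok n) f ->
  (forall k l, (k < n)%N -> (l < n)%N -> V k l = U k l) -> PV f V = PV f U.
Proof.
move=> ok VU; elim: f ok => [|lam f IH] /=; first by rewrite !PV_nil.
by move=> /andP[h1 ok]; rewrite !PV_cons (ev_ext n lam V U) // IH.
Qed.

Lemma evD lam V U : ev lam (fun k l => V k l + U k l) = ev lam V + ev lam U.
Proof. by rewrite /ev -big_split; apply: eq_bigr => x _; rewrite mulrDr. Qed.

Lemma evZ lam (c : R) V : ev lam (fun k l => c * V k l) = c * ev lam V.
Proof. by rewrite /ev mulr_sumr; apply: eq_bigr => x _; rewrite mulrCA. Qed.

Definition rm (v : nat) (f : seq form) : seq form := take v f ++ drop v.+1 f.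

Lemma rm0 lam f : rm 0 (lam :: f) = f.
Proof. by rewrite /rm /= drop0. Qed.

Lemma rmS v lam f : rm v.+1 (lam :: f) = lam :: rm v f.
Proof. by []. Qed.

Lemma rm_ok n v f : all (fok n) f -> all (fok n) (rm v f).
Proof.
move=> ok; rewrite /rm all_cat; apply/andP; split.
  by apply/allP => x /mem_take; move/allP: ok; apply.
by apply/allP => x /mem_drop; move/allP: ok; apply.
Qed.

Lemma fokS n n' lam : (n <= n')%N -> fok n lam -> fok n' lam.
Proof.
move=> nn; apply: sub_all => x /andP[h1 h2]; apply/andP; split;
  by apply: leq_trans nn.
Qed.

Lemma all_fokS n n' f : (n <= n')%N -> all (fok n) f -> all (fok n') f.
Proof. by move=> nn; apply: sub_all => lam; exact: fokS. Qed.

End Forms.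

(* Stated apart because [ring] would try to unify the averages used as atoms. *)
Section Arithmetic.
Context {R : comNzRingType}.
Implicit Types a b c d k w x y z : R.

Lemma first_order_arith a b c : a + (b - c) = b + a - c.
Proof. ring. Qed.

Lemma cross_arith a b k z : a - k * z - k * (b - z) = a - k * b.
Proof. ring. Qed.

Lemma kernel_arith x k d c y : x * k - d * c * (y * k) = k * x - c * k * (d * y).
Proof. ring. Qed.

Lemma kernel_diff_arith k x z w : k * (x - z) - w = k * x - w - k * z.
Proof. ring. Qed.

Lemma collect_arith a w b x y z : a - w + (w - b) + (x - y + z) = a + x + z - (y + b).
Proof. ring. Qed.

Lemma unscale_arith d k w x z : k * d = 1 ->
  k * (w + d * x + d ^+ 2 * z) = k * w + x + d * z.
Proof.
move=> kd; rewrite (_ : k * _ = k * w + (k * d) * x + (k * d) * d * z); last by ring.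
by rewrite kd !mul1r.
Qed.

End Arithmetic.

(** * First-order expansion of moments of linear forms *)

Section Cavity.
Context {R : realType}.
Variables (S : nat) (beta h D p q : R).
Hypothesis fp : fixed_point S beta h D p q.
Hypothesis beta0 : 0 < beta.
Hypothesis betaS : beta * S%:R ^+ 2 <= 200%:R^-1.
Local Notation cfg M := (config S M.+1).
Local Notation nuc M := (nuc S beta h D p q M).
Local Notation nuN M := (nuN S beta h D M).
Local Notation E1 := (E1 S beta h D p q).
Local Notation fam := (fam S).
Local Notation mb := (mb S beta h D p q).
Let q0 : 0 <= q := q_ge0 _ _ _ _ _ _ fp.

Definition Xf M (t : nat -> cfg M) := fun k l => X S p q M k l t.
Definition Xmf M (t : nat -> cfg M) := fun k l => Xm S p q M k l t.
Definition elf M (t : nat -> cfg M) := fun k l => el S p q M k l t.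
Definition e1f (s : nat -> spin S) := fun k l => sv S (s k) * sv S (s l) - qq p q k l.

Lemma ev_Xf M t lam : ev lam (Xf M t) = ev lam (Xmf M t) + dl M * ev lam (elf M t).
Proof.
rewrite -evZ -evD; congr ev; apply/funext => k; apply/funext => l.
exact: X_Xm.
Qed.

Lemma mb_ev n lam (V : nat -> nat -> fam) : fok n lam ->
  (forall k l, (k < n)%N -> (l < n)%N -> mb n (V k l)) ->
  mb n (fun M t => ev lam (fun k l => V k l M t)).
Proof.
move=> ok bV; elim: lam ok => [_|x lam IH /= /andP[/andP[h1 h2] ok]].
  by apply: mb_ext (mb_cst _ _ _ _ _ _ n 0) => M t; rewrite ev_nil.
apply: (mb_ext _ _ _ _ _ _ n (fun M t => x.1 * V x.2.1 x.2.2 M t + ev lam (fun k l => V k l M t))).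
  by move=> M t; rewrite ev_cons.
apply: mb_add; last exact: IH.
by apply: mb_mul; [exact: mb_cst|exact: bV].
Qed.

Lemma mb_PV n f (V : nat -> nat -> fam) : all (fok n) f ->
  (forall k l, (k < n)%N -> (l < n)%N -> mb n (V k l)) ->
  mb n (fun M t => PV f (fun k l => V k l M t)).
Proof.
move=> ok bV; elim: f ok => [_|lam f IH /= /andP[h1 ok]].
  by apply: mb_ext (mb_cst _ _ _ _ _ _ n 1) => M t; rewrite PV_nil.
apply: (mb_ext _ _ _ _ _ _ n (fun M t => ev lam (fun k l => V k l M t) * PV f (fun k l => V k l M t))).
  by move=> M t; rewrite PV_cons.
by apply: mb_mul; [exact: mb_ev|exact: IH].
Qed.

Lemma mb_evm n lam : fok n lam -> mb n (fun M t => ev lam (Xmf M t)).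
Proof. by move=> ok; apply: mb_ev => // k l kn ln; exact: mb_Xm. Qed.

Lemma mb_eve n lam : fok n lam -> mb n (fun M t => ev lam (elf M t)).
Proof. by move=> ok; apply: mb_ev => // k l kn ln; exact: mb_el. Qed.

Lemma mb_PVm n f : all (fok n) f -> mb n (fun M t => PV f (Xmf M t)).
Proof. by move=> ok; apply: mb_PV => // k l kn ln; exact: mb_Xm. Qed.

(** Coefficient of [dl] when the last site is separated from every factor of the product. *)
Definition dPV M (f : seq form) (t : nat -> cfg M) : R :=
  \sum_(v < size f) ev (nth [::] f v) (elf M t) * PV (rm v f) (Xmf M t).

Lemma nth_fok n f v : all (fok (R := R) n) f -> fok n (nth [::] f v).
Proof.
move=> ok; have [vf|vf] := ltnP v (size f); first by move/all_nthP: ok; apply.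
by rewrite nth_default.
Qed.

Lemma mb_dPV n f : all (fok n) f -> mb n (fun M t => dPV M f t).
Proof.
move=> ok; apply: mb_sum => v _; apply: mb_mul.
  by apply: mb_eve; exact: nth_fok.
by apply: mb_PVm; exact: rm_ok.
Qed.

Lemma PV_expand n f : all (fok n) f -> exists2 Rem : fam, mb n Rem &
  forall M t, PV f (Xf M t) = PV f (Xmf M t) + dl M * dPV M f t + dl M ^+ 2 * Rem M t.
Proof.
elim: f => [_|lam f IH /= /andP[ok1 ok]].
  exists (fun M t => 0); first exact: mb_cst.
  by move=> M t; rewrite !PV_nil /dPV big_ord0 !mulr0 !addr0.
have [Rem bR HR] := IH ok.
exists (fun M t => ev lam (Xmf M t) * Rem M t + ev lam (elf M t) * dPV M f t
  + dl M * (ev lam (elf M t) * Rem M t)).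
  apply: mb_add.
    apply: mb_add; first exact: (mb_mul _ _ _ _ _ _ n _ _ (mb_evm n lam ok1) bR).
    exact: (mb_mul _ _ _ _ _ _ n _ _ (mb_eve n lam ok1) (mb_dPV n f ok)).
  exact: (mb_dl _ _ _ _ _ _ n _ (mb_mul _ _ _ _ _ _ n _ _ (mb_eve n lam ok1) bR)).
move=> M t; rewrite !PV_cons ev_Xf HR {2}/dPV /= big_ord_recl /= rm0.
have -> : \sum_(i < size f) ev (nth [::] f (0 + i)) (elf M t) * PV (rm (bump 0 i) (lam :: f)) (Xmf M t)
  = ev lam (Xmf M t) * dPV M f t.
  rewrite /dPV mulr_sumr; apply: eq_bigr => v _.
  by rewrite /bump leq0n add1n rmS PV_cons add0n; ring.
ring.
Qed.

Lemma depn_PV n f M (V : (nat -> cfg M) -> nat -> nat -> R) : all (fok n) f ->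
  (forall k l, (k < n)%N -> (l < n)%N -> depn n (fun t => V t k l)) ->
  depn n (fun t => PV f (V t)).
Proof. by move=> ok dV j nj t x; apply: (PV_ext n) => // k l kn ln; exact: dV. Qed.

Lemma depn_ev n lam M (V : (nat -> cfg M) -> nat -> nat -> R) : fok n lam ->
  (forall k l, (k < n)%N -> (l < n)%N -> depn n (fun t => V t k l)) ->
  depn n (fun t => ev lam (V t)).
Proof. by move=> ok dV j nj t x; apply: (ev_ext n) => // k l kn ln; exact: dV. Qed.

Lemma depn_PVm n f M : all (fok n) f -> depn n (fun t => PV f (Xmf M t)).
Proof. by move=> ok; apply: depn_PV => // k l kn ln; exact: depn_Xm. Qed.

Lemma depn_PVx n f M : all (fok n) f -> depn n (fun t => PV f (Xf M t)).
Proof. by move=> ok; apply: depn_PV => // k l kn ln; exact: depn_X. Qed.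

Lemma depn_eve n lam M : fok n lam -> depn n (fun t => ev lam (elf M t)).
Proof. by move=> ok; apply: depn_ev => // k l kn ln; exact: depn_el. Qed.

Lemma nolast_PVm M f : nolast S M (fun t => PV f (Xmf M t)).
Proof.
move=> t t' tt; congr PV; apply/funext => k; apply/funext => l.
rewrite /Xmf /Xm; congr (_ * _); apply: eq_bigr => i il.
by rewrite /es /sp !tt.
Qed.

Lemma site_sym_PVx M f : site_sym S M (fun t => PV f (Xf M t)).
Proof.
move=> i t; congr PV; apply/funext => k; apply/funext => l.
exact: X_site_sym.
Qed.

Lemma nuN_site_ev n lam f M : fok n lam -> all (fok n) f ->
  nuN M n (fun t => ev lam (Xf M t) * PV f (Xf M t)) =
  Num.sqrt M.+1%:R * nuN M n (fun t => ev lam (elf M t) * PV f (Xf M t)).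
Proof.
move=> ok okf; elim: lam ok => [_|x lam IH /= /andP[/andP[h1 h2] ok]].
  rewrite -!(nuc_pi2 S beta h D p q) !(nuc_ext S beta h D p q M _ _ _ (fun _ => 0)).
  - by rewrite nuc_cst mulr0.
  - by move=> t; rewrite ev_nil mul0r.
  - by move=> t; rewrite ev_nil mul0r.
have lin (V : (nat -> cfg M) -> nat -> nat -> R) :
   nuN M n (fun t => ev (x :: lam) (V t) * PV f (Xf M t)) =
   x.1 * nuN M n (fun t => V t x.2.1 x.2.2 * PV f (Xf M t)) +
   nuN M n (fun t => ev lam (V t) * PV f (Xf M t)).
  rewrite -!(nuc_pi2 S beta h D p q) -nucZ -nucD; apply: nuc_ext => t.
  by rewrite ev_cons; ring.
rewrite !lin IH // mulrDr mulrCA; congr (_ * _ + _).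
apply: nuN_site => //; [exact: depn_PVx|exact: site_sym_PVx].
Qed.

Lemma sqrt_dl M : Num.sqrt M.+1%:R * dl M = 1 :> R.
Proof. by rewrite /dl mulfV // gt_eqF // sqrtr_gt0. Qed.

(** Removing the last site and decoupling the model each cost O([dl]); this suffices for every term
    that is not multiplied by sqrt N. *)
Lemma PV_first_order n f : all (fok n) f ->
  Od (fun M => nuN M n (fun t => PV f (Xf M t)) - nuc M 0 n (fun t => PV f (Xmf M t))).
Proof.
move=> ok; have [Rem bR HR] := PV_expand n f ok.
have b1 : mb n (fun M t => dPV M f t + dl M * Rem M t).
  by apply: mb_add; [exact: mb_dPV|exact: mb_dl].
have o1 := Od_dl _ _ _ _ _ _ n n (pi / 2) _ quarter1 (leqnn n) b1.
have o2 := path_first_order _ _ _ _ _ _ fp beta0 betaS n (fun M t => PV f (Xmf M t))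
  (fun M => depn_PVm n f M ok) (mb_PVm n f ok).
apply: Od_ext (Od_add _ _ o1 o2) => M.
have -> : nuN M n (fun t => PV f (Xf M t)) = nuc M (pi / 2) n (fun t => PV f (Xmf M t)) +
    nuc M (pi / 2) n (fun t => dl M * (dPV M f t + dl M * Rem M t)).
  rewrite -(nuc_pi2 S beta h D p q M n) -nucD; apply: nuc_ext => t; rewrite HR; ring.
rewrite nucZ -(nuc_pi2 S beta h D p q M n (fun t => PV f (Xmf M t))).
exact: first_order_arith.
Qed.

(** The one-site constants of the expansion: [cc] arises when the last site of [lam] meets the last
    site of another factor, [KK] is the weight that the path derivative puts on U_kl. *)
Definition cc n lam lam' : R := E1 n (fun s => ev lam (e1f s) * ev lam' (e1f s)).
Definition KK n lam k l : R := E1 n (fun s => ev lam (e1f s) * (sv S (s k) * sv S (s l))).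

Lemma E1_ev n lam : fok n lam -> E1 n (fun s => ev lam (e1f s)) = 0.
Proof.
move=> ok; rewrite /E1.
have tF g : tame 1 (fun s => av (gibbs (lin_ham 1 (fun _ => one_field S beta q)
     (one_pot S beta h D p q) s)) n g (fun _ => ord0)).
  apply: (tame_av _ _ _ (fun _ t => g t)) => [u|tau]; last exact: tame_cst.
  apply: tame_add; last exact: tame_cst.
  by apply: tame_sum => a _; apply: tame_mul; [exact: tame_nth|exact: tame_cst].
elim: lam ok => [_|x lam IH /= /andP[/andP[h1 h2] ok]].
  rewrite -[RHS](gauss_iter_cst 1); apply: gauss_iter_ext => s _.
  rewrite -[RHS](av_cst (gibbs (lin_ham 1 (fun _ => one_field S beta q) (one_pot S beta h D p q) s)) n 0 (fun _ => ord0)).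
    by congr (av _ _ _ _); apply/funext => t; rewrite ev_nil.
  exact: (sum_gibbs (ord0 : spin S)).
transitivity (x.1 * E1 n (fun s => e1f s x.2.1 x.2.2) + E1 n (fun s => ev lam (e1f s))).
  rewrite /E1 /gst -gauss_iterZ // -gauss_iterD //; last exact: tame_scale.
  apply: gauss_iter_ext => s _; rewrite -avZ -avD; congr (av _ _ _ _).
  by apply/funext => t; rewrite ev_cons.
have e0 : E1 n (fun s => e1f s x.2.1 x.2.2) = 0 by exact: (E1_el _ _ _ _ _ _ fp).
by rewrite e0 mulr0 add0r; exact: IH.
Qed.

(** Site symmetry puts sqrt N in front. The product with its last site removed contributes nothing
    at angle 0, so what remains of it is the path derivative, of order one. The share of the last
    site in one other factor has size [dl] and yields the [cc] terms. Everything else is O([dl]). *)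
Theorem cavity n lam f : fok n lam -> all (fok n) f ->
  Od (fun M => nuN M n (fun t => ev lam (Xf M t) * PV f (Xf M t)) -
    (\sum_(v < size f) cc n lam (nth [::] f v) * nuN M n (fun t => PV (rm v f) (Xf M t))
     + beta ^+ 2 / 2 * Qsum n (fun k l => KK n.+2 lam k l *
         nuN M n.+2 (fun t => X S p q M k l t * PV f (Xf M t))))).
Proof.
move=> ok okf; have [Rem bR HR] := PV_expand n f okf.
set F : fam := fun M t => ev lam (elf M t) * PV f (Xmf M t).
have bF : mb n F by apply: mb_mul; [exact: mb_eve|exact: mb_PVm].
have dF M : depn n (F M) by apply: depnM; [exact: depn_eve|exact: depn_PVm].
(* The cancellation of the term of order sqrt N, by the fixed-point equations. *)
have F0 M : nuc M 0 n (F M) = 0.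
  rewrite (nuc_ext S beta h D p q M 0 n _ (fun t => PV f (Xmf M t) *
    (fun s => ev lam (e1f s)) (fun a => t a ord_max))); last first.
    by move=> t; rewrite mulrC.
  rewrite (nuc0_split S beta h D p q M n _ (fun s => ev lam (e1f s)) (nolast_PVm M f)).
  by rewrite E1_ev // mulr0.
have [C C0 HC] := path_second_order _ _ _ _ _ _ fp beta0 betaS n F dF bF.
(* An exact identity: [PV_expand] multiplied by sqrt N, each [dl] cancelling one sqrt N. *)
have split3 M : nuN M n (fun t => ev lam (Xf M t) * PV f (Xf M t)) =
  Num.sqrt M.+1%:R * nuN M n (F M) +
  \sum_(v < size f) nuN M n (fun t => ev lam (elf M t) * ev (nth [::] f v) (elf M t) * PV (rm v f) (Xmf M t))
  + dl M * nuN M n (fun t => ev lam (elf M t) * Rem M t).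
  rewrite nuN_site_ev // -!(nuc_pi2 S beta h D p q).
  under [in RHS]eq_bigr do rewrite -(nuc_pi2 S beta h D p q).
  rewrite -nuc_sum.
  have -> : nuc M (pi / 2) n (fun t => ev lam (elf M t) * PV f (Xf M t)) =
    nuc M (pi / 2) n (F M) + dl M * nuc M (pi / 2) n (fun t =>
    \sum_(i < size f) ev lam (elf M t) * ev (nth [::] f i) (elf M t) * PV (rm i f) (Xmf M t))
    + dl M ^+ 2 * nuc M (pi / 2) n (fun t => ev lam (elf M t) * Rem M t).
    rewrite -!nucZ -!nucD; apply: nuc_ext => t; rewrite HR /F.
    have -> : \sum_(i < size f) ev lam (elf M t) * ev (nth [::] f i) (elf M t) * PV (rm i f) (Xmf M t)
      = ev lam (elf M t) * dPV M f t.
      by rewrite /dPV mulr_sumr; apply: eq_bigr => i _; rewrite mulrA.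
    ring.
  exact: unscale_arith (sqrt_dl M).
have oRem := Od_dl _ _ _ _ _ _ n n (pi / 2) _ quarter1 (leqnn n)
   (mb_mul _ _ _ _ _ _ n _ _ (mb_eve n lam ok) bR).
have oV : Od (fun M => \sum_(v < size f) (nuN M n (fun t => ev lam (elf M t) *
     ev (nth [::] f v) (elf M t) * PV (rm v f) (Xmf M t)) -
     cc n lam (nth [::] f v) * nuN M n (fun t => PV (rm v f) (Xf M t)))).
  apply: Od_sum => v _.
  have okv := nth_fok n f v okf; have okr := rm_ok n v f okf.
  have o1 := path_first_order _ _ _ _ _ _ fp beta0 betaS n
    (fun M t => ev lam (elf M t) * ev (nth [::] f v) (elf M t) * PV (rm v f) (Xmf M t))
    (fun M => depnM _ _ _ (depnM _ _ _ (depn_eve n lam M ok) (depn_eve n _ M okv)) (depn_PVm n _ M okr))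
    (mb_mul _ _ _ _ _ _ n _ _ (mb_mul _ _ _ _ _ _ n _ _ (mb_eve n lam ok) (mb_eve n _ okv)) (mb_PVm n _ okr)).
  have o2 := Od_scale (cc n lam (nth [::] f v)) _ (PV_first_order n _ okr).
  apply: Od_ext (Od_sub _ _ o1 o2) => M.
  have -> : nuc M 0 n (fun t => ev lam (elf M t) * ev (nth [::] f v) (elf M t) * PV (rm v f) (Xmf M t))
    = cc n lam (nth [::] f v) * nuc M 0 n (fun t => PV (rm v f) (Xmf M t)).
    rewrite [RHS]mulrC -(nuc0_split S beta h D p q M n _
      (fun s => ev lam (e1f s) * ev (nth [::] f v) (e1f s)) (nolast_PVm M (rm v f))).
    by apply: nuc_ext => t; rewrite mulrC.
  exact: cross_arith.
have oA : Od (fun M => Num.sqrt M.+1%:R * nuN M n (F M) -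
    nuc M 0 n.+2 (fun t => F M t * Qcav S beta p q M n t)).
  exists C => // M; have := HC M; rewrite F0 subr0.
  have d0 := dl_gt0 M (R := R); have rd := sqrt_dl M.
  move: (nuN M n (F M)) (nuc M 0 n.+2 _) => u w H.
  have -> : Num.sqrt M.+1%:R * u - w = Num.sqrt M.+1%:R * (u - dl M * w).
    by rewrite mulrBr mulrA rd mul1r.
  rewrite normrM ger0_norm ?sqrtr_ge0 //.
  apply: (le_trans (ler_wpM2l (sqrtr_ge0 _) H)).
  move: rd; move: (Num.sqrt _) (dl M) => r d rd.
  have -> : r * (C * d ^+ 2) = C * (r * d * d) by ring.
  by rewrite rd mul1r.
have oQ : Od (fun M => nuc M 0 n.+2 (fun t => F M t * Qcav S beta p q M n t) -
    beta ^+ 2 / 2 * Qsum n (fun k l => KK n.+2 lam k l *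
         nuN M n.+2 (fun t => X S p q M k l t * PV f (Xf M t)))).
  have QE M : nuc M 0 n.+2 (fun t => F M t * Qcav S beta p q M n t) =
    beta ^+ 2 / 2 * Qsum n (fun k l => KK n.+2 lam k l *
       nuc M 0 n.+2 (fun t => Xm S p q M k l t * PV f (Xmf M t))
       - qq p q k l * KK n.+2 lam k l * (dl M * nuc M 0 n.+2 (fun t => PV f (Xmf M t)))).
    pose G k l t := F M t * (sp S M (t k) ord_max * sp S M (t l) ord_max * (Xm S p q M k l t - dl M * qq p q k l)).
    transitivity (beta ^+ 2 / 2 * Qsum n (fun k l => nuc M 0 n.+2 (G k l))).
      rewrite (nuc_ext S beta h D p q M 0 n.+2 _ (fun t => beta ^+ 2 / 2 * Qsum n (fun k l => G k l t))).
        rewrite nucZ; congr (_ * _); rewrite /Qsum nucB nucZ nucB nuc_sum nuc_sum nucZ; congr (_ - _).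
        by apply: eq_bigr => k _; rewrite nucB nuc_sum nucZ.
      by move=> t; rewrite /Qcav QsumZ mulrCA.
    congr (_ * _); apply: Qsum_ext => k l _ _.
    pose g (s : nat -> spin S) := ev lam (e1f s) * (sv S (s k) * sv S (s l)).
    have nl : nolast S M (fun t => Xm S p q M k l t * PV f (Xmf M t)).
      move=> t t' tt; rewrite (nolast_PVm M f t t' tt); congr (_ * _).
      by rewrite /Xm; congr (_ * _); apply: eq_bigr => i il; rewrite /es /sp !tt.
    have e1 : nuc M 0 n.+2 (fun t => Xm S p q M k l t * PV f (Xmf M t) * g (fun a => t a ord_max)) =
      nuc M 0 n.+2 (fun t => Xm S p q M k l t * PV f (Xmf M t)) * KK n.+2 lam k l.
      exact: (nuc0_split S beta h D p q M n.+2 _ g nl).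
    have e2 : nuc M 0 n.+2 (fun t => PV f (Xmf M t) * g (fun a => t a ord_max)) =
      nuc M 0 n.+2 (fun t => PV f (Xmf M t)) * KK n.+2 lam k l.
      exact: (nuc0_split S beta h D p q M n.+2 _ g (nolast_PVm M f)).
    transitivity (nuc M 0 n.+2 (fun t => Xm S p q M k l t * PV f (Xmf M t) * g (fun a => t a ord_max))
      - dl M * qq p q k l * nuc M 0 n.+2 (fun t => PV f (Xmf M t) * g (fun a => t a ord_max))).
      by rewrite -nucZ -nucB; apply: nuc_ext => t; rewrite /G /F /sp /g; ring.
    rewrite e1 e2.
    exact: kernel_arith.
  have okf2 : all (fok n.+2) f by apply: all_fokS okf; lia.
  have oP := Od_dl _ _ _ _ _ _ n.+2 n.+2 0 _ quarter0 (leqnn _) (mb_PVm n.+2 f okf2).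
  (* Error made for each pair in returning from angle 0 to the true model, together with the
     centring term of [Qcav], which has a factor [dl]. *)
  pose V k l M := KK n.+2 lam k l * (nuc M 0 n.+2 (fun t => Xm S p q M k l t * PV f (Xmf M t)) -
       nuN M n.+2 (fun t => X S p q M k l t * PV f (Xf M t)))
     - qq p q k l * KK n.+2 lam k l * (dl M * nuc M 0 n.+2 (fun t => PV f (Xmf M t))).
  suff OV : forall k l, (k < n.+2)%N -> (l < n.+2)%N -> Od (V k l).
    apply: Od_ext (Od_scale (beta ^+ 2 / 2) _ (Od_Qsum n V OV)) => M.
    rewrite QE -mulrBr -QsumB; congr (_ * _); apply: Qsum_ext => k l _ _.
    exact: kernel_diff_arith.
  move=> k l kn ln; apply: Od_sub; last exact: Od_scale.
  apply: Od_scale.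
  (* The overlap of the pair is adjoined to the product as one more form, so that [PV_first_order]
     covers it. *)
  have okg : all (fok n.+2) ([:: (1 : R, (k, l))] :: f) by rewrite /= kn ln.
  have evg U : PV ([:: (1 : R, (k, l))] :: f) U = U k l * PV f U.
    by rewrite PV_cons ev_cons ev_nil /= mul1r addr0.
  apply: Od_ext (Od_opp _ (PV_first_order n.+2 _ okg)) => M.
  have e1 : nuc M 0 n.+2 (fun t => Xm S p q M k l t * PV f (Xmf M t)) =
    nuc M 0 n.+2 (fun t => PV ([:: (1 : R, (k, l))] :: f) (Xmf M t)).
    by apply: nuc_ext => t; rewrite evg.
  have e2 : nuN M n.+2 (fun t => X S p q M k l t * PV f (Xf M t)) =
    nuN M n.+2 (fun t => PV ([:: (1 : R, (k, l))] :: f) (Xf M t)).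
    by rewrite -!(nuc_pi2 S beta h D p q); apply: nuc_ext => t; rewrite evg.
  by rewrite e1 e2; exact: opprB.
apply: Od_ext (Od_add _ _ (Od_add _ _ oA oQ) (Od_add _ _ oV oRem)) => M.
rewrite split3 sumrB -(nuc_pi2 S beta h D p q M n (fun t => ev lam (elf M t) * Rem M t)).
exact: collect_arith.
Qed.

End Cavity.

(** * Fresh replicas and one-site kernels *)

Section FreshReplicas.
Context {R : realType} {T : finType}.
Variables (w : T -> R) (V : T -> T -> R) (Dg : T -> R) (tau0 : nat -> T).
Hypothesis w1 : \sum_x w x = 1.
Hypothesis Vsym : forall x y, V x y = V y x.
Implicit Types (F : (nat -> T) -> R) (g f : T -> R) (n j k l b : nat).

Definition wavg (g : T -> R) : R := \sum_x w x * g x.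

(** Abstract in the measure and the kernel because it serves twice: for the one-site measure, to
    compute constants, and for the full Gibbs measure, to recognise T_k, S_k, T and S. *)
Definition pf (t : nat -> T) k l : R := if k == l then Dg (t k) else V (t k) (t l).

Definition v1 x : R := wavg (V x).
Definition v0 : R := wavg v1.
Definition d0 : R := wavg Dg.

Local Notation avn n F := (av w n F tau0).

Lemma av_fun n j g F : (j < n)%N -> indep F j ->
  avn n (fun t => g (t j) * F t) = wavg g * avn n F.
Proof.
move=> jn iF; rewrite -(av_avj _ _ _ _ w1 jn).
rewrite (avj_mulr w j (fun t => g (t j)) F iF) -avZ; congr (av _ _ _ _).
by apply/funext => t; congr (_ * _); apply: eq_bigr => x _; rewrite updE eqxx.
Qed.

Lemma av_V n k j F : (j < n)%N -> k != j -> indep F j ->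
  avn n (fun t => V (t k) (t j) * F t) = avn n (fun t => v1 (t k) * F t).
Proof.
move=> jn kj iF; rewrite -(av_avj _ _ _ _ w1 jn).
rewrite (avj_mulr w j (fun t => V (t k) (t j)) F iF); congr (av _ _ _ _).
apply/funext => t; congr (_ * _); apply: eq_bigr => x _.
by rewrite !updE eqxx (negbTE kj).
Qed.

Lemma indepM F F' j : indep F j -> indep F' j -> indep (fun t => F t * F' t) j.
Proof. by move=> i i' t x; rewrite i i'. Qed.

Lemma pf_sym t k l : pf t k l = pf t l k.
Proof. by rewrite /pf eq_sym; case: eqP => [->|_] //; exact: Vsym. Qed.

Lemma av_pf_fresh n k j F : (j < n)%N -> k != j -> indep F j ->
  avn n (fun t => pf t k j * F t) = avn n (fun t => v1 (t k) * F t).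
Proof. by move=> jn kj iF; rewrite -(av_V _ _ _ _ jn kj iF) /pf (negbTE kj). Qed.

Lemma av_pf_fresh2 n j j' F : (j < n)%N -> (j' < n)%N -> j != j' -> indep F j -> indep F j' ->
  avn n (fun t => pf t j j' * F t) = avn n (fun t => v0 * F t).
Proof.
move=> jn jn' jj iF iF'; rewrite av_pf_fresh // av_fun // -avZ.
by [].
Qed.

Lemma av_pf_diag n j F : (j < n)%N -> indep F j ->
  avn n (fun t => pf t j j * F t) = avn n (fun t => d0 * F t).
Proof.
move=> jn iF; rewrite avZ -(av_fun n j Dg F jn iF); congr (av _ _ _ _); apply/funext => t.
by rewrite /pf eqxx.
Qed.

(* [(Some k, true)] stands for T_k, [(Some k, false)] for S_k, [(None, true)] for T
   and [(None, false)] for S.  [frm kd j] is the corresponding form: replicas [j]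
   and [j.+1] are fresh, so averaging over them gives [kval kd]. *)
Definition kind : Type := option nat * bool.

Definition kind_ok b (kd : kind) : bool := if kd.1 is Some k then (k < b)%N else true.

Definition frm (kd : kind) j : form (R := R) :=
  match kd with
  | (Some k, true) => [:: (1, (k, j)); (-1, (j.+1, j))]
  | (Some k, false) => [:: (1, (k, k)); (-1, (j, j))]
  | (None, true) => [:: (1, (j, j.+1))]
  | (None, false) => [:: (1, (j, j))]
  end.

Definition kval (kd : kind) (t : nat -> T) : R :=
  match kd with
  | (Some k, true) => v1 (t k) - v0
  | (Some k, false) => Dg (t k) - d0
  | (None, true) => v0
  | (None, false) => d0
  end.

Lemma indep_kval b kd j : kind_ok b kd -> (b <= j)%N -> indep (kval kd) j.
Proof.
move=> kb bj t x; case: kd kb => -[k|] [] //= kb;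
  by rewrite updE (ltn_eqF (leq_trans kb bj)).
Qed.

(** Averaging over the fresh replica [j] turns the kernel into its conditional mean [v1]; averaging
    over [j.+1] as well gives [v0]. The differences in [frm] thus produce centred quantities. *)
Lemma av_frm n b kd j F : kind_ok b kd -> (b <= j)%N -> (j.+1 < n)%N ->
  indep F j -> indep F j.+1 ->
  avn n (fun t => ev (frm kd j) (pf t) * F t) = avn n (fun t => kval kd t * F t).
Proof.
move=> kb bj jn iF iF'; have jn' : (j < n)%N by exact: ltnW.
have jj : j.+1 != j by rewrite gtn_eqF.
case: kd kb => -[k|] [] /= kb.
- have kj : k != j by rewrite ltn_eqF //; exact: leq_trans bj.
  rewrite (_ : (fun t => _) = fun t => pf t k j * F t - pf t j.+1 j * F t); last first.
    by apply/funext => t; rewrite !ev_cons ev_nil /=; ring.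
  rewrite avB av_pf_fresh // av_pf_fresh2 // -avB; congr (av _ _ _ _).
  by apply/funext => t; rewrite mulrBl.
- rewrite (_ : (fun t => _) = fun t => Dg (t k) * F t - pf t j j * F t); last first.
    by apply/funext => t; rewrite !ev_cons ev_nil /= /pf !eqxx; ring.
  rewrite avB av_pf_diag // -avB; congr (av _ _ _ _).
  by apply/funext => t; rewrite mulrBl.
- rewrite -(av_pf_fresh2 n j j.+1) // 1?eq_sym //; congr (av _ _ _ _).
  by apply/funext => t; rewrite !ev_cons ev_nil /= mul1r addr0.
- rewrite -(av_pf_diag n j F jn' iF); congr (av _ _ _ _).
  by apply/funext => t; rewrite !ev_cons ev_nil /= mul1r addr0.
Qed.

Definition slot b (i : nat) : nat := (b + 2 * i)%N.

Definition frms b (L : seq (kind * nat)) : seq (form (R := R)) :=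
  [seq frm x.1 (slot b x.2) | x <- L].

Definition kvals (s : seq kind) (t : nat -> T) : R := \prod_(kd <- s) kval kd t.

Definition slots_ok b n (L : seq (kind * nat)) : bool :=
  [&& all (kind_ok b) (unzip1 L), uniq (unzip2 L) & all (fun i => (slot b i).+1 < n)%N (unzip2 L)].

Lemma indep_pf t j x k l : k != j -> l != j -> pf (upd t j x) k l = pf t k l.
Proof. by move=> kj lj; rewrite /pf !updE (negbTE kj) (negbTE lj). Qed.

Lemma indep_frm b kd i j : kind_ok b kd -> (b <= j)%N -> j != slot b i -> j != (slot b i).+1 ->
  indep (fun t => ev (frm kd (slot b i)) (pf t)) j.
Proof.
move=> kb bj j1 j2 t x; rewrite eq_sym in j1; rewrite eq_sym in j2.
have kj k : (k < b)%N -> k != j by move=> k0; rewrite ltn_eqF //; exact: leq_trans bj.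
case: kd kb => -[k|] [] /= kb; rewrite !ev_cons !ev_nil /= !indep_pf //; exact: kj.
Qed.

Lemma indep_PV_frms b L j : all (kind_ok b) (unzip1 L) -> (b <= j)%N ->
  (forall i, i \in unzip2 L -> (j != slot b i) && (j != (slot b i).+1)) ->
  indep (fun t => PV (frms b L) (pf t)) j.
Proof.
elim: L => [|x L IH] /=; first by move=> _ _ _ t y; rewrite !PV_nil.
move=> /andP[kx kL] bj H t y; rewrite !PV_cons.
have /andP[h1 h2] := H x.2 (mem_head _ _).
rewrite (indep_frm b) // IH // => i iL; apply: H.
by rewrite inE iL orbT.
Qed.

(** The slots are disjoint, so the fresh replicas of one factor can be averaged with the other
    factors held fixed. Slot numbers are stored next to the kinds so that deleting a factor does not
    renumber the others. *)
Lemma av_frms n b L F : slots_ok b n L -> (forall j, (b <= j)%N -> indep F j) ->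
  avn n (fun t => PV (frms b L) (pf t) * F t) = avn n (fun t => kvals (unzip1 L) t * F t).
Proof.
elim: L F => [|x L IH] F.
  by move=> _ _; congr (av _ _ _ _); apply/funext => t; rewrite PV_nil /kvals big_nil.
move=> /and3P[/= /andP[kx kL] /andP[xL uL] /andP[nx nL]] iF.
have neq i : i \in unzip2 L -> forall d d', (d < 2)%N -> (d' < 2)%N ->
    (slot b x.2 + d != slot b i + d')%N.
  move=> iL d d' d2 d2'; apply/eqP => e; case/negP: xL.
  suff -> : x.2 = i by [].
  by move: e; rewrite /slot; lia.
rewrite (_ : (fun t => _) = fun t => ev (frm x.1 (slot b x.2)) (pf t) * (PV (frms b L) (pf t) * F t)); last first.
  by apply/funext => t; rewrite PV_cons mulrA.
have b0 : (b <= slot b x.2)%N by exact: leq_addr.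
rewrite (av_frm n b) //; first last.
- apply: indepM; last by apply: iF; lia.
  apply: indep_PV_frms => //; first by lia.
  move=> i iL; have := neq i iL 1%N 0%N isT isT; have := neq i iL 1%N 1%N isT isT.
  by rewrite !addn1 addn0 => -> ->.
- apply: indepM; last exact: iF.
  apply: indep_PV_frms => //.
  move=> i iL; have := neq i iL 0%N 0%N isT isT; have := neq i iL 0%N 1%N isT isT.
  by rewrite !addn1 !addn0 => -> ->.
rewrite (_ : (fun t => _) = fun t => PV (frms b L) (pf t) * (kval x.1 t * F t)); last first.
  by apply/funext => t; rewrite mulrCA.
rewrite IH.
- congr (av _ _ _ _); apply/funext => t; rewrite /kvals big_cons; ring.
- by rewrite /slots_ok kL uL nL.
- by move=> j bj; apply: indepM; [exact: indep_kval kx bj|exact: iF].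
Qed.

Lemma frm_ok b n kd i : kind_ok b kd -> ((slot b i).+1 < n)%N -> fok n (frm kd (slot b i)).
Proof.
move=> kb sn; have sn' := ltnW sn.
have bn : (b < n)%N by apply: leq_ltn_trans sn'; exact: leq_addr.
case: kd kb => -[k|] [] /= kb; rewrite ?sn ?sn' //.
  by rewrite (ltn_trans kb bn).
by rewrite (ltn_trans kb bn).
Qed.

Lemma frms_ok b n L : slots_ok b n L -> all (fok n) (frms b L).
Proof.
elim: L => //= x L IH /and3P[/= /andP[kx kL] /andP[xL uL] /andP[nx nL]].
by rewrite frm_ok //= IH // /slots_ok kL uL nL.
Qed.

End FreshReplicas.

Section ReplicaCovariance.
Context {R : realType} {T : finType}.
Variables (w : T -> R) (tau0 : nat -> T).
Hypothesis w1 : \sum_x w x = 1.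
Implicit Types (F : (nat -> T) -> R) (g f : T -> R) (n i j : nat).
Local Notation avn n F := (av w n F tau0).
Local Notation wavg := (wavg w).

Lemma wavgD g f : wavg (fun x => g x + f x) = wavg g + wavg f.
Proof. by rewrite /wavg -big_split; apply: eq_bigr => x _; rewrite mulrDr. Qed.

Lemma wavgZ (c : R) g : wavg (fun x => c * g x) = c * wavg g.
Proof. by rewrite /wavg mulr_sumr; apply: eq_bigr => x _; rewrite mulrCA. Qed.

Lemma wavg_cst (c : R) : wavg (fun=> c) = c.
Proof. by rewrite /wavg -mulr_suml w1 mul1r. Qed.

Lemma wavgB g f : wavg (fun x => g x - f x) = wavg g - wavg f.
Proof.
by rewrite -mulN1r -wavgZ -wavgD; congr wavg; apply/funext => x; rewrite mulN1r.
Qed.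

Lemma av_prod_uniq n (r : seq nat) (g : nat -> T -> R) : uniq r ->
  all (fun i => (i < n)%N) r ->
  avn n (fun t => \prod_(i <- r) g i (t i)) = \prod_(i <- r) wavg (g i).
Proof.
elim: r => [_ _|i r IH /andP[ir ur] /andP[iN rN]].
  rewrite big_nil -[RHS](av_cst w n 1 tau0 w1).
  by congr (av _ _ _ _); apply/funext => t; rewrite big_nil.
rewrite big_cons -(IH ur rN) -(av_fun w tau0 w1 n i) //.
  by congr (av _ _ _ _); apply/funext => t; rewrite big_cons.
move=> t x; apply: eq_big_seq => j jr; rewrite updE; case: eqP => // ji.
by rewrite -ji jr in ir.
Qed.

Lemma av_centered n i g F : (i < n)%N -> wavg g = 0 -> indep F i ->
  avn n (fun t => g (t i) * F t) = 0.
Proof. by move=> iN g0 iF; rewrite av_fun // g0 mul0r. Qed.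

End ReplicaCovariance.

(** * One-site covariances and kernels *)

Section OneSiteMoments.
Context {R : realType}.
Variables (S : nat) (beta h D p q : R).
Local Notation w e := (w1 S beta h D p q e).
Local Notation mj j e := (mj S beta h D p q j e).
Local Notation t0 := (fun _ : nat => ord0 : spin S).
Local Notation pw j := (fun x : spin S => sv S x ^+ j : R).
Local Notation Vs := (fun x y : spin S => sv S x * sv S y - q : R).
Local Notation Ds := (fun x : spin S => sv S x * sv S x - p : R).
Implicit Types (e : R).

Lemma e1f_pf s k l : e1f S p q s k l = pf Vs Ds s k l.
Proof. by rewrite /e1f /pf /qq; case: eqP => [->|]. Qed.

Lemma wavg_pw e j : wavg (w e) (pw j) = mj j e.
Proof. by rewrite mj_w1. Qed.

Lemma wavg_sv e : wavg (w e) (sv S) = mj 1 e.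
Proof. by rewrite -wavg_pw; congr wavg; apply/funext => x; rewrite expr1. Qed.

Lemma v1_one e x : v1 (w e) Vs x = sv S x * mj 1 e - q.
Proof.
rewrite /v1 wavgB wavgZ wavg_cst ?sum_w1 //.
by rewrite wavg_sv.
Qed.

Lemma v0_one e : v0 (w e) Vs = mj 1 e ^+ 2 - q.
Proof.
rewrite /v0 (_ : v1 _ _ = fun x => mj 1 e * sv S x - q); last first.
  by apply/funext => x; rewrite v1_one mulrC.
by rewrite wavgB wavgZ wavg_cst ?sum_w1 // wavg_sv expr2.
Qed.

Lemma d0_one e : d0 (w e) Ds = mj 2 e - p.
Proof. by rewrite /d0 wavgB wavg_cst ?sum_w1 // -wavg_pw. Qed.

Definition gk e (c : bool) (x : spin S) : R :=
  if c then mj 1 e * sv S x - mj 1 e ^+ 2 else sv S x ^+ 2 - mj 2 e.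

Lemma gk_mean e c : wavg (w e) (gk e c) = 0.
Proof.
case: c; rewrite /gk wavgB wavg_cst ?sum_w1 //.
  by rewrite wavgZ wavg_sv expr2 subrr.
by rewrite wavg_pw subrr.
Qed.

Lemma kval_gk e a c t : kval (w e) Vs Ds (Some a, c) t = gk e c (t a).
Proof.
case: c; rewrite /kval /gk.
  by rewrite v1_one v0_one; ring.
by rewrite d0_one; ring.
Qed.

Lemma gk_TT e : wavg (w e) (fun x => gk e true x * gk e true x) =
  mj 1 e ^+ 2 * (mj 2 e - mj 1 e ^+ 2).
Proof.
rewrite /gk (_ : (fun x => _) = fun x => mj 1 e ^+ 2 * pw 2 x -
   (2 * mj 1 e ^+ 3 * sv S x - mj 1 e ^+ 4)); last by apply/funext => x; ring.
rewrite !wavgB wavg_cst ?sum_w1 // !wavgZ wavg_sv wavg_pw; ring.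
Qed.

Lemma gk_TS e : wavg (w e) (fun x => gk e true x * gk e false x) =
  mj 1 e * (mj 3 e - mj 1 e * mj 2 e).
Proof.
rewrite /gk (_ : (fun x => _) = fun x => mj 1 e * pw 3 x -
   (mj 1 e * mj 2 e * sv S x + mj 1 e ^+ 2 * pw 2 x - mj 1 e ^+ 2 * mj 2 e)); last by apply/funext => x; ring.
rewrite !wavgB wavgD wavg_cst ?sum_w1 // !wavgZ wavg_sv !wavg_pw; ring.
Qed.

Lemma gk_SS e : wavg (w e) (fun x => gk e false x * gk e false x) = mj 4 e - mj 2 e ^+ 2.
Proof.
rewrite /gk (_ : (fun x => _) = fun x => pw 4 x -
   (2 * mj 2 e * pw 2 x - mj 2 e ^+ 2)); last by apply/funext => x; ring.
rewrite !wavgB wavg_cst ?sum_w1 // !wavgZ !wavg_pw; ring.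
Qed.

Definition gcov (c c' : bool) : R :=
  if c then (if c' then Gc S beta h D p q else Ecal S beta h D p q)
  else (if c' then Ecal S beta h D p q else Dcal S beta h D p q).

Lemma gk_cov c c' : gauss1 (fun e => wavg (w e) (fun x => gk e c x * gk e c' x)) = gcov c c'.
Proof.
case: c; case: c'; rewrite /gcov.
- by congr gauss1; apply/funext => e; rewrite gk_TT.
- by congr gauss1; apply/funext => e; rewrite gk_TS.
- congr gauss1; apply/funext => e; rewrite -gk_TS; congr wavg.
  by apply/funext => x; rewrite mulrC.
- by congr gauss1; apply/funext => e; rewrite gk_SS.
Qed.

(** Given eta, T_a and S_a become centred functions of replica [a] alone, so they are uncorrelated
    with factors on other replicas and with T and S. On the same replica the covariances are G, E
    and D. *)
Lemma cc_frm n b a c i kd i' :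
  slots_ok b n [:: ((Some a, c), i); (kd, i')] ->
  cc S beta h D p q n (frm (Some a, c) (slot b i)) (frm kd (slot b i')) =
  if kd.1 == Some a then gcov c kd.2 else 0.
Proof.
move=> ok; rewrite /cc E1_gauss1.
have ab : (a < b)%N by move: ok; rewrite /slots_ok /= -andbA => /and5P[].
have i0n : (slot b i < n)%N.
  by move: ok; rewrite /slots_ok => /and3P[_ _] /= /andP[/ltnW].
have an : (a < n)%N by apply: ltn_trans ab _; apply: leq_ltn_trans i0n; exact: leq_addr.
have key e : av (w e) n (fun s => ev (frm (Some a, c) (slot b i)) (e1f S p q s) *
     ev (frm kd (slot b i')) (e1f S p q s)) t0 =
   av (w e) n (fun t => gk e c (t a) * kval (w e) Vs Ds kd t) t0.
  have := av_frms (w e) Vs Ds t0 (sum_w1 _ _ _ _ _ _ e) n b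
     [:: ((Some a, c), i); (kd, i')] (fun _ => 1) ok (fun _ _ _ _ => erefl).
  rewrite /frms /= (_ : (fun t => PV _ _ * 1) = fun s => ev (frm (Some a, c) (slot b i)) (e1f S p q s) *
     ev (frm kd (slot b i')) (e1f S p q s)); last first.
    apply/funext => s; rewrite !PV_cons PV_nil !mulr1; congr (_ * _).
      by congr ev; apply/funext => k; apply/funext => l; rewrite e1f_pf.
    by congr ev; apply/funext => k; apply/funext => l; rewrite e1f_pf.
  move=> ->; congr (av _ _ _ _); apply/funext => t.
  by rewrite /kvals !big_cons big_nil !mulr1 kval_gk.
case: kd key ok => -[k|] c' key ok /=.
- have [[ka]|ka] := eqVneq (Some k) (Some a).
    rewrite -gk_cov; congr gauss1; apply/funext => e.
    rewrite key ka.
    transitivity (av (w e) n (fun t => gk e c (t a) * gk e c' (t a)) t0).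
      by congr (av _ _ _ _); apply/funext => t; rewrite kval_gk.
    exact: (av1_eq (w e) n a (fun x => gk e c x * gk e c' x) t0 (sum_w1 _ _ _ _ _ _ e) an).
  rewrite -[RHS]gauss1_cst; congr gauss1; apply/funext => e; rewrite key.
  apply: (av_centered (w e) t0 (sum_w1 _ _ _ _ _ _ e) n a (gk e c) _ an (gk_mean e c)).
  have ka' : k != a by apply: contraNneq ka => ->.
  by move=> t x; rewrite !kval_gk updE (negbTE ka').
- rewrite -[RHS]gauss1_cst; congr gauss1; apply/funext => e; rewrite key.
  apply: (av_centered (w e) t0 (sum_w1 _ _ _ _ _ _ e) n a (gk e c) _ an (gk_mean e c)).
  by move=> t x; case: c' {key ok}.
Qed.

End OneSiteMoments.

Ltac eval_counts :=
  rewrite /=; repeat (rewrite ?inE ?eqxx /=; match goal with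
  | H : is_true (?x != ?y) |- context [?x == ?y] => rewrite (negbTE H)
  | H : is_true (?x != ?y) |- context [?y == ?x] => rewrite (eq_sym y x) (negbTE H)
  end); rewrite ?inE ?eqxx /= ?big_cons ?big_nil /=;
  repeat (rewrite ?eqxx /=; match goal with
  | H : is_true (?x != ?y) |- context [?x == ?y] => rewrite (negbTE H)
  | H : is_true (?x != ?y) |- context [?y == ?x] => rewrite (eq_sym y x) (negbTE H)
  end); rewrite ?eqxx /=.

Section OneSiteKernels.
Context {R : realType}.
Variables (S : nat) (beta h D p q : R).
Local Notation w e := (w1 S beta h D p q e).
Local Notation mj j e := (mj S beta h D p q j e).
Local Notation t0 := (fun _ : nat => ord0 : spin S).
Local Notation avs e n F := (av (w e) n F t0).
Implicit Types (e : R) (n i j k l a b c d : nat).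

Lemma av_monomial e n (I : seq nat) : all (fun i => (i < n)%N) I ->
  avs e n (fun t => \prod_(i <- I) sv S (t i)) =
  \prod_(i <- undup I) mj (count_mem i I) e.
Proof.
move=> IN; rewrite -(eq_bigr _ (fun i _ => wavg_pw S beta h D p q e (count_mem i I))).
rewrite -(av_prod_uniq (w e) t0 (sum_w1 _ _ _ _ _ _ e) n _ (fun i x => sv S x ^+ count_mem i I)) ?undup_uniq //; last first.
  by apply/allP => i; rewrite mem_undup; exact: (allP IN).
congr (av _ _ _ _); apply/funext => t.
rewrite -big_undup_iterop_count; apply: eq_bigr => i _.
by elim: (count_mem i I) => [|[|c] IH] //; rewrite exprS IH.
Qed.

Lemma av_mono4 e n i j k l : (i < n)%N -> (j < n)%N -> (k < n)%N -> (l < n)%N ->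
  avs e n (fun t => sv S (t i) * sv S (t j) * (sv S (t k) * sv S (t l))) =
  \prod_(x <- undup [:: i; j; k; l]) mj (count_mem x [:: i; j; k; l]) e.
Proof.
move=> iN jN kN lN; rewrite -(av_monomial e n) /= ?iN ?jN ?kN ?lN //.
by congr (av _ _ _ _); apply/funext => t; rewrite !big_cons big_nil mulr1 -mulrA.
Qed.

Definition ge e := mj 1 e ^+ 2 * (mj 2 e - mj 1 e ^+ 2).
Definition fe e := mj 2 e ^+ 2 - mj 1 e ^+ 2 * mj 2 e.
Definition ee e := mj 1 e * (mj 3 e - mj 1 e * mj 2 e).
Definition de e := mj 4 e - mj 2 e ^+ 2.

Definition dd k i : R := (k == i)%:R.

(** Given eta, a monomial in four spins depends only on which indices coincide. The formula with
    Kronecker symbols is checked case by case in the positions of [k] and [l]; away from [a], [b],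
    [c] one must still separate k = l. *)
Lemma kernel_T e n a c b k l : (a < n)%N -> (c < n)%N -> (b < n)%N -> (k < n)%N -> (l < n)%N ->
  a != b -> a != c -> b != c ->
  avs e n (fun t => (sv S (t a) - sv S (t c)) * sv S (t b) * (sv S (t k) * sv S (t l))) =
  ge e * (dd k a - dd k c + dd l a - dd l c
     - 2 * (dd k a * dd l a - dd k c * dd l c)
     - (dd k a * dd l b + dd k b * dd l a - dd k c * dd l b - dd k b * dd l c))
  + fe e * (dd k a * dd l b + dd k b * dd l a - dd k c * dd l b - dd k b * dd l c)
  + ee e * (dd k a * dd l a - dd k c * dd l c).
Proof.
move=> aN cN bN kN lN ab ac bc.
transitivity (avs e n (fun t => sv S (t a) * sv S (t b) * (sv S (t k) * sv S (t l)))
  - avs e n (fun t => sv S (t c) * sv S (t b) * (sv S (t k) * sv S (t l)))).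
  by rewrite -avB; congr (av _ _ _ _); apply/funext => t; ring.
rewrite !av_mono4 // /ge /fe /ee /dd.
have [->|ka] := eqVneq k a; last have [->|kb] := eqVneq k b; last have [->|kc] := eqVneq k c;
  (have [->|la] := eqVneq l a; last have [->|lb] := eqVneq l b; last have [->|lc] := eqVneq l c);
  last have [->|lk] := eqVneq l k; last first.
all: eval_counts.
all: ring.
Qed.

Lemma kernel_S e n a b k l : (a < n)%N -> (b < n)%N -> (k < n)%N -> (l < n)%N -> a != b ->
  avs e n (fun t => (sv S (t a) * sv S (t a) - sv S (t b) * sv S (t b)) * (sv S (t k) * sv S (t l))) =
  ee e * (dd k a - dd k b + dd l a - dd l b - 2 * (dd k a * dd l a - dd k b * dd l b))
  + de e * (dd k a * dd l a - dd k b * dd l b).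
Proof.
move=> aN bN kN lN ab.
transitivity (avs e n (fun t => sv S (t a) * sv S (t a) * (sv S (t k) * sv S (t l)))
  - avs e n (fun t => sv S (t b) * sv S (t b) * (sv S (t k) * sv S (t l)))).
  by rewrite -avB; congr (av _ _ _ _); apply/funext => t; ring.
rewrite !av_mono4 // /ee /de /dd.
have [->|ka] := eqVneq k a; last have [->|kb] := eqVneq k b;
  (have [->|la] := eqVneq l a; last have [->|lb] := eqVneq l b);
  last have [->|lk] := eqVneq l k; last first.
all: eval_counts.
all: ring.
Qed.

Lemma kernel_4 e n a b c d k l : (a < n)%N -> (b < n)%N -> (c < n)%N -> (d < n)%N ->
  (k < n)%N -> (l < n)%N -> a != b -> a != c -> a != d -> b != c -> b != d -> c != d ->
  avs e n (fun t => (sv S (t a) - sv S (t c)) * (sv S (t b) - sv S (t d)) * (sv S (t k) * sv S (t l))) =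
  (fe e - ge e) * (dd k a * dd l b + dd k b * dd l a + dd k c * dd l d + dd k d * dd l c
    - dd k a * dd l d - dd k d * dd l a - dd k c * dd l b - dd k b * dd l c).
Proof.
move=> aN bN cN dN kN lN ab ac ad bc bd cd.
transitivity (avs e n (fun t => sv S (t a) * sv S (t b) * (sv S (t k) * sv S (t l)))
  - avs e n (fun t => sv S (t a) * sv S (t d) * (sv S (t k) * sv S (t l)))
  - avs e n (fun t => sv S (t c) * sv S (t b) * (sv S (t k) * sv S (t l)))
  + avs e n (fun t => sv S (t c) * sv S (t d) * (sv S (t k) * sv S (t l)))).
  by rewrite -!avB -avD; congr (av _ _ _ _); apply/funext => t; ring.
rewrite !av_mono4 // /fe /ge /dd.
have [->|ka] := eqVneq k a; last have [->|kb] := eqVneq k b; last have [->|kc] := eqVneq k c;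
  last have [->|kd] := eqVneq k d;
  (have [->|la] := eqVneq l a; last have [->|lb] := eqVneq l b; last have [->|lc] := eqVneq l c;
  last have [->|ld] := eqVneq l d);
  last have [->|lk] := eqVneq l k; last first.
all: eval_counts.
all: ring.
Qed.

End OneSiteKernels.

Section OneSiteKernelMeans.
Context {R : realType}.
Variables (S : nat) (beta h D p q : R).
Local Notation mj j e := (mj S beta h D p q j e).
Local Notation ge := (ge S beta h D p q).
Local Notation fe := (fe S beta h D p q).
Local Notation ee := (ee S beta h D p q).
Local Notation de := (de S beta h D p q).

Lemma tame_mj j : tame 1 (fun s => mj j s`_0).
Proof.
apply: (tame_ext _ (fun s => av (gibbs (lin_ham 1 (fun _ => one_field S beta q)
   (one_pot S beta h D p q) s)) 1 (fun t => sv S (t 0%N) ^+ j) (fun _ => ord0))) => [s|].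
  rewrite (av1_eq _ 1 0 (fun x => sv S x ^+ j)) //; last exact: (sum_gibbs (ord0 : spin S)).
  have -> : lin_ham 1 (fun _ => one_field S beta q) (one_pot S beta h D p q) s =
    lin_ham 1 (fun _ => one_field S beta q) (one_pot S beta h D p q) [:: s`_0].
    by apply/funext => y; rewrite /lin_ham !big_ord1.
  by rewrite mj_w1.
apply: (tame_av _ _ _ (fun _ t => sv S (t 0%N) ^+ j)) => [u|tau]; last exact: tame_cst.
apply: tame_add; last exact: tame_cst.
by apply: tame_sum => a _; apply: tame_mul; [exact: tame_nth|exact: tame_cst].
Qed.

Lemma gauss1_kernels (cg cf ce cd : R) :
  gauss1 (fun e => ge e * cg + fe e * cf + ee e * ce + de e * cd) =
  Gc S beta h D p q * cg + Fc S beta h D p q * cf + Ecal S beta h D p q * ce + Dcal S beta h D p q * cd.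
Proof.
have t1 := tame_mj 1; have t2 := tame_mj 2; have t3 := tame_mj 3; have t4 := tame_mj 4.
have tg : tame 1 (fun s => ge s`_0).
  by apply: tame_mul; [apply: tame_mul|apply: tame_sub => //; apply: tame_mul].
have tf : tame 1 (fun s => fe s`_0).
  by apply: tame_sub; [apply: tame_mul|apply: tame_mul => //; apply: tame_mul].
have te : tame 1 (fun s => ee s`_0).
  by apply: tame_mul => //; apply: tame_sub => //; apply: tame_mul.
have td : tame 1 (fun s => de s`_0) by apply: tame_sub => //; apply: tame_mul.
have tc (f : R -> R) (c : R) : tame 1 (fun s => f s`_0) -> tame 1 (fun s => f s`_0 * c).
  by move=> tf'; apply: tame_mul => //; exact: tame_cst.
have gc (f : R -> R) (c : R) : tame 1 (fun s => f s`_0) ->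
    gauss_iter 1 (fun s => f s`_0 * c) = gauss_iter 1 (fun s => f s`_0) * c.
  move=> tf'; rewrite [RHS]mulrC -gauss_iterZ //; apply: gauss_iter_ext => s _.
  exact: mulrC.
transitivity (gauss_iter 1 (fun s => ge s`_0 * cg + fe s`_0 * cf + ee s`_0 * ce + de s`_0 * cd)) => //.
rewrite !gauss_iterD ?gc //; do ?apply: tame_add; exact: tc.
Qed.

End OneSiteKernelMeans.

Section CavityKernels.
Context {R : realType}.
Variables (S : nat) (beta h D p q : R).
Local Notation E1 := (E1 S beta h D p q).
Local Notation e1f := (e1f S p q).
Local Notation KK := (KK S beta h D p q).
Local Notation Gg := (Gc S beta h D p q).
Local Notation Ff := (Fc S beta h D p q).
Local Notation Ee := (Ecal S beta h D p q).
Local Notation Dd := (Dcal S beta h D p q).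
Implicit Types (n a b c d k l : nat).

Lemma KK_T n a b k l : (a < n)%N -> (b.+1 < n)%N -> (k < n)%N -> (l < n)%N -> (a < b)%N ->
  KK n (frm (Some a, true) b) k l =
  Gg * (dd k a - dd k b.+1 + dd l a - dd l b.+1
     - 2 * (dd k a * dd l a - dd k b.+1 * dd l b.+1)
     - (dd k a * dd l b + dd k b * dd l a - dd k b.+1 * dd l b - dd k b * dd l b.+1))
  + Ff * (dd k a * dd l b + dd k b * dd l a - dd k b.+1 * dd l b - dd k b * dd l b.+1)
  + Ee * (dd k a * dd l a - dd k b.+1 * dd l b.+1) + Dd * 0.
Proof.
move=> aN bN kN lN ab; rewrite /KK E1_gauss1 -gauss1_kernels; congr gauss1; apply/funext => e.
rewrite mulr0 addr0 -(kernel_T S beta h D p q e n) //; last 4 first.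
- exact: ltnW.
- by rewrite ltn_eqF.
- by rewrite ltn_eqF // ltnW.
- by rewrite ltn_eqF.
congr (av _ _ _ _); apply/funext => s; congr (_ * _).
by rewrite !ev_cons ev_nil /e1f /qq ltn_eqF // gtn_eqF //=; ring.
Qed.

Lemma KK_S n a b k l : (a < n)%N -> (b < n)%N -> (k < n)%N -> (l < n)%N -> (a < b)%N ->
  KK n (frm (Some a, false) b) k l =
  Gg * 0 + Ff * 0 + Ee * (dd k a - dd k b + dd l a - dd l b - 2 * (dd k a * dd l a - dd k b * dd l b))
  + Dd * (dd k a * dd l a - dd k b * dd l b).
Proof.
move=> aN bN kN lN ab; rewrite /KK E1_gauss1 -gauss1_kernels; congr gauss1; apply/funext => e.
rewrite !mulr0 !add0r -(kernel_S S beta h D p q e n) //; last by rewrite ltn_eqF.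
congr (av _ _ _ _); apply/funext => s; congr (_ * _).
by rewrite !ev_cons ev_nil /e1f /qq !eqxx /=; ring.
Qed.

(* Correlation of the deviations of replicas [a] and [b]; [c] and [d] are fresh. *)
Definition frm4 a b c d : form := [:: (1 : R, (a, b)); (-1, (a, d)); (-1, (c, b)); (1, (c, d))].

(* Equals E (m_2 - m_1^2)^2, hence M_3 = 1 - beta^2 * yc. *)
Definition yc : R := Ff - Gg.

Lemma KK_4 n a b c d k l : (a < n)%N -> (b < n)%N -> (c < n)%N -> (d < n)%N ->
  (k < n)%N -> (l < n)%N -> a != b -> a != c -> a != d -> b != c -> b != d -> c != d ->
  KK n (frm4 a b c d) k l =
  yc * (dd k a * dd l b + dd k b * dd l a + dd k c * dd l d + dd k d * dd l c
    - dd k a * dd l d - dd k d * dd l a - dd k c * dd l b - dd k b * dd l c).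
Proof.
move=> aN bN cN dN kN lN ab ac ad bc bd cd; rewrite /yc /KK E1_gauss1.
set V := (X in _ = _ * X).
transitivity (Gg * - V + Ff * V + Ee * 0 + Dd * 0); last by ring.
rewrite -gauss1_kernels; congr gauss1; apply/funext => e.
transitivity ((fe S beta h D p q e - ge S beta h D p q e) * V); last by ring.
rewrite -(kernel_4 S beta h D p q e n) //.
congr (av _ _ _ _); apply/funext => s; congr (_ * _).
have cb : c != b by rewrite eq_sym.
rewrite !ev_cons ev_nil /e1f /qq /= (negbTE ab) (negbTE ad) (negbTE cb) (negbTE cd); ring.
Qed.

Lemma tame_E1 n g : tame 1 (fun s => av (gibbs (lin_ham 1 (fun _ => one_field S beta q)
     (one_pot S beta h D p q) s)) n g (fun _ => ord0)).
Proof.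
apply: (tame_av _ _ _ (fun _ t => g t)) => [u|tau]; last exact: tame_cst.
apply: tame_add; last exact: tame_cst.
by apply: tame_sum => a _; apply: tame_mul; [exact: tame_nth|exact: tame_cst].
Qed.

Lemma E1Z n (c : R) g : E1 n (fun t => c * g t) = c * E1 n g.
Proof.
have tg := tame_E1 n g; rewrite /E1 /gst -gauss_iterZ //.
by apply: gauss_iter_ext => s _; rewrite avZ.
Qed.

Lemma E1D n f g : E1 n (fun t => f t + g t) = E1 n f + E1 n g.
Proof.
have tf := tame_E1 n f; have tg := tame_E1 n g; rewrite /E1 /gst -gauss_iterD //.
by apply: gauss_iter_ext => s _; rewrite avD.
Qed.

Hypothesis fp : fixed_point S beta h D p q.

(** The constants [qq] in the second form drop out because the first form has mean zero, so
    covariances can be read off the kernel formulas. *)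
Lemma cc_KK n lam lam' : fok n lam -> cc S beta h D p q n lam lam' = ev lam' (KK n lam).
Proof.
move=> ok; have lin (U : (nat -> spin S) -> nat -> nat -> R) :
   E1 n (fun s => ev lam (e1f s) * ev lam' (U s)) =
   ev lam' (fun k l => E1 n (fun s => ev lam (e1f s) * U s k l)).
  elim: lam' => [|x lam' IH].
    rewrite ev_nil -[RHS](E1_cst S beta h D p q n 0); congr E1; apply/funext => s.
    by rewrite ev_nil mulr0.
  rewrite ev_cons -IH -E1Z -E1D; congr E1; apply/funext => s; rewrite ev_cons; ring.
rewrite /cc lin /KK; congr ev; apply/funext => k; apply/funext => l.
have e0 := E1_ev S beta h D p q fp n lam ok.
transitivity (E1 n (fun s => ev lam (e1f s) * (sv S (s k) * sv S (s l))) +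
   (- qq p q k l) * E1 n (fun s => ev lam (e1f s))); last by rewrite e0 mulr0 addr0.
rewrite -E1Z -E1D; congr E1; apply/funext => s; rewrite /e1f; ring.
Qed.

(** The indices [c] and [d] lie beyond those of [frm kd j], so only the pair {a, b} can match, and
    it occurs only in T_a when the slot starts at [b]. *)
Lemma cc_4 n a b c d j kd bb : (a < n)%N -> (b < n)%N -> (c < n)%N -> (d < n)%N ->
  a != b -> a != c -> a != d -> b != c -> b != d -> c != d ->
  (a < bb)%N -> (bb <= j)%N -> (j.+1 < c)%N -> (j.+1 < d)%N -> kind_ok bb kd ->
  cc S beta h D p q n (frm4 a b c d) (frm kd j) =
  if (kd == (Some a, true)) && (b == j) then yc else 0.
Proof.
move=> aN bN cN dN ab ac ad bc bd cd abb bbj jc jd kb.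
have ok : fok n (frm4 a b c d) by rewrite /= aN bN cN dN.
rewrite cc_KK //.
have aj : a != j by rewrite ltn_eqF //; exact: leq_trans bbj.
have aj1 : a != j.+1 by rewrite ltn_eqF // ltnW // ltnS; exact: leq_trans bbj.
have cj : c != j by rewrite gtn_eqF // ltnW.
have cj1 : c != j.+1 by rewrite gtn_eqF.
have dj : d != j by rewrite gtn_eqF // ltnW.
have dj1 : d != j.+1 by rewrite gtn_eqF.
have jN : (j < n)%N by apply: ltn_trans cN; exact: ltnW.
have j1N : (j.+1 < n)%N by apply: ltn_trans cN.
have jj : j != j.+1 by rewrite ltn_eqF.
case: kd kb => -[k|] [] kb; rewrite !ev_cons ev_nil /= ?addr0 ?mul1r ?mulN1r.
- have kj : k != j by rewrite ltn_eqF //; exact: leq_trans bbj.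
  have kc : k != c by rewrite ltn_eqF //; apply: leq_ltn_trans jc; exact: leq_trans (ltnW kb) (leq_trans bbj (leqnSn j)).
  have kd : k != d by rewrite ltn_eqF //; apply: leq_ltn_trans jd; exact: leq_trans (ltnW kb) (leq_trans bbj (leqnSn j)).
  have kN : (k < n)%N by apply: ltn_trans jN; exact: leq_trans bbj.
  have kE : ((Some k, true) == (Some a, true) :> kind) = (k == a) by rewrite xpair_eqE andbT.
  rewrite kE !KK_4 // /dd.
  have [->|ka] := eqVneq k a; have [->|bj] := eqVneq b j; do ?have [->|bj1] := eqVneq b j.+1; eval_counts; ring.
- have kj : k != j by rewrite ltn_eqF //; exact: leq_trans bbj.
  have kc : k != c by rewrite ltn_eqF //; apply: leq_ltn_trans jc; exact: leq_trans (ltnW kb) (leq_trans bbj (leqnSn j)).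
  have kd : k != d by rewrite ltn_eqF //; apply: leq_ltn_trans jd; exact: leq_trans (ltnW kb) (leq_trans bbj (leqnSn j)).
  have kN : (k < n)%N by apply: ltn_trans jN; exact: leq_trans bbj.
  have kE : ((Some k, false) == (Some a, true) :> kind) = false by rewrite xpair_eqE andbF.
  rewrite kE !KK_4 // /dd; eval_counts.
  have [->|ka] := eqVneq k a; eval_counts; ring.
- rewrite !KK_4 // /dd; eval_counts; ring.
- rewrite !KK_4 // /dd; eval_counts; ring.
Qed.

End CavityKernels.

(** * The linear system *)

Section KernelSums.
Context {R : realType}.
Implicit Types (V Y : nat -> nat -> R) (n a b c d i j k l : nat).

Lemma sum_dd n i (f : nat -> R) : (i < n)%N -> \sum_(k < n) dd k i * f k = f i.
Proof.
move=> iN; rewrite (bigD1 (Ordinal iN)) //= /dd eqxx mul1r big1 ?addr0 // => k ki.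
by rewrite (_ : (k == i :> nat) = false) ?mul0r //; apply: negbTE.
Qed.

Lemma Qsum_row n i V : (i < n)%N ->
  Qsum n (fun k l => dd k i * V k l) = \sum_(l < n.+1) V i l - n.+1%:R * V i n.+1.
Proof.
move=> iN; rewrite /Qsum.
have ni : dd n i = 0 :> R by rewrite /dd gtn_eqF.
rewrite ni !mul0r [X in n%:R * X](_ : _ = 0) ?mulr0 ?subr0; last first.
  by rewrite big1 ?mulr0 ?subr0 // => l _; rewrite mul0r.
rewrite -(sum_dd n i (fun k => \sum_(l < n.+1) V k l - n.+1%:R * V k n.+1)) //.
apply: eq_bigr => k _; rewrite -mulr_sumr; ring.
Qed.

Lemma Qsum_col n i V : (i < n)%N ->
  Qsum n (fun k l => dd l i * V k l) = \sum_(k < n) V k i - n%:R * V n i.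
Proof.
move=> iN; have iN1 : (i < n.+1)%N by apply: ltnW.
have ni : dd n.+1 i = 0 :> R by rewrite /dd gtn_eqF.
rewrite /Qsum ni !mul0r !mulr0 !subr0 (sum_dd _ _ (V n)) //; congr (_ - _).
apply: eq_bigr => k _; rewrite mul0r mulr0 subr0.
exact: (sum_dd n.+1 i (V k)).
Qed.

Lemma Qsum_entry n i j V : (i < n)%N -> (j < n)%N ->
  Qsum n (fun k l => dd k i * dd l j * V k l) = V i j.
Proof.
move=> iN jN; have jN1 : (j < n.+1)%N by apply: ltnW.
have nj : dd n.+1 j = 0 :> R by rewrite /dd gtn_eqF.
rewrite -[RHS](sum_dd n.+1 j (V i) jN1).
rewrite (_ : \sum_(l < n.+1) _ = \sum_(l < n.+1) dd l j * V i l - n.+1%:R * (dd n.+1 j * V i n.+1)); last first.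
  by rewrite nj mul0r mulr0 subr0.
rewrite -(Qsum_row n i (fun k l => dd l j * V k l)) //.
by apply: Qsum_ext => k l _ _; rewrite mulrA.
Qed.

Lemma Qsum_sym_rows n i Y : (forall k l, Y k l = Y l k) -> (i < n)%N ->
  Qsum n (fun k l => dd k i * Y k l) + Qsum n (fun k l => dd l i * Y k l) =
  2 * \sum_(l < n) Y i l + (1 - n%:R) * Y i n - n.+1%:R * Y i n.+1.
Proof.
move=> Ys iN; rewrite Qsum_row // Qsum_col // big_ord_recr /=.
rewrite [X in _ + (X - _)](eq_bigr (fun k : 'I_n => Y i k)) => [|k _]; last exact: Ys.
rewrite (Ys n i); ring.
Qed.

Lemma sum_if_corrections n i j (P : pred nat) (z : nat -> R) (t u v : R) : (i < n)%N -> (j < n)%N ->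
  \sum_(l < n) ((if P l then z l else 0) + t + (dd l i * u + dd l j * v)) =
  \sum_(l < n | P l) z l + n%:R * t + (u + v).
Proof.
move=> iN jN; rewrite big_split big_split /= -big_mkcond [X in _ + X]big_split /=.
by rewrite (sum_dd n i (fun _ => u)) // (sum_dd n j (fun _ => v)) // sumr_const card_ord mulr_natl.
Qed.

Variables (n a b : nat) (Y : nat -> nat -> R).
Hypothesis Ysym : forall k l, Y k l = Y l k.
Hypothesis abn : (a < b)%N.

(** The form [frm4 a l n n.+1] evaluated on [Y]. *)
Definition zz l := Y a l - Y a n.+1 - Y n l + Y n n.+1.

Section TKernel.
(** The identities assumed below express that [b], [b.+1], [n] and [n.+1] do not occur in the rest
    of the product, hence are interchangeable. *)
Hypothesis bn : (b.+1 < n)%N.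
Hypothesis ya : Y a n = Y a n.+1.
Hypothesis yab : Y a b = Y a n.+1.
Hypothesis yac : Y a b.+1 = Y a n.+1.
Hypothesis yc0 : forall l, (l < n)%N -> l != b.+1 -> Y b.+1 l = Y n l.
Hypothesis yn : Y b.+1 n = Y n n.+1.
Hypothesis yn1 : Y b.+1 n.+1 = Y n n.+1.
Hypothesis ynb : Y n b = Y n n.+1.
Hypothesis ync : Y n b.+1 = Y n n.+1.
Hypothesis ycc : Y b.+1 b.+1 = Y n n.

Lemma zz_fresh : zz b.+1 = 0.
Proof. by rewrite /zz yac ync; ring. Qed.

(** Away from [a] and [b.+1] each difference is [zz l] plus a common value. At these two indices
    diagonal entries enter instead, which accounts for n - 2. *)
Lemma sum_diff_T : \sum_(l < n) (Y a l - Y b.+1 l) =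
  (Y a a - Y n n) + \sum_(l < n | (l : nat) != a) zz l + (n%:R - 2) * (Y a n.+1 - Y n n.+1).
Proof.
have an : (a < n)%N by apply: ltn_trans bn; apply: (ltn_trans abn).
have ac : a != b.+1 by rewrite ltn_eqF // ltnW.
pose tx := Y a n.+1 - Y n n.+1.
transitivity (\sum_(l < n) ((if (l : nat) != a then zz l else 0) + tx
   + (dd l a * (Y a a - Y b.+1 a - tx) + dd l b.+1 * (Y a b.+1 - Y b.+1 b.+1 - tx)))).
  apply: eq_bigr => l _; rewrite /dd; have [->|la] := eqVneq (l : nat) a.
    by rewrite (negbTE ac) /=; ring.
  have [->|lc] := eqVneq (l : nat) b.+1; first by rewrite zz_fresh /=; ring.
  by rewrite yc0 //= /zz /tx; ring.
rewrite (sum_if_corrections n a b.+1 (fun l => l != a)) // (Ysym b.+1 a) ycc /tx; ring.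
Qed.

(** The derivative closes on three unknowns: the moments with T_a and with S_a, and the sum of [zz].
    The explicit factors [n] cancel. Multiplied by beta^2 / 2, the coefficient 2 f - 6 g gives
    M_1. *)
Lemma Qsum_T (g f e d : R) :
  Qsum n (fun k l => (g * (dd k a - dd k b.+1 + dd l a - dd l b.+1
     - 2 * (dd k a * dd l a - dd k b.+1 * dd l b.+1)
     - (dd k a * dd l b + dd k b * dd l a - dd k b.+1 * dd l b - dd k b * dd l b.+1))
  + f * (dd k a * dd l b + dd k b * dd l a - dd k b.+1 * dd l b - dd k b * dd l b.+1)
  + e * (dd k a * dd l a - dd k b.+1 * dd l b.+1) + d * 0) * Y k l) =
  (2 * f - 6 * g) * (Y a n.+1 - Y n n.+1) + e * (Y a a - Y n n)
  + 2 * g * \sum_(l < n | (l : nat) != a) zz l.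
Proof.
have bn' : (b < n)%N by apply: ltnW.
have an : (a < n)%N by apply: ltn_trans bn; apply: (ltn_trans abn).
pose R1 i k l := dd k i * Y k l; pose R2 i k l := dd l i * Y k l.
pose En i j k l := dd k i * dd l j * Y k l.
transitivity (g * (Qsum n (R1 a) + Qsum n (R2 a) - (Qsum n (R1 b.+1) + Qsum n (R2 b.+1)))
   + (e - 2 * g) * (Qsum n (En a a) - Qsum n (En b.+1 b.+1))
   + (f - g) * (Qsum n (En a b) + Qsum n (En b a) - Qsum n (En b.+1 b) - Qsum n (En b b.+1))).
  rewrite -!(QsumD, QsumB, QsumZ); apply: Qsum_ext => k l _ _; rewrite /R1 /R2 /En; ring.
rewrite !Qsum_entry // !Qsum_sym_rows //.
rewrite (_ : 2 * _ + _ - _ - _ = 2 * (\sum_(l < n) (Y a l - Y b.+1 l))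
   + (1 - n%:R) * (Y a n - Y b.+1 n) - n.+1%:R * (Y a n.+1 - Y b.+1 n.+1)); last first.
  by rewrite sumrB; ring.
rewrite sum_diff_T ya yn yn1 ycc (Ysym b a) (Ysym b b.+1) yc0 // ?yab ?ynb; last first.
  by rewrite ltn_eqF.
rewrite -[n.+1%:R]natr1; ring.
Qed.

End TKernel.

Section SKernel.
Hypothesis bn : (b < n)%N.
Hypothesis ya : Y a n = Y a n.+1.
Hypothesis yab : Y a b = Y a n.+1.
Hypothesis yc0 : forall l, (l < n)%N -> l != b -> Y b l = Y n l.
Hypothesis yn : Y b n = Y n n.+1.
Hypothesis yn1 : Y b n.+1 = Y n n.+1.
Hypothesis ynb : Y n b = Y n n.+1.
Hypothesis ycc : Y b b = Y n n.

Lemma sum_diff_S : \sum_(l < n) (Y a l - Y b l) =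
  (Y a a - Y n n) + \sum_(l < n | (l : nat) != a) zz l + (n%:R - 2) * (Y a n.+1 - Y n n.+1).
Proof.
have an : (a < n)%N by apply: ltn_trans bn.
have ac : a != b by rewrite ltn_eqF.
have zb : zz b = 0 by rewrite /zz yab ynb; ring.
pose tx := Y a n.+1 - Y n n.+1.
transitivity (\sum_(l < n) ((if (l : nat) != a then zz l else 0) + tx
   + (dd l a * (Y a a - Y b a - tx) + dd l b * (Y a b - Y b b - tx)))).
  apply: eq_bigr => l _; rewrite /dd; have [->|la] := eqVneq (l : nat) a.
    by rewrite (negbTE ac) /=; ring.
  have [->|lc] := eqVneq (l : nat) b; first by rewrite zb /=; ring.
  by rewrite yc0 //= /zz /tx; ring.
rewrite (sum_if_corrections n a b (fun l => l != a)) // (Ysym b a) ycc /tx; ring.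
Qed.

Lemma Qsum_S (g f e d : R) :
  Qsum n (fun k l => (g * 0 + f * 0 +
    e * (dd k a - dd k b + dd l a - dd l b - 2 * (dd k a * dd l a - dd k b * dd l b))
    + d * (dd k a * dd l a - dd k b * dd l b)) * Y k l) =
  d * (Y a a - Y n n) - 4 * e * (Y a n.+1 - Y n n.+1)
  + 2 * e * \sum_(l < n | (l : nat) != a) zz l.
Proof.
have an : (a < n)%N by apply: ltn_trans bn.
pose R1 i k l := dd k i * Y k l; pose R2 i k l := dd l i * Y k l.
pose En i j k l := dd k i * dd l j * Y k l.
transitivity (e * (Qsum n (R1 a) + Qsum n (R2 a) - (Qsum n (R1 b) + Qsum n (R2 b)))
   + (d - 2 * e) * (Qsum n (En a a) - Qsum n (En b b))).
  rewrite -!(QsumD, QsumB, QsumZ); apply: Qsum_ext => k l _ _; rewrite /R1 /R2 /En; ring.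
rewrite !Qsum_entry // !Qsum_sym_rows //.
rewrite (_ : 2 * _ + _ - _ - _ = 2 * (\sum_(l < n) (Y a l - Y b l))
   + (1 - n%:R) * (Y a n - Y b n) - n.+1%:R * (Y a n.+1 - Y b n.+1)); last first.
  by rewrite sumrB; ring.
rewrite sum_diff_S ya yn yn1 ycc -[n.+1%:R]natr1; ring.
Qed.

End SKernel.

(** The correlation of two deviations reproduces itself alone; with the prefactor beta^2 / 2, the
    coefficient 2 y gives M_3. *)
Lemma Qsum_4 l (y : R) : (a < n)%N -> (l < n)%N ->
  Qsum n.+2 (fun k m => y * (dd k a * dd m l + dd k l * dd m a + dd k n * dd m n.+1 + dd k n.+1 * dd m n
    - dd k a * dd m n.+1 - dd k n.+1 * dd m a - dd k n * dd m l - dd k l * dd m n) * Y k m) =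
  2 * y * zz l.
Proof.
move=> an ln; have an2 : (a < n.+2)%N by do 2 apply: ltnW.
have ln2 : (l < n.+2)%N by do 2 apply: ltnW.
pose En i j k l := dd k i * dd l j * Y k l.
transitivity (y * (Qsum n.+2 (En a l) + Qsum n.+2 (En l a) + Qsum n.+2 (En n n.+1) + Qsum n.+2 (En n.+1 n)
  - Qsum n.+2 (En a n.+1) - Qsum n.+2 (En n.+1 a) - Qsum n.+2 (En n l) - Qsum n.+2 (En l n))).
  rewrite -!(QsumD, QsumB, QsumZ); apply: Qsum_ext => k m _ _; rewrite /En; ring.
rewrite !Qsum_entry // (Ysym l a) (Ysym n.+1 n) (Ysym n.+1 a) (Ysym l n) /zz; ring.
Qed.

End KernelSums.

(** * Moments indexed by lists of kinds *)

Section KindMoments.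
Context {R : realType}.
Variables (S : nat) (beta h D p q : R).
Local Notation cfg M := (config S M.+1).
Local Notation nuN M := (nuN S beta h D M).
Implicit Types (M n a b j k l : nat).

Definition Vc M (x y : cfg M) : R := dl M * \sum_i (sp S M x i * sp S M y i - q).
Definition Dc M (x : cfg M) : R := dl M * \sum_i (sp S M x i * sp S M x i - p).
Definition gwt M (s : seq R) : cfg M -> R :=
  gibbs (lin_ham (M.+1 * M.+1) (csk S beta M) (Wsk S h D M) s).

(* Moment of a product of kinds, in the sqrt N scaling, with N = M + 1. *)
Definition mm M b (kds : seq kind) : R := gauss_iter (M.+1 * M.+1) (fun s =>
  av (gwt M s) b (kvals (gwt M s) (Vc M) (Dc M) kds) (cfg0 S M)).

Lemma Vc_sym M x y : Vc M x y = Vc M y x.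
Proof. by congr (_ * _); apply: eq_bigr => i _; rewrite mulrC. Qed.

Lemma sum_gwt M s : \sum_x gwt M s x = 1.
Proof. exact: (sum_gibbs (cfg0 S M 0%N)). Qed.

Lemma X_pf M k l t : X S p q M k l t = pf (Vc M) (Dc M) t k l.
Proof. by rewrite /X /pf /es /qq; case: eqP => [->|]. Qed.

Lemma Xf_pf M t : Xf S p q M t = pf (Vc M) (Dc M) t.
Proof. by apply/funext => k; apply/funext => l; exact: X_pf. Qed.

Lemma nuN_E M n F : nuN M n F = gauss_iter (M.+1 * M.+1) (fun s => av (gwt M s) n F (cfg0 S M)).
Proof. by []. Qed.

Lemma av_gwt_frms M s b n L : slots_ok b n L -> (b <= n)%N ->
  av (gwt M s) n (fun t => PV (frms b L) (Xf S p q M t)) (cfg0 S M) =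
  av (gwt M s) b (kvals (gwt M s) (Vc M) (Dc M) (unzip1 L)) (cfg0 S M).
Proof.
move=> ok bn.
have e1 := av_frms (gwt M s) (Vc M) (Dc M) (cfg0 S M) (sum_gwt M s) n b L (fun _ => 1) ok (fun _ _ _ _ => erefl).
transitivity (av (gwt M s) n (fun t => PV (frms b L) (pf (Vc M) (Dc M) t) * 1) (cfg0 S M)).
  by congr (av _ _ _ _); apply/funext => t; rewrite mulr1 Xf_pf.
rewrite e1 -(subnKC bn) av_extend; last 2 first.
- exact: sum_gwt.
- move=> j bj t x; rewrite !mulr1; apply: eq_big_seq => kd kL.
  have kb : kind_ok b kd by case/and3P: ok => /allP H _ _; apply: H.
  exact: indep_kval kb bj t x.
by congr (av _ _ _ _); apply/funext => t; rewrite mulr1.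
Qed.

Lemma nuN_frms M b n L : slots_ok b n L -> (b <= n)%N ->
  nuN M n (fun t => PV (frms b L) (Xf S p q M t)) = mm M b (unzip1 L).
Proof.
by move=> ok bn; rewrite nuN_E /mm; apply: gauss_iter_ext => s _; exact: av_gwt_frms.
Qed.

Lemma nuN_fresh M n k j j' F : (j < n)%N -> (j' < n)%N -> k != j -> k != j' ->
  indep F j -> indep F j' ->
  nuN M n (fun t => X S p q M k j t * F t) = nuN M n (fun t => X S p q M k j' t * F t).
Proof.
move=> jn jn' kj kj' iF iF'; rewrite !nuN_E; apply: gauss_iter_ext => s _.
have e1 := av_pf_fresh (gwt M s) (Vc M) (Dc M) (cfg0 S M) (sum_gwt M s) n k j F jn kj iF.
have e2 := av_pf_fresh (gwt M s) (Vc M) (Dc M) (cfg0 S M) (sum_gwt M s) n k j' F jn' kj' iF'.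
transitivity (av (gwt M s) n (fun t => pf (Vc M) (Dc M) t k j * F t) (cfg0 S M)).
  by congr (av _ _ _ _); apply/funext => t; rewrite X_pf.
rewrite e1 -e2.
by congr (av _ _ _ _); apply/funext => t; rewrite X_pf.
Qed.

Lemma nuN_fresh_diag M n j j' F : (j < n)%N -> (j' < n)%N -> indep F j -> indep F j' ->
  nuN M n (fun t => X S p q M j j t * F t) = nuN M n (fun t => X S p q M j' j' t * F t).
Proof.
move=> jn jn' iF iF'; rewrite !nuN_E; apply: gauss_iter_ext => s _.
have e1 := av_pf_diag (gwt M s) (Vc M) (Dc M) (cfg0 S M) (sum_gwt M s) n j F jn iF.
have e2 := av_pf_diag (gwt M s) (Vc M) (Dc M) (cfg0 S M) (sum_gwt M s) n j' F jn' iF'.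
transitivity (av (gwt M s) n (fun t => pf (Vc M) (Dc M) t j j * F t) (cfg0 S M)).
  by congr (av _ _ _ _); apply/funext => t; rewrite X_pf.
rewrite e1 -e2.
by congr (av _ _ _ _); apply/funext => t; rewrite X_pf.
Qed.

Lemma X_sym M k l t : X S p q M k l t = X S p q M l k t.
Proof. by rewrite !X_pf; exact: (pf_sym _ _ (Vc_sym M)). Qed.

Definition del {A : Type} v (s : seq A) := take v s ++ drop v.+1 s.

(** Numbering starts at 1: slot 0 is kept for the factor to be removed. *)
Definition slotted (kds : seq kind) := zip kds (iota 1 (size kds)).

Lemma size_slotted kds : size (slotted kds) = size kds.
Proof. by rewrite size_zip size_iota minnn. Qed.

Lemma unzip1_slotted kds : unzip1 (slotted kds) = kds.
Proof. by rewrite unzip1_zip // size_iota. Qed.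

Lemma unzip2_slotted kds : unzip2 (slotted kds) = iota 1 (size kds).
Proof. by rewrite unzip2_zip // size_iota. Qed.

Lemma slotted_ok b n kds : all (kind_ok b) kds -> (slot b (size kds).+1 <= n)%N ->
  slots_ok b n (slotted kds).
Proof.
move=> kb sn; rewrite /slots_ok unzip1_slotted kb unzip2_slotted iota_uniq /=.
by apply/allP => i; rewrite mem_iota; move: sn; rewrite /slot; lia.
Qed.

Lemma subseq_slots_ok b n L L' : subseq L' L -> slots_ok b n L -> slots_ok b n L'.
Proof.
move=> sL /and3P[h1 h2 h3].
have s1 := map_subseq fst sL; have s2 := map_subseq snd sL.
apply/and3P; split; [|exact: subseq_uniq s2 h2|].
- by apply/allP => x /(mem_subseq s1) xL; exact: (allP h1).
- by apply/allP => x /(mem_subseq s2) xL; exact: (allP h3).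
Qed.

Lemma del_subseq {A : eqType} v (s : seq A) : subseq (del v s) s.
Proof.
rewrite /del -[X in subseq _ X](cat_take_drop v s); apply: cat_subseq => //.
by rewrite -add1n -drop_drop; exact: drop_subseq.
Qed.

Lemma map_del {A B : Type} (f : A -> B) v s : [seq f x | x <- del v s] = del v [seq f x | x <- s].
Proof. by rewrite /del map_cat map_take map_drop. Qed.

Lemma nuN_rm M b n v kds : all (kind_ok b) kds -> (slot b (size kds).+1 <= n)%N ->
  nuN M n (fun t => PV (rm v (frms b (slotted kds))) (Xf S p q M t)) = mm M b (del v kds).
Proof.
move=> kb sn; have ok := slotted_ok _ _ _ kb sn.
have bn : (b <= n)%N by apply: leq_trans sn; exact: leq_addr.
have okv := subseq_slots_ok _ _ _ _ (del_subseq v _) ok.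
rewrite -[X in mm M b (del v X)](unzip1_slotted kds) -(map_del fst) -(nuN_frms M b n _ okv bn).
by rewrite /frms map_del.
Qed.

(** The factors themselves contain Gibbs means, hence depend on the disorder. Written with fresh
    replicas they become forms with fixed coefficients, for which only the Gibbs weights vary. *)
Lemma tame_kvals M b kds : all (kind_ok b) kds ->
  tame (M.+1 * M.+1) (fun s => av (gwt M s) b (kvals (gwt M s) (Vc M) (Dc M) kds) (cfg0 S M)).
Proof.
move=> kb; set n := slot b (size kds).+1.
have ok := slotted_ok b n kds kb (leqnn _).
have bn : (b <= n)%N by exact: leq_addr.
apply: (tame_ext _ (fun s => av (gwt M s) n (fun t => PV (frms b (slotted kds)) (Xf S p q M t)) (cfg0 S M))).
  by move=> s; rewrite av_gwt_frms // unzip1_slotted.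
apply: (tame_av _ _ _ (fun _ t => PV (frms b (slotted kds)) (Xf S p q M t))) => [u|tau]; last exact: tame_cst.
apply: tame_add; last exact: tame_cst.
by apply: tame_sum => a _; apply: tame_mul; [exact: tame_nth|exact: tame_cst].
Qed.

End KindMoments.

(** * The cavity equations for T_a, S_a and the correlations of deviations *)

Section CavityEquations.
Local Opaque nuN.
Context {R : realType}.
Variables (S : nat) (beta h D p q : R).
Hypothesis fp : fixed_point S beta h D p q.
Hypothesis beta0 : 0 < beta.
Hypothesis betaS : beta * S%:R ^+ 2 <= 200%:R^-1.
Local Notation cfg M := (config S M.+1).
Local Notation nuN M := (nuN S beta h D M).
Local Notation Xfn := (Xf S p q).
Local Notation mm := (mm S beta h D p q).
Local Notation Gg := (Gc S beta h D p q).
Local Notation Ff := (Fc S beta h D p q).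
Local Notation Ee := (Ecal S beta h D p q).
Local Notation Dd := (Dcal S beta h D p q).
Local Notation gcov := (gcov S beta h D p q).
Local Notation KK := (KK S beta h D p q).
Local Notation cc := (cc S beta h D p q).

Lemma nuN_ev M n lam (F : (nat -> cfg M) -> R) :
  nuN M n (fun t => ev lam (Xfn M t) * F t) =
  ev lam (fun k l => nuN M n (fun t => X S p q M k l t * F t)).
Proof.
elim: lam => [|x lam IH].
  rewrite ev_nil -(nuc_cst S beta h D p q M (pi / 2) n 0) nuc_pi2 -!(nuc_pi2 S beta h D p q).
  by apply: nuc_ext => t; rewrite ev_nil mul0r.
rewrite ev_cons -IH -!(nuc_pi2 S beta h D p q) -nucZ -nucD; apply: nuc_ext => t.
by rewrite ev_cons mulrDl -mulrA.
Qed.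

Lemma sum_cast (m n : nat) (F : nat -> R) : m = n -> \sum_(i < m) F i = \sum_(i < n) F i.
Proof. by move=> ->. Qed.

Variables (b a : nat) (kds : seq kind).
Hypothesis ab : (a < b)%N.
Hypothesis kb : all (kind_ok b) kds.
Let n := slot b (size kds).+1.
Let f : seq (form (R := R)) := frms b (slotted kds).

(** The slots use replicas below [n]. Four more are provided because [equation_4] applies the
    expansion with [n.+2] replicas, which creates two further ones. *)
Definition Yv M k l : R := nuN M n.+4 (fun t => X S p q M k l t * PV f (Xfn M t)).

Let ok : slots_ok b n (slotted kds) := slotted_ok _ _ _ kb (leqnn _).
Let okf : all (fok n) f := frms_ok b n (slotted kds) ok.

Lemma b2n : (b.+1 < n)%N.
Proof. by rewrite /n /slot; lia. Qed.

Lemma indepPVf M j : (b <= j)%N -> (j < b.+2)%N || (n <= j)%N ->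
  indep (fun t : nat -> cfg M => PV f (Xfn M t)) j.
Proof.
move=> bj jf t x; rewrite !Xf_pf.
have kb' : all (kind_ok b) (unzip1 (slotted kds)) by rewrite unzip1_slotted.
apply: (indep_PV_frms (Vc S q M) (Dc S p M) b (slotted kds) j kb' bj) => i.
rewrite unzip2_slotted mem_iota; move: jf; rewrite /n /slot; lia.
Qed.

Lemma depnPVf M : depn n (fun t : nat -> cfg M => PV f (Xfn M t)).
Proof. exact: (depn_PVx _ _ _ _ _ _ fp n f M okf). Qed.

Lemma Yv_ext M m k l : (n <= m)%N -> (m <= n.+4)%N -> (k < m)%N -> (l < m)%N ->
  nuN M m (fun t => X S p q M k l t * PV f (Xfn M t)) = Yv M k l.
Proof.
move=> nm mn km lm; rewrite /Yv -(subnKC mn) -!(nuc_pi2 S beta h D p q) nuc_extend //.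
apply: depnM; first exact: (depn_X _ _ _ (q_ge0 _ _ _ _ _ _ fp) M m k l km lm).
by move=> j mj; apply: depnPVf; exact: leq_trans mj.
Qed.

Lemma Yv_sym M k l : Yv M k l = Yv M l k.
Proof.
rewrite /Yv -!(nuc_pi2 S beta h D p q); apply: nuc_ext => t.
by rewrite X_sym.
Qed.

(** The pair of slot 0 and the replicas from [n] on: these do not occur in [f]. *)
Let fresh j := [&& (b <= j)%N, (j < b.+2)%N || (n <= j)%N & (j < n.+4)%N].

Lemma Yv_fresh M k j j' : fresh j -> fresh j' -> k != j -> k != j' -> Yv M k j = Yv M k j'.
Proof.
move=> /and3P[h1 h2 h3] /and3P[h4 h5 h6] kj kj'.
by apply: nuN_fresh => //; exact: indepPVf.
Qed.

Lemma Yv_diag M j j' : fresh j -> fresh j' -> Yv M j j = Yv M j' j'.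
Proof.
move=> /and3P[h1 h2 h3] /and3P[h4 h5 h6].
by apply: nuN_fresh_diag => //; exact: indepPVf.
Qed.

Lemma freshb : fresh b. Proof. by rewrite /fresh /n /slot; lia. Qed.
Lemma freshb1 : fresh b.+1. Proof. by rewrite /fresh /n /slot; lia. Qed.
Lemma freshn : fresh n. Proof. by rewrite /fresh /n /slot; lia. Qed.
Lemma freshn1 : fresh n.+1. Proof. by rewrite /fresh /n /slot; lia. Qed.

Let kd0 : kind := (None, true).

Lemma size_f : size f = size kds.
Proof. by rewrite size_map size_slotted. Qed.

Lemma nth_f v : (v < size kds)%N -> nth [::] f v = frm (nth kd0 kds v) (slot b v.+1).
Proof.
move=> vs; rewrite /f /frms (nth_map (kd0, 0%N)) ?size_slotted // nth_zip ?size_iota //=.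
by rewrite nth_iota.
Qed.

Lemma nth_kind_ok v : (v < size kds)%N -> kind_ok b (nth kd0 kds v).
Proof. by move=> vs; apply: (allP kb); exact: mem_nth. Qed.

Lemma pair_ok c v : (v < size kds)%N -> slots_ok b n [:: ((Some a, c), 0%N); (nth kd0 kds v, v.+1)].
Proof.
move=> vs; rewrite /slots_ok /= nth_kind_ok // {1}/kind_ok /= ab /n /slot /=; lia.
Qed.

Lemma cc_sum c M :
  \sum_(v < size f) cc n (frm (Some a, c) b) (nth [::] f v) * nuN M n (fun t => PV (rm v f) (Xfn M t)) =
  \sum_(v < size kds) (if (nth kd0 kds v).1 == Some a then gcov c (nth kd0 kds v).2 else 0) * mm M b (del v kds).
Proof.
rewrite (sum_cast _ _ (fun v => cc n (frm (Some a, c) b) (nth [::] f v) *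
   nuN M n (fun t => PV (rm v f) (Xfn M t))) size_f).
apply: eq_bigr => v _; have vs := ltn_ord v.
have e1 := nuN_rm S beta h D p q M b n v kds kb (leqnn _).
have e2 := cc_frm S beta h D p q n b a c 0 _ v.+1 (pair_ok c v vs).
have sl0 : slot b 0 = b by rewrite /slot muln0 addn0.
rewrite sl0 -nth_f // in e2.
by rewrite e2 e1.
Qed.

Definition txv M := Yv M a n.+1 - Yv M n n.+1.
Definition sxv M := Yv M a a - Yv M n n.
Definition zsum M := \sum_(l < n | (l : nat) != a) zz n a (Yv M) l.

Let neqs : [/\ a != b, a != b.+1, a != n, a != n.+1 & b != n] /\ [/\ b != n.+1, b.+1 != n, b.+1 != n.+1, n != n.+1 & b != b.+1].
Proof. by have := b2n; have := ab; move: n => m ab' bm; split; split; rewrite neq_ltn; lia. Qed.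

Lemma an : (a < n)%N.
Proof. by apply: ltn_trans b2n; apply: ltnW; rewrite ltnS. Qed.

Lemma nuN_T M : nuN M n (fun t => ev (frm (Some a, true) b) (Xfn M t) * PV f (Xfn M t)) = txv M.
Proof.
case: neqs => -[n1 n2 n3 n4 n5] [n6 n7 n8 n9 n10]; have bn := ltnW b2n; have := b2n => bn1.
have an' := an; have nn4 : (n <= n.+4)%N by do 4 apply: leqW.
rewrite nuN_ev !ev_cons ev_nil /= !(Yv_ext _ n) //.
rewrite (Yv_fresh M a b n.+1) ?freshb ?freshn1 //.
rewrite (Yv_fresh M b.+1 b n.+1) ?freshb ?freshn1 //; last by rewrite eq_sym.
have m1 : n.+1 != b.+1 by rewrite eq_sym.
have m2 : n.+1 != n by rewrite eq_sym.
rewrite (Yv_sym M b.+1) (Yv_fresh M n.+1 b.+1 n) ?freshb1 ?freshn //.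
by rewrite (Yv_sym M n.+1) mul1r mulN1r addr0.
Qed.

Lemma nuN_S M : nuN M n (fun t => ev (frm (Some a, false) b) (Xfn M t) * PV f (Xfn M t)) = sxv M.
Proof.
have bn := ltnW b2n; have an' := an; have nn4 : (n <= n.+4)%N by do 4 apply: leqW.
rewrite nuN_ev !ev_cons ev_nil /= !(Yv_ext _ n) //.
by rewrite (Yv_diag M b n) ?freshb ?freshn // mul1r mulN1r addr0.
Qed.

Lemma nuN_4 M l : (l < n)%N ->
  nuN M n.+2 (fun t => ev (frm4 a l n n.+1) (Xfn M t) * PV f (Xfn M t)) = zz n a (Yv M) l.
Proof.
move=> ln; have an' := an; have n2 : (n <= n.+2)%N by do 2 apply: leqW.
have l2 : (l < n.+2)%N by do 2 apply: ltnW.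
have a2 : (a < n.+2)%N by do 2 apply: ltnW.
rewrite nuN_ev !ev_cons ev_nil /= !(Yv_ext _ n.+2) //.
by rewrite /zz; move: (Yv M) => Y; ring.
Qed.

Local Opaque Yv.

Lemma Yv_facts M : [/\ Yv M a n = Yv M a n.+1, Yv M a b = Yv M a n.+1, Yv M a b.+1 = Yv M a n.+1,
   Yv M b n = Yv M n n.+1 & Yv M b n.+1 = Yv M n n.+1] /\
   [/\ Yv M b.+1 n = Yv M n n.+1, Yv M b.+1 n.+1 = Yv M n n.+1, Yv M n b = Yv M n n.+1 & Yv M n b.+1 = Yv M n n.+1].
Proof.
case: neqs => -[n1 n2 n3 n4 n5] [n6 n7 n8 n9 n10].
have F k j j' := Yv_fresh M k j j'; have fb := freshb; have fb1 := freshb1; have fn := freshn; have fn1 := freshn1.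
have nb : n != b by rewrite eq_sym.
have nb1 : n != b.+1 by rewrite eq_sym.
split; split.
- exact: F.
- exact: F.
- exact: F.
- by rewrite (Yv_sym M b n); exact: F.
- by rewrite (F b n.+1 n fn1 fn n6 n5) (Yv_sym M b n); exact: F.
- by rewrite (Yv_sym M b.+1 n); exact: F.
- by rewrite (F b.+1 n.+1 n fn1 fn n8 n7) (Yv_sym M b.+1 n); exact: F.
- exact: F.
- exact: F.
Qed.

Lemma Yv_row M c l : fresh c -> (c < n)%N -> (l < n)%N -> l != c -> Yv M c l = Yv M n l.
Proof.
move=> fc cn ln lc; rewrite (Yv_sym M c) (Yv_sym M n); apply: Yv_fresh => //; first exact: freshn.
by rewrite neq_ltn ln.
Qed.

Lemma okT c : fok n (frm (R := R) (Some a, c) b).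
Proof.
have := frm_ok (R := R) b n (Some a, c) 0 ab; rewrite /slot muln0 addn0; apply; exact: b2n.
Qed.

Lemma equation_T : Od (fun M => txv M -
  (\sum_(v < size kds) (if (nth kd0 kds v).1 == Some a then gcov true (nth kd0 kds v).2 else 0) * mm M b (del v kds)
   + beta ^+ 2 / 2 * ((2 * Ff - 6 * Gg) * txv M + Ee * sxv M + 2 * Gg * zsum M))).
Proof.
apply: Od_ext (cavity _ _ _ _ _ _ fp beta0 betaS n _ f (okT true) okf) => M.
rewrite nuN_T cc_sum.
have [[f1 f2 f3 _ _] [g1 g2 g3 g4]] := Yv_facts M.
have e3 : Qsum n (fun k l => KK n.+2 (frm (Some a, true) b) k l *
    nuN M n.+2 (fun t => X S p q M k l t * PV f (Xfn M t))) =
   (2 * Ff - 6 * Gg) * txv M + Ee * sxv M + 2 * Gg * zsum M.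
  rewrite -(Qsum_T n a b (Yv M) (Yv_sym M) ab b2n f1 f2 f3 _ g1 g2 g3 g4 _ Gg Ff Ee Dd).
  - apply: Qsum_ext => k l kn ln.
    have an2 : (a < n.+2)%N by have := an; move=> an'; do 2 apply: ltnW.
    have b12 : (b.+1 < n.+2)%N by have := b2n; move=> bn'; do 2 apply: ltnW.
    have nn2 : (n <= n.+2)%N by do 2 apply: leqW.
    have nn4 : (n.+2 <= n.+4)%N by do 2 apply: leqW.
    have k1 := KK_T S beta h D p q n.+2 a b k l an2 b12 kn ln ab.
    have k2 := Yv_ext M n.+2 k l nn2 nn4 kn ln.
    by rewrite k1 k2.
  - by move=> l ln lb; exact: (Yv_row M b.+1 l freshb1 b2n ln lb).
  - by apply: Yv_diag; [exact: freshb1|exact: freshn].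
by rewrite e3.
Qed.

Lemma equation_S : Od (fun M => sxv M -
  (\sum_(v < size kds) (if (nth kd0 kds v).1 == Some a then gcov false (nth kd0 kds v).2 else 0) * mm M b (del v kds)
   + beta ^+ 2 / 2 * (Dd * sxv M - 4 * Ee * txv M + 2 * Ee * zsum M))).
Proof.
apply: Od_ext (cavity _ _ _ _ _ _ fp beta0 betaS n _ f (okT false) okf) => M.
rewrite nuN_S cc_sum.
have [[f1 f2 f3 f4 f5] [g1 g2 g3 g4]] := Yv_facts M.
have e3 : Qsum n (fun k l => KK n.+2 (frm (Some a, false) b) k l *
    nuN M n.+2 (fun t => X S p q M k l t * PV f (Xfn M t))) =
   Dd * sxv M - 4 * Ee * txv M + 2 * Ee * zsum M.
  rewrite -(Qsum_S n a b (Yv M) (Yv_sym M) ab (ltnW b2n) f1 f2 _ f4 f5 g3 _ Gg Ff Ee Dd).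
  - apply: Qsum_ext => k l kn ln.
    have an2 : (a < n.+2)%N by have := an; move=> an'; do 2 apply: ltnW.
    have b12 : (b < n.+2)%N by have := ltnW b2n; move=> bn'; do 2 apply: ltnW.
    have nn2 : (n <= n.+2)%N by do 2 apply: leqW.
    have nn4 : (n.+2 <= n.+4)%N by do 2 apply: leqW.
    have k1 := KK_S S beta h D p q n.+2 a b k l an2 b12 kn ln ab.
    have k2 := Yv_ext M n.+2 k l nn2 nn4 kn ln.
    by rewrite k1 k2.
  - by move=> l ln lb; exact: (Yv_row M b l freshb (ltnW b2n) ln lb).
  - by apply: Yv_diag; [exact: freshb|exact: freshn].
by rewrite e3.
Qed.

Local Notation yc := (yc S beta h D p q).

(** A source term can arise only when [l] is the first replica of a slot occupied by T_a. *)
Lemma equation_4 l : (l < n)%N -> l != a -> Od (fun M => zz n a (Yv M) l -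
  (\sum_(v < size kds) (if (nth kd0 kds v == (Some a, true)) && (l == slot b v.+1) then yc else 0) * mm M b (del v kds)
   + beta ^+ 2 / 2 * (2 * yc * zz n a (Yv M) l))).
Proof.
move=> ln la; have an' := an.
have l2 : (l < n.+2)%N by do 2 apply: ltnW.
have a2 : (a < n.+2)%N by do 2 apply: ltnW.
have okl : fok n.+2 (frm4 (R := R) a l n n.+1) by rewrite /= a2 l2 !ltnS !leqnn leqnSn.
have okf2 : all (fok n.+2) f by apply: all_fokS okf; do 2 apply: leqW.
have al : a != l by rewrite eq_sym.
have [an1 an2 ln1 ln2] : [/\ a != n, a != n.+1, l != n & l != n.+1].
  by split; rewrite neq_ltn ?an' ?ln // ltnW ?ltnS.
have nn : n != n.+1 by rewrite neq_ltn leqnn.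
apply: Od_ext (cavity _ _ _ _ _ _ fp beta0 betaS n.+2 _ f okl okf2) => M.
rewrite (nuN_4 M l ln).
have e2 : \sum_(v < size f) cc n.+2 (frm4 a l n n.+1) (nth [::] f v) * nuN M n.+2 (fun t => PV (rm v f) (Xfn M t)) =
  \sum_(v < size kds) (if (nth kd0 kds v == (Some a, true)) && (l == slot b v.+1) then yc else 0) * mm M b (del v kds).
  rewrite (sum_cast _ _ (fun v => cc n.+2 (frm4 a l n n.+1) (nth [::] f v) *
     nuN M n.+2 (fun t => PV (rm v f) (Xfn M t))) size_f).
  apply: eq_bigr => v _; have vs := ltn_ord v.
  have n2 : (n <= n.+2)%N by do 2 apply: leqW.
  have e1 := nuN_rm S beta h D p q M b n.+2 v kds kb n2.
  have sn : ((slot b v.+1).+1 < n)%N by rewrite /n /slot; lia.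
  have bs : (b <= slot b v.+1)%N by rewrite /slot; lia.
  have e3 := cc_4 S beta h D p q fp n.+2 a l n n.+1 (slot b v.+1) (nth kd0 kds v) b
    a2 l2 (ltnW (leqnn _)) (leqnn _) al an1 an2 ln1 ln2 nn ab bs sn (ltnW sn) (nth_kind_ok v vs).
  by rewrite nth_f // e3 e1.
have e4 : Qsum n.+2 (fun k m => KK n.+4 (frm4 a l n n.+1) k m *
    nuN M n.+4 (fun t => X S p q M k m t * PV f (Xfn M t))) = 2 * yc * zz n a (Yv M) l.
  rewrite -(Qsum_4 n a (Yv M) (Yv_sym M) l yc an' ln).
  apply: Qsum_ext => k m kn mn.
  have [h1 h2 h3 h4] : [/\ (a < n.+4)%N, (l < n.+4)%N, (n < n.+4)%N & (n.+1 < n.+4)%N].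
    by split; do ?[exact: leqnn | apply: leqW].
  have k1 := KK_4 S beta h D p q n.+4 a l n n.+1 k m h1 h2 h3 h4 kn mn al an1 an2 ln1 ln2 nn.
  by rewrite k1.
by rewrite e2 e4.
Qed.

End CavityEquations.

Section LinearSystem.
Context {F : numFieldType}.
Variables (bt G Ff E D : F).
Let m1 := 1 - bt ^+ 2 * (Ff - 3 * G).
Let m2 := 1 - bt ^+ 2 / 2 * D.
Let m3 := 1 - bt ^+ 2 * (Ff - G).
Let mc := m1 * m2 + bt ^+ 4 * E ^+ 2.

(** An exact identity: the right side combines the residuals of the three cavity equations with
    coefficients from a row of the inverse matrix, so the left side inherits their order O([dl]). *)
Lemma solve_T (x y z sT sS : F) : m3 != 0 -> mc != 0 ->
  x - ((G * m2 + bt ^+ 2 / 2 * E ^+ 2) / (mc * m3) * sT + E / mc * sS) =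
  m2 / mc * (x - (G * sT + E * sS + bt ^+ 2 / 2 * ((2 * Ff - 6 * G) * x + E * y + 2 * G * z)))
  + bt ^+ 2 / 2 * E / mc * (y - (E * sT + D * sS + bt ^+ 2 / 2 * (D * y - 4 * E * x + 2 * E * z)))
  + bt ^+ 2 * (G * m2 + bt ^+ 2 / 2 * E ^+ 2) / (mc * m3) *
    (z - ((Ff - G) * sT + bt ^+ 2 / 2 * (2 * (Ff - G) * z))).
Proof.
move=> h3 hc; have n2 : (2 : F) != 0 by rewrite pnatr_eq0.
apply: (mulfI (mulf_neq0 hc h3)).
(* Denominators are cleared while [mc] and [m3] are still folded; they are expanded only for the
   final polynomial identity. *)
rewrite (_ : mc * m3 * (x - _) = mc * m3 * x - ((G * m2 + bt ^+ 2 / 2 * E ^+ 2) * sT + m3 * E * sS)); last by field; rewrite ?hc ?h3.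
rewrite [RHS](_ : _ = m3 * m2 * (x - (G * sT + E * sS + bt ^+ 2 / 2 * ((2 * Ff - 6 * G) * x + E * y + 2 * G * z)))
  + m3 * (bt ^+ 2 / 2 * E) * (y - (E * sT + D * sS + bt ^+ 2 / 2 * (D * y - 4 * E * x + 2 * E * z)))
  + bt ^+ 2 * (G * m2 + bt ^+ 2 / 2 * E ^+ 2) *
    (z - ((Ff - G) * sT + bt ^+ 2 / 2 * (2 * (Ff - G) * z)))); last by field; rewrite ?hc ?h3.
by rewrite /mc /m3 /m2 /m1; clear h3 hc; field.
Qed.

Lemma solve_S (x y z sT sS : F) : m3 != 0 -> mc != 0 ->
  y - (E / mc * sT + (D * m1 - 2 * bt ^+ 2 * E ^+ 2) / mc * sS) =
  m1 / mc * (y - (E * sT + D * sS + bt ^+ 2 / 2 * (D * y - 4 * E * x + 2 * E * z)))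
  - 2 * bt ^+ 2 * E / mc * (x - (G * sT + E * sS + bt ^+ 2 / 2 * ((2 * Ff - 6 * G) * x + E * y + 2 * G * z)))
  + bt ^+ 2 * (E * m1 - 2 * bt ^+ 2 * E * G) / (mc * m3) *
    (z - ((Ff - G) * sT + bt ^+ 2 / 2 * (2 * (Ff - G) * z))).
Proof.
move=> h3 hc; have n2 : (2 : F) != 0 by rewrite pnatr_eq0.
apply: (mulfI (mulf_neq0 hc h3)).
rewrite (_ : mc * m3 * (y - _) = mc * m3 * y - m3 * (E * sT + (D * m1 - 2 * bt ^+ 2 * E ^+ 2) * sS)); last by field; rewrite ?hc ?h3.
rewrite [RHS](_ : _ = m3 * m1 * (y - (E * sT + D * sS + bt ^+ 2 / 2 * (D * y - 4 * E * x + 2 * E * z)))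
  - m3 * (2 * bt ^+ 2 * E) * (x - (G * sT + E * sS + bt ^+ 2 / 2 * ((2 * Ff - 6 * G) * x + E * y + 2 * G * z)))
  + bt ^+ 2 * (E * m1 - 2 * bt ^+ 2 * E * G) *
    (z - ((Ff - G) * sT + bt ^+ 2 / 2 * (2 * (Ff - G) * z)))); last by field; rewrite ?hc ?h3.
by rewrite /mc /m3 /m2 /m1; clear h3 hc; field.
Qed.

End LinearSystem.

Section ConstantBounds.
Context {R : realType}.
Variables (S : nat) (beta h D p q : R).
Local Notation mj j e := (mj S beta h D p q j e).
Local Notation Gg := (Gc S beta h D p q).
Local Notation Ff := (Fc S beta h D p q).
Local Notation Ee := (Ecal S beta h D p q).
Local Notation Dd := (Dcal S beta h D p q).
Local Notation s := (S%:R : R).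

Lemma abs_mj j e : `|mj j e| <= s ^+ j.
Proof.
rewrite mj_w1 (le_trans (ler_norm_sum _ _ _)) //.
have -> : s ^+ j = \sum_x w1 S beta h D p q e x * s ^+ j by rewrite -mulr_suml sum_w1 mul1r.
rewrite ler_sum // => x _.
rewrite normrM ger0_norm ?gibbs_ge0 // ler_wpM2l ?gibbs_ge0 // normrX.
apply: lerXn2r; rewrite ?nnegrE ?ler0n ?normr_ge0 //; exact: abs_sv.
Qed.

Lemma gauss1_bounded (f : R -> R) (B : R) : tame 1 (fun u => f u`_0) ->
  (forall e, `|f e| <= B) -> `|gauss1 f| <= B.
Proof.
move=> tf fB; have B0 : 0 <= B by exact: le_trans (fB 0).
have := gauss_iter_bound 1 0 B _ tf.
rewrite /mpk (_ : pk 0 = fun _ => 1); last by apply/funext => x; rewrite /pk expr0.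
rewrite gauss1_cst expr1n mulr1; apply => u _.
by apply: (le_trans (fB _)); rewrite ler_peMr // pks_ge1.
Qed.

Lemma constants_bounded : [/\ `|Gg| <= 2 * s ^+ 4, `|Ff| <= 2 * s ^+ 4,
  `|Ee| <= 2 * s ^+ 4 & `|Dd| <= 2 * s ^+ 4].
Proof.
have t1 := tame_mj S beta h D p q 1; have t2 := tame_mj S beta h D p q 2.
have t3 := tame_mj S beta h D p q 3; have t4 := tame_mj S beta h D p q 4.
have s0 : 0 <= s by [].
have bM (x y : R) i j : `|x| <= s ^+ i -> `|y| <= s ^+ j -> `|x * y| <= s ^+ (i + j).
  by move=> hx hy; rewrite normrM exprD ler_pM.
have bB (x y : R) i : `|x| <= s ^+ i -> `|y| <= s ^+ i -> `|x - y| <= 2 * s ^+ i.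
  by move=> hx hy; rewrite (le_trans (ler_normB _ _)) // mulrDl mul1r lerD.
split; apply: gauss1_bounded.
- by apply: tame_mul; [apply: tame_mul|apply: tame_sub => //; apply: tame_mul].
- move=> e; rewrite mulrBr; apply: bB.
    by apply: (bM _ _ 2 2); rewrite ?abs_mj // expr2 (bM _ _ 1 1) ?abs_mj.
  by rewrite expr2; apply: (bM _ _ 2 2); apply: (bM _ _ 1 1); rewrite ?abs_mj.
- by apply: tame_sub; [apply: tame_mul|apply: tame_mul => //; apply: tame_mul].
- move=> e; rewrite !expr2; apply: bB.
    by apply: (bM _ _ 2 2); rewrite ?abs_mj.
  by apply: (bM _ _ 2 2); rewrite ?abs_mj //; apply: (bM _ _ 1 1); rewrite ?abs_mj.
- by apply: tame_mul => //; apply: tame_sub => //; apply: tame_mul.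
- move=> e; rewrite mulrBr; apply: bB.
    by apply: (bM _ _ 1 3); rewrite ?abs_mj.
  by apply: (bM _ _ 1 3); rewrite ?abs_mj //; apply: (bM _ _ 1 2); rewrite ?abs_mj.
- by apply: tame_sub => //; apply: tame_mul.
- move=> e; apply: bB; first exact: abs_mj.
  by rewrite expr2; apply: (bM _ _ 2 2); rewrite ?abs_mj.
Qed.

Hypothesis beta0 : 0 < beta.
Hypothesis betaS : beta * s ^+ 2 <= 200%:R^-1.

Lemma beta_small (x : R) : `|x| <= 2 * s ^+ 4 -> `|beta ^+ 2 * x| <= 16%:R^-1.
Proof.
move=> hx; have := betaS2 S beta beta0 betaS.
rewrite -exprD => hb; have b0 : 0 <= beta ^+ 2 by rewrite sqr_ge0.
rewrite normrM ger0_norm //; apply: (le_trans (ler_wpM2l b0 hx)).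
rewrite mulrCA; apply: (le_trans (ler_wpM2l (ler0n R 2) hb)).
rewrite (_ : 200%:R^-1 ^+ 2 = 100%:R^-1 * 400%:R^-1); last by field.
lra.
Qed.

Lemma M3_gt0 : 0 < M3 S beta h D p q.
Proof.
case: constants_bounded => /beta_small hG /beta_small hF _ _; rewrite /M3 mulrBr.
move: (beta ^+ 2 * Gg) (beta ^+ 2 * Ff) hG hF => g f; rewrite !ler_norml => /andP[a1 a2] /andP[a3 a4].
by lra.
Qed.

(** M_1 and M_2 are close to 1, and the remaining term beta^4 E^2 is a nonnegative addition. *)
Lemma Mc_gt0 : 0 < Mc S beta h D p q.
Proof.
have m1 : 0 < M1 S beta h D p q.
  case: constants_bounded => /beta_small hG /beta_small hF _ _.
  rewrite /M1 mulrBr [_ * (3 * _)]mulrCA.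
  move: (beta ^+ 2 * Gg) (beta ^+ 2 * Ff) hG hF => g f; rewrite !ler_norml => /andP[a1 a2] /andP[a3 a4].
  by lra.
have m2 : 0 < M2 S beta h D p q.
  case: constants_bounded => _ _ _ /beta_small hD.
  rewrite /M2 mulrAC.
  move: (beta ^+ 2 * Dd) hD => d; rewrite !ler_norml => /andP[a1 a2].
  by lra.
rewrite /Mc ltr_pwDl ?mulr_gt0 // mulr_ge0 ?sqr_ge0 //.
by rewrite exprn_ge0 // ltW.
Qed.

End ConstantBounds.

Section KindRecursion.
Context {R : realType}.
Variables (S : nat) (beta h D p q : R).
Hypothesis fp : fixed_point S beta h D p q.
Hypothesis beta0 : 0 < beta.
Hypothesis betaS : beta * S%:R ^+ 2 <= 200%:R^-1.
Local Notation mm := (mm S beta h D p q).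
Local Notation Gg := (Gc S beta h D p q).
Local Notation Ff := (Fc S beta h D p q).
Local Notation Ee := (Ecal S beta h D p q).
Local Notation Dd := (Dcal S beta h D p q).
Local Notation gcov := (gcov S beta h D p q).
Local Notation m1 := (M1 S beta h D p q).
Local Notation m2 := (M2 S beta h D p q).
Local Notation m3 := (M3 S beta h D p q).
Local Notation mc := (Mc S beta h D p q).
Local Notation yc := (yc S beta h D p q).

(** N times the entries of Sigma_1, that is, the covariance in the sqrt N scaling. *)
Definition acov (c c' : bool) : R :=
  if c then (if c' then (Gg * m2 + beta ^+ 2 / 2 * Ee ^+ 2) / (mc * m3) else Ee / mc)
  else (if c' then Ee / mc else (Dd * m1 - 2 * beta ^+ 2 * Ee ^+ 2) / mc).

Let kd0 : kind := (None, true).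

(** The Wick sum: one term for each occurrence of the factor that is paired off and deleted. *)
Definition removal (a : nat) (c : bool) (b : nat) (kds : seq kind) M : R :=
  \sum_(v < size kds) (if nth kd0 kds v == (Some a, c) then 1 else 0) * mm M b (del v kds).

Lemma gcov_removal a c b kds M :
  \sum_(v < size kds) (if (nth kd0 kds v).1 == Some a then gcov c (nth kd0 kds v).2 else 0) * mm M b (del v kds)
  = gcov c true * removal a true b kds M + gcov c false * removal a false b kds M.
Proof.
rewrite /removal !mulr_sumr -big_split; apply: eq_bigr => v _ /=; rewrite !mulrA -mulrDl; congr (_ * _).
case: (nth kd0 kds v) => k c' /=; rewrite !xpair_eqE.
by case: (k == Some a); case: c'; rewrite /= ?mulr0 ?mulr1 ?addr0 ?add0r.
Qed.

Lemma sum_sub_add (I : finType) (P : pred I) (z u v : I -> R) :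
  \sum_(i | P i) (z i - (u i + v i)) = \sum_(i | P i) z i - (\sum_(i | P i) u i + \sum_(i | P i) v i).
Proof. by rewrite sumrB big_split. Qed.

Section Step.
Variables (b a : nat) (kds : seq kind).
Hypothesis ab : (a < b)%N.
Hypothesis kb : all (kind_ok b) kds.
Local Notation n := (slot b (size kds).+1).
Local Notation tx := (txv S beta h D p q b a kds).
Local Notation sx := (sxv S beta h D p q b a kds).
Local Notation zs := (zsum S beta h D p q b a kds).
Local Notation zv M l := (zz n a (Yv S beta h D p q b kds M) l).

(** Each occurrence of T_a owns one slot, whose first replica is one of the indices [l] in the sum,
    so adding the equations for [zz] counts it exactly once. *)
Lemma equation_zsum : Od (fun M => zs M - ((Ff - Gg) * removal a true b kds M
   + beta ^+ 2 / 2 * (2 * (Ff - Gg) * zs M))).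
Proof.
have H := Od_sum _ (index_enum 'I_n) (fun l : 'I_n => (l : nat) != a) _
   (fun l la => equation_4 S beta h D p q fp beta0 betaS b a kds ab kb l (ltn_ord l) la).
apply: Od_ext H => M.
rewrite sum_sub_add; congr (_ - (_ + _)); last by rewrite -!mulr_sumr.
rewrite exchange_big /= /removal mulr_sumr; apply: eq_bigr => v _.
rewrite -mulr_suml mulrA; congr (_ * _).
case: (_ == _) => /=; last by rewrite big1 ?mulr0 // => l _.
have sn : (slot b v.+1 < n)%N by have := ltn_ord v; rewrite /slot; lia.
have sa : slot b v.+1 != a by rewrite neq_ltn; move: ab; rewrite /slot; lia.
rewrite (bigD1 (Ordinal sn)) //= eqxx big1 ?addr0 ?mulr1 // => l /andP[_ ls].
by rewrite (_ : (l == slot b v.+1 :> nat) = false) //; apply: negbTE.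
Qed.

Lemma mm_cons c M : mm M b ((Some a, c) :: kds) = if c then tx M else sx M.
Proof.
have ok : slots_ok b n (((Some a, c), 0%N) :: slotted kds).
  have := slotted_ok b n kds kb (leqnn _); rewrite /slots_ok /= => /and3P[h1 h2 h3].
  rewrite h1 h2 h3 unzip2_slotted mem_iota /= {1}/kind_ok /= ab /slot; lia.
have bn : (b <= n)%N by rewrite /slot; lia.
have := nuN_frms S beta h D p q M b n _ ok bn; rewrite /= unzip1_slotted => <-.
have sl0 : slot b 0 = b by rewrite /slot muln0 addn0.
have e1 : (fun t : nat -> config S M.+1 => PV (frms b (((Some a, c), 0%N) :: slotted kds)) (Xf S p q M t)) =
   (fun t => ev (frm (Some a, c) b) (Xf S p q M t) * PV (frms b (slotted kds)) (Xf S p q M t)).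
  by apply/funext => t; rewrite /frms /= PV_cons sl0.
rewrite e1; case: c {ok e1}; first exact: (nuN_T S beta h D p q fp beta0 betaS b a kds ab kb M).
exact: (nuN_S S beta h D p q fp beta0 betaS b a kds ab kb M).
Qed.

(** Gaussian integration by parts with covariance [acov], up to O([dl]): the cavity equations
    combined with the weights of [solve_T] and [solve_S]. *)
Theorem kind_recursion c : Od (fun M => mm M b ((Some a, c) :: kds) -
  (acov c true * removal a true b kds M + acov c false * removal a false b kds M)).
Proof.
have oT := equation_T S beta h D p q fp beta0 betaS b a kds ab kb.
have oS := equation_S S beta h D p q fp beta0 betaS b a kds ab kb.
have o4 := equation_zsum.
have h3 : m3 != 0 by rewrite gt_eqF // M3_gt0.
have hc : mc != 0 by rewrite gt_eqF // Mc_gt0.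
case: c; rewrite /acov.
- apply: Od_ext (Od_add _ _ (Od_add _ _ (Od_scale (m2 / mc) _ oT)
    (Od_scale (beta ^+ 2 / 2 * Ee / mc) _ oS))
    (Od_scale (beta ^+ 2 * (Gg * m2 + beta ^+ 2 / 2 * Ee ^+ 2) / (mc * m3)) _ o4)) => M.
  rewrite mm_cons !gcov_removal.
  by rewrite -(solve_T beta Gg Ff Ee Dd _ _ (zs M) _ _ h3 hc).
- apply: Od_ext (Od_add _ _ (Od_sub _ _ (Od_scale (m1 / mc) _ oS)
    (Od_scale (2 * beta ^+ 2 * Ee / mc) _ oT))
    (Od_scale (beta ^+ 2 * (Ee * m1 - 2 * beta ^+ 2 * Ee * Gg) / (mc * m3)) _ o4)) => M.
  rewrite mm_cons !gcov_removal.
  by rewrite -(solve_S beta Gg Ff Ee Dd _ _ (zs M) _ _ h3 hc).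
Qed.

End Step.

End KindRecursion.

(** * Gaussian moments *)

Section GaussianInduction.
Context {R : realType}.
Variables (S : nat) (beta h D p q : R).
Hypothesis fp : fixed_point S beta h D p q.
Hypothesis beta0 : 0 < beta.
Hypothesis betaS : beta * S%:R ^+ 2 <= 200%:R^-1.
Local Notation mm := (mm S beta h D p q).
Local Notation acov := (acov S beta h D p q).
Local Notation removal := (removal S beta h D p q).

Lemma mm_perm M b k1 k2 : perm_eq k1 k2 -> mm M b k1 = mm M b k2.
Proof.
move=> k12; apply: gauss_iter_ext => s _; congr (av _ _ _ _); apply/funext => t.
exact: perm_big.
Qed.

Lemma nth_del_perm {T : eqType} (x0 : T) v (s : seq T) : (v < size s)%N ->
  perm_eq s (nth x0 s v :: del v s).
Proof.
move=> vs; rewrite -{1}(cat_take_drop v s) (drop_nth x0 vs) /del.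
by rewrite -cat1s perm_catCA.
Qed.

Lemma sum_nth_count {T : eqType} (x0 x : T) (s : seq T) (c : R) :
  \sum_(v < size s) (if nth x0 s v == x then c else 0) = (count_mem x s)%:R * c.
Proof.
elim: s => [|y s IH]; first by rewrite big_ord0 mul0r.
rewrite big_ord_recl /= natrD mulrDl IH; congr (_ + _).
by case: (y == x); rewrite ?mul1r ?mul0r.
Qed.

(** The Gaussian moments enter only through the Wick recursion. At u = 0 or v = 0 the truncated
    predecessor is harmless, its coefficient being 0. *)
Variable gm : nat -> nat -> R.
Hypothesis gm00 : gm 0 0 = 1.
Hypothesis gmT : forall u v, gm u.+1 v =
  acov true true * (u%:R * gm u.-1 v) + acov true false * (v%:R * gm u v.-1).
Hypothesis gmS : forall u v, gm u v.+1 =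
  acov false true * (u%:R * gm u.-1 v) + acov false false * (v%:R * gm u v.-1).
Variable b : nat.

Let nT a (kds : seq kind) := count_mem (Some a, true) kds.
Let nS a (kds : seq kind) := count_mem (Some a, false) kds.

Definition gweight (kds : seq kind) : R := \prod_(i < b) gm (nT i kds) (nS i kds).

Definition overlaps (kds : seq kind) := [seq kd <- kds | kd.1 == None].

Lemma gweight_perm k1 k2 : perm_eq k1 k2 -> gweight k1 = gweight k2.
Proof. by move=> /seq.permP k12; apply: eq_bigr => i _; rewrite /nT /nS !k12. Qed.

Let others a kds : R := \prod_(i < b | (i : nat) != a) gm (nT i kds) (nS i kds).

Lemma gweight_split a kds : (a < b)%N ->
  gweight kds = gm (nT a kds) (nS a kds) * others a kds.
Proof. by move=> ab; rewrite /gweight (bigD1 (Ordinal ab)). Qed.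

Lemma others_cons a c kds : others a ((Some a, c) :: kds) = others a kds.
Proof.
apply: eq_bigr => i ia; rewrite /nT /nS /= !xpair_eqE.
by rewrite (_ : (Some a == Some (i : nat)) = false) // eq_sym; apply: negbTE.
Qed.

(** Deleting any one of the equal factors leaves the same weight and the same overlaps, so the sum
    is the multiplicity times a single term. *)
Lemma removal_gauss a c kds : (a < b)%N ->
  (forall v, (v < size kds)%N -> Od (fun M => mm M b (del v kds) -
     gweight (del v kds) * mm M b (overlaps (del v kds)))) ->
  Od (fun M => removal a c b kds M -
    (if c then (nT a kds)%:R * gm (nT a kds).-1 (nS a kds) else (nS a kds)%:R * gm (nT a kds) (nS a kds).-1)
    * others a kds * mm M b (overlaps kds)).
Proof.
move=> ab IH.
have key v : (v < size kds)%N -> nth (None, true) kds v = (Some a, c) ->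
    gweight (del v kds) = (if c then gm (nT a kds).-1 (nS a kds) else gm (nT a kds) (nS a kds).-1) * others a kds
    /\ forall M, mm M b (overlaps (del v kds)) = mm M b (overlaps kds).
  move=> vs nv; have pk := nth_del_perm (None, true) v kds vs; rewrite nv in pk.
  split; last by move=> M; apply: mm_perm; rewrite perm_sym /overlaps (perm_trans (perm_filter _ pk)).
  have eT : nT a kds = (c + nT a (del v kds))%N.
    by rewrite /nT (seq.permP pk) /= xpair_eqE eqxx; case: (c).
  have eS : nS a kds = (~~ c + nS a (del v kds))%N.
    by rewrite /nS (seq.permP pk) /= xpair_eqE eqxx; case: (c).
  have eo : others a kds = others a (del v kds).
    rewrite -(others_cons a c (del v kds)); apply: eq_bigr => i _.
    by rewrite /nT /nS !(seq.permP pk).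
  by rewrite (gweight_split a) // eo eT eS; case: (c).
set X : R := (if c then gm (nT a kds).-1 (nS a kds) else gm (nT a kds) (nS a kds).-1) * others a kds in key.
have H := Od_sum _ (index_enum 'I_(size kds)) (fun v : 'I_(size kds) => nth (None, true) kds v == (Some a, c)) _
   (fun v _ => IH v (ltn_ord v)).
apply: Od_ext H => M.
have -> : (if c then (nT a kds)%:R * gm (nT a kds).-1 (nS a kds) else (nS a kds)%:R * gm (nT a kds) (nS a kds).-1)
    * others a kds * mm M b (overlaps kds) =
    (count_mem (Some a, c) kds)%:R * (X * mm M b (overlaps kds)).
  by rewrite /X /nT /nS; case: (c); rewrite -!mulrA.
rewrite -(sum_nth_count (None, true)) /removal -sumrB [LHS]big_mkcond /=; apply: eq_bigr => v _.
case: eqP => [nv|_]; last by rewrite mul0r subr0.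
by have [-> ->] := key v (ltn_ord v) nv; rewrite mul1r.
Qed.

(** Induction on the number of factors. One that carries a replica is moved to the front and removed
    by [kind_recursion]; a product of T and S alone is left as it is. *)
Theorem gaussian_limit kds : all (kind_ok b) kds ->
  Od (fun M => mm M b kds - gweight kds * mm M b (overlaps kds)).
Proof.
move: {2}(size kds) (leqnn (size kds)) => m; elim: m kds => [|m IH] kds sm ok.
  move: sm; rewrite leqn0 size_eq0 => /eqP ->.
  have e : gweight [::] = 1 by rewrite /gweight big1 // => i _; exact: gm00.
  by apply: Od_ext Od0 => M; rewrite e mul1r subrr.
have [hasS|noS] := boolP (has (fun kd : kind => kd.1 != None) kds); last first.
  have e1 : overlaps kds = kds.
    apply/all_filterP/allP => kd kk; apply: contraNT noS => h'.
    by apply/hasP; exists kd.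
  have e2 : gweight kds = 1.
    rewrite /gweight big1 // => i _; rewrite /nT /nS.
    have z c : count_mem (Some (i : nat), c) kds = 0%N.
      apply/count_memPn; apply: contraNN noS => kk; apply/hasP; by exists (Some (i : nat), c).
    by rewrite !z gm00.
  by apply: Od_ext Od0 => M; rewrite e1 e2 mul1r subrr.
have [[[a|] c] kk //= _] := hasP hasS.
have pk := perm_to_rem kk; set rest := rem _ kds in pk.
have okr : all (kind_ok b) ((Some a, c) :: rest) by rewrite -(perm_all _ pk).
have [ab okrest] := andP okr.
have sr : (size rest <= m)%N by move: sm; rewrite (perm_size pk).
have IHd v : (v < size rest)%N -> Od (fun M => mm M b (del v rest) -
     gweight (del v rest) * mm M b (overlaps (del v rest))).
  move=> vs; apply: IH.
    by apply: leq_trans sr; exact: (size_subseq (del_subseq v rest)).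
  by apply/allP => kd kdr; apply: (allP okrest); exact: (mem_subseq (del_subseq v rest)).
have oT := removal_gauss a true rest ab IHd; have oS := removal_gauss a false rest ab IHd.
have oR := kind_recursion S beta h D p q fp beta0 betaS b a rest ab okrest c.
apply: Od_ext (Od_add _ _ oR (Od_add _ _ (Od_scale (acov c true) _ oT) (Od_scale (acov c false) _ oS))) => M.
have e1 : mm M b kds = mm M b ((Some a, c) :: rest) by apply: mm_perm.
have e2 : mm M b (overlaps kds) = mm M b (overlaps rest).
  by apply: mm_perm; rewrite /overlaps (perm_trans (perm_filter _ pk)).
have e3 : gweight kds = (acov c true * ((nT a rest)%:R * gm (nT a rest).-1 (nS a rest)) +
    acov c false * ((nS a rest)%:R * gm (nT a rest) (nS a rest).-1)) * others a rest.
  rewrite (gweight_perm _ _ pk) (gweight_split a) // others_cons; congr (_ * _).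
  rewrite /nT /nS /= !xpair_eqE eqxx /=; case: (c); rewrite /= ?add0n ?add1n.
    by rewrite gmT.
  by rewrite gmS.
rewrite e1 e2 e3.
move: (mm M b _) (mm M b _) (removal _ _ _ _ _) (removal _ _ _ _ _) (others _ _) => x y r1 r2 o.
ring.
Qed.

End GaussianInduction.

(** * Wick recursion for the moments of a bivariate Gaussian *)

Section BivariateGaussian.
Context {R : realType}.

Section Moments.
Variables (L11 L12 L21 L22 : R).
Local Notation gm := (gmom L11 L12 L21 L22).

Let gA (s : seq R) : R := L11 * s`_0 + L12 * s`_1.
Let gB (s : seq R) : R := L21 * s`_0 + L22 * s`_1.
Let gP u v (s : seq R) : R := gA s ^+ u * gB s ^+ v.

Lemma tame_exp m F k : tame m F -> tame m (fun s : seq R => F s ^+ k).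
Proof.
move=> tF; elim: k => [|k IH].
  by apply: tame_ext (tame_cst m 1) => s; rewrite expr0.
by apply: tame_ext (tame_mul _ _ _ tF IH) => s; rewrite exprS.
Qed.

Lemma gmomE u v : gm u v = gauss_iter 2 (gP u v).
Proof. by []. Qed.

Lemma tame_gP u v : tame 2 (gP u v).
Proof.
by apply: tame_mul; apply: tame_exp; apply: tame_add; apply: tame_scale; exact: tame_nth.
Qed.

Lemma gmom00 : gm 0 0 = 1.
Proof.
rewrite gmomE -[RHS](gauss_iter_cst 2); apply: gauss_iter_ext => s _.
by rewrite /gP !expr0 mulr1.
Qed.

Lemma gmom_ibp i (c1 c2 : R) u v : (i < 2)%N ->
  c1 = (if i == 0%N then L11 else L12) -> c2 = (if i == 0%N then L21 else L22) ->
  gauss_iter 2 (fun s => s`_i * gP u v s) = c1 * (u%:R * gm u.-1 v) + c2 * (v%:R * gm u v.-1).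
Proof.
move=> i2 h1 h2.
have t1 := tame_scale _ (c1 * u%:R) _ (tame_gP u.-1 v).
have t2 := tame_scale _ (c2 * v%:R) _ (tame_gP u v.-1).
rewrite !mulrA !gmomE -(gauss_iterZ _ _ _ (tame_gP u.-1 v)) -(gauss_iterZ _ _ _ (tame_gP u v.-1)).
rewrite -(gauss_iterD _ _ _ t1 t2).
apply: gauss_iter_ibp => //; first exact: tame_gP.
  exact: tame_add.
have lin (x y z d : R) : is_derive y 1 (fun y0 : R => d * y0 + z) d.
  by apply: der_eq (derD (derZ d (der_id y)) (der_cst y z)) _; rewrite mulr1 addr0.
move=> [|x [|y []]] // _.
case: i i2 h1 h2 => [|[|//]] _ /= -> ->; rewrite /gP /gA /gB /=.
- apply: der_eq (derM (derX u (lin x x (L12 * y) L11)) (derX v (lin x x (L22 * y) L21))) _.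
  ring.
- have lin' (w d c : R) : is_derive w 1 (fun y0 : R => c + d * y0) d.
    by apply: der_eq (derD (der_cst w c) (derZ d (der_id w))) _; rewrite mulr1 add0r.
  apply: der_eq (derM (derX u (lin' y L12 (L11 * x))) (derX v (lin' y L22 (L21 * x)))) _.
  ring.
Qed.

Lemma gmom_split (d1 d2 : R) u v :
  gauss_iter 2 (fun s => (d1 * s`_0 + d2 * s`_1) * gP u v s) =
  (d1 * L11 + d2 * L12) * (u%:R * gm u.-1 v) + (d1 * L21 + d2 * L22) * (v%:R * gm u v.-1).
Proof.
have e0 := gmom_ibp 0 L11 L21 u v isT erefl erefl.
have e1 := gmom_ibp 1 L12 L22 u v isT erefl erefl.
have t0 : tame 2 (fun s => s`_0 * gP u v s) by apply: tame_mul; [exact: tame_nth|exact: tame_gP].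
have t1 : tame 2 (fun s => s`_1 * gP u v s) by apply: tame_mul; [exact: tame_nth|exact: tame_gP].
transitivity (d1 * gauss_iter 2 (fun s => s`_0 * gP u v s) + d2 * gauss_iter 2 (fun s => s`_1 * gP u v s)).
  rewrite -!gauss_iterZ // -gauss_iterD; try exact: tame_scale.
  by apply: gauss_iter_ext => s _; rewrite mulrDl -!mulrA.
rewrite e0 e1; move: (gm _ _) (gm _ _) => x y; ring.
Qed.

Variables (a bb c : R).
Hypothesis cov : is_cov_factor L11 L12 L21 L22 a bb c.

Lemma gmomSl u v : gm u.+1 v = a * (u%:R * gm u.-1 v) + c * (v%:R * gm u v.-1).
Proof.
case: cov => <- [<- _]; rewrite gmomE.
transitivity (gauss_iter 2 (fun s => (L11 * s`_0 + L12 * s`_1) * gP u v s)).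
  by apply: gauss_iter_ext => s _; rewrite /gP exprS mulrA.
by rewrite gmom_split !expr2.
Qed.

Lemma gmomSr u v : gm u v.+1 = c * (u%:R * gm u.-1 v) + bb * (v%:R * gm u v.-1).
Proof.
case: cov => _ [<- <-]; rewrite gmomE.
transitivity (gauss_iter 2 (fun s => (L21 * s`_0 + L22 * s`_1) * gP u v s)).
  by apply: gauss_iter_ext => s _; rewrite /gP exprS mulrCA.
by rewrite gmom_split !expr2 (mulrC L21 L11) (mulrC L22 L12).
Qed.

Lemma gmom_scale r u v :
  gmom (r * L11) (r * L12) (r * L21) (r * L22) u v = r ^+ (u + v) * gm u v.
Proof.
rewrite gmomE -gauss_iterZ; last exact: tame_gP.
apply: (gauss_iter_ext 2 (fun s => (r * L11 * s`_0 + r * L12 * s`_1) ^+ u *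
   (r * L21 * s`_0 + r * L22 * s`_1) ^+ v)) => s _.
by rewrite /gP /gA /gB -!mulrA -!mulrDr !exprMn exprD mulrACA.
Qed.

End Moments.

(** Moments depend on the covariance alone. Thus a factor fixed once and for all can replace the one
    in the statement, which varies with N. *)
Lemma wick_unique (a bb c : R) (g1 g2 : nat -> nat -> R) : g1 0%N 0%N = g2 0%N 0%N ->
  (forall u v, g1 u.+1 v = a * (u%:R * g1 u.-1 v) + c * (v%:R * g1 u v.-1)) ->
  (forall u v, g1 u v.+1 = c * (u%:R * g1 u.-1 v) + bb * (v%:R * g1 u v.-1)) ->
  (forall u v, g2 u.+1 v = a * (u%:R * g2 u.-1 v) + c * (v%:R * g2 u v.-1)) ->
  (forall u v, g2 u v.+1 = c * (u%:R * g2 u.-1 v) + bb * (v%:R * g2 u v.-1)) ->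
  forall u v, g1 u v = g2 u v.
Proof.
move=> h0 a1 b1 a2 b2 u v; move: {2}(u + v)%N (leqnn (u + v)) => m.
elim: m u v => [|m IH] u v uv.
  by move: uv; rewrite leqn0 addn_eq0 => /andP[/eqP -> /eqP ->].
case: u uv => [|u] uv.
  case: v uv => [//|v] uv; rewrite b1 b2 !mul0r !mulr0 !add0r; congr (_ * _).
  by case: v uv => [|v] uv; rewrite ?mul0r // IH //; lia.
rewrite a1 a2; congr (_ * _ + _ * _).
  by case: u uv => [|u] uv; rewrite ?mul0r // IH //; lia.
by case: v uv => [|v] uv; rewrite ?mul0r // IH //; lia.
Qed.

End BivariateGaussian.

(** * The model of the theorem *)

Section FrozenModel.
Context {R : realType}.
Variables (S : nat) (beta h D p q : R).
Variable M : nat.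
Local Notation N := M.+1.
Local Notation cfg := (config S N).
Local Notation gwt := (gwt S beta h D M).
Local Notation r := (Num.sqrt N%:R : R).
Implicit Types (s : seq R) (x : cfg).

Lemma HN_lin_ham s x : HN S beta h D N (gdis N s) x =
  lin_ham (N * N) (csk S beta M) (Wsk S h D M) s x.
Proof.
rewrite /HN /lin_ham /Wsk -!addrA; congr (_ + _).
have e1 (a : nat) : s`_a = nth 0 s (a %/ N * N + a %% N) by rewrite -divn_eq.
under [RHS]eq_bigr => a _ do rewrite e1.
rewrite (sum_divmod N N (fun i j => nth 0 s (i * N + j) *
   (if (i < j)%N then beta / r * sp S M x (inord i) * sp S M x (inord j) else 0))).
rewrite mulr_sumr; apply: eq_bigr => i _; rewrite mulr_sumr big_mkcond /=; apply: eq_bigr => j _.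
by rewrite !inord_val /gdis /sp; case: ifP => _; rewrite ?mulr0 //; ring.
Qed.

Lemma gw_gwt s x : gw S beta h D N (gdis N s) x / Zpart S beta h D N (gdis N s) = gwt s x.
Proof.
rewrite /gwt /gibbs /gw HN_lin_ham; congr (_ / _).
by apply: eq_bigr => y _; rewrite /gw HN_lin_ham.
Qed.

Lemma gavg1_wavg s (f : cfg -> R) : gavg1 S beta h D N (gdis N s) f = wavg (gwt s) f.
Proof. by apply: eq_bigr => x _; rewrite gw_gwt mulrC. Qed.

(** Replicas are independent given the disorder, so expanding the product of means recovers the sum
    over all configurations. *)
Lemma gavg_prod s n (phi : 'I_n -> cfg -> R) (c : R) :
  gavg S beta h D N (gdis N s) n (fun tau => (\prod_k phi k (tau k)) * c) =
  (\prod_k wavg (gwt s) (phi k)) * c.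
Proof.
rewrite /wavg bigA_distr_bigA /= mulr_suml; apply: eq_bigr => tau _.
under [X in _ * X = _]eq_bigr => k _ do rewrite gw_gwt.
by rewrite [in RHS]big_split mulrC mulrA.
Qed.

Lemma r_dl : r * dl M = 1 :> R.
Proof. by rewrite /dl divff // gt_eqF // sqrtr_gt0. Qed.

Lemma dl_rN : dl M = r * N%:R^-1 :> R.
Proof. by rewrite -(dl2 M) expr2 mulrA r_dl mul1r. Qed.

Section Values.
Variable s : seq R.
Local Notation g := (gdis N s).
Local Notation w := (gwt s).
Let bi i := Defs.b S beta h D N g i.
Let bti i := bt S beta h D N g i.

Lemma wavg_sum (I : finType) (f : I -> cfg -> R) :
  wavg w (fun x => \sum_i f i x) = \sum_i wavg w (f i).
Proof.
by rewrite /wavg exchange_big; apply: eq_bigr => x _; rewrite mulr_sumr.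
Qed.

Lemma v1_model x : v1 w (Vc S q M) x = dl M * \sum_i (sp S M x i * bi i - q).
Proof.
rewrite /v1 /Vc wavgZ wavg_sum; congr (_ * _); apply: eq_bigr => i _.
rewrite wavgB wavgZ wavg_cst; last exact: sum_gwt.
by rewrite /bi /Defs.b gavg1_wavg.
Qed.

Lemma v0_model : v0 w (Vc S q M) = dl M * \sum_i (bi i ^+ 2 - q).
Proof.
rewrite /v0 (_ : v1 _ _ = fun x => dl M * \sum_i (sp S M x i * bi i - q)); last first.
  by apply/funext => x; exact: v1_model.
rewrite wavgZ wavg_sum; congr (_ * _); apply: eq_bigr => i _.
rewrite wavgB wavg_cst; last exact: sum_gwt.
rewrite (_ : (fun x => _) = fun x => bi i * sp S M x i); last by apply/funext => x; rewrite mulrC.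
by rewrite wavgZ expr2 {3}/bi /Defs.b gavg1_wavg.
Qed.

Lemma d0_model : d0 w (Dc S p M) = dl M * \sum_i (bti i - p).
Proof.
rewrite /d0 /Dc wavgZ wavg_sum; congr (_ * _); apply: eq_bigr => i _.
rewrite wavgB wavg_cst; last exact: sum_gwt.
by rewrite /bti /bt gavg1_wavg; congr (wavg _ _ - _); apply/funext => x; rewrite expr2.
Qed.

Definition kfun (kd : bool) x : R :=
  if kd then v1 w (Vc S q M) x - v0 w (Vc S q M) else Dc S p M x - d0 w (Dc S p M).

Lemma kfun_T n (tau : {ffun 'I_n -> cfg}) k :
  kfun true (tau k) = r * Tk S beta h D N g n tau k.
Proof.
rewrite /kfun v1_model v0_model -mulrBr -sumrB /Tk mulrA -dl_rN; congr (_ * _).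
by apply: eq_bigr => i _; rewrite -/(bi i) /sp; ring.
Qed.

Lemma kfun_S n (tau : {ffun 'I_n -> cfg}) k :
  kfun false (tau k) = r * Sk S beta h D N g n tau k.
Proof.
rewrite /kfun d0_model /Dc -mulrBr -sumrB /Sk mulrA -dl_rN; congr (_ * _).
by apply: eq_bigr => i _; rewrite -/(bti i) /sp; ring.
Qed.

Lemma v0_Tbar : v0 w (Vc S q M) = r * Tbar S beta h D N g q.
Proof.
rewrite v0_model sumrB sumr_const card_ord /Tbar dl_rN -!mulrA; congr (_ * _).
by rewrite mulrBr -[q *+ _]mulr_natl mulKf // pnatr_eq0.
Qed.

Lemma d0_Sbar : d0 w (Dc S p M) = r * Sbar S beta h D N g p.
Proof.
rewrite d0_model sumrB sumr_const card_ord /Sbar dl_rN -!mulrA; congr (_ * _).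
by rewrite mulrBr -[p *+ _]mulr_natl mulKf // pnatr_eq0.
Qed.

End Values.

Lemma prod_nseq (F : kind -> R) m kd : \prod_(x <- nseq m kd) F x = F kd ^+ m.
Proof. by elim: m => [|m IH]; rewrite ?big_nil //= big_cons IH exprS. Qed.

Section Kinds.
Variables (n : nat) (hT hS : 'I_n -> nat) (e1 e2 : nat).

Definition overlap_kinds : seq kind := nseq e1 (None, true) ++ nseq e2 (None, false).

Definition statement_kinds : seq kind :=
  flatten [seq nseq (hT k) (Some (k : nat), true) ++ nseq (hS k) (Some (k : nat), false) | k <- enum 'I_n]
  ++ overlap_kinds.

Lemma statement_kinds_ok : all (kind_ok n) statement_kinds.
Proof.
rewrite /statement_kinds /overlap_kinds !all_cat !all_nseq !orbT !andbT.
by apply/allP => kd /flatten_mapP[k _]; rewrite mem_cat => /orP[] /nseqP[-> _]; exact: ltn_ord.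
Qed.

Lemma overlaps_statement : overlaps statement_kinds = overlap_kinds.
Proof.
rewrite /overlaps filter_cat [X in X ++ _](_ : _ = [::]).
  by apply/all_filterP; rewrite all_cat !all_nseq !orbT.
apply/eqP/negPn; rewrite -has_filter; apply/hasPn => kd /flatten_mapP[k _].
by rewrite mem_cat => /orP[] /nseqP[-> _].
Qed.

Lemma count_statement (a : 'I_n) c :
  count_mem (Some (a : nat), c) statement_kinds = if c then hT a else hS a.
Proof.
rewrite /statement_kinds /overlap_kinds !count_cat !count_nseq /= !addn0 count_flatten -map_comp.
rewrite sumnE big_map big_enum /= (bigD1 a) //= big1 ?addn0 => [|k ka]; rewrite count_cat !count_nseq /= !xpair_eqE.
  by rewrite eqxx; case: c; rewrite ?mul1n ?mul0n ?addn0.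
by rewrite (_ : (Some (k : nat) == Some (a : nat)) = false) //; apply: negbTE.
Qed.

Lemma kvals_statement s (t : nat -> cfg) :
  kvals (gwt s) (Vc S q M) (Dc S p M) statement_kinds t =
  (\prod_(k < n) (kfun s true (t k) ^+ hT k * kfun s false (t k) ^+ hS k))
  * (v0 (gwt s) (Vc S q M) ^+ e1 * d0 (gwt s) (Dc S p M) ^+ e2).
Proof.
rewrite /kvals /statement_kinds /overlap_kinds !big_cat /= !prod_nseq; congr (_ * _).
rewrite big_flatten /= big_map big_enum /=; apply: eq_bigr => k _.
by rewrite big_cat /= !prod_nseq.
Qed.

Lemma kvals_overlap s (t : nat -> cfg) :
  kvals (gwt s) (Vc S q M) (Dc S p M) overlap_kinds t =
  v0 (gwt s) (Vc S q M) ^+ e1 * d0 (gwt s) (Dc S p M) ^+ e2.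
Proof. by rewrite /kvals /overlap_kinds big_cat /= !prod_nseq. Qed.

Lemma av_kvals_statement s : av (gwt s) n (kvals (gwt s) (Vc S q M) (Dc S p M) statement_kinds) (cfg0 S M) =
  (\prod_(k < n) wavg (gwt s) (fun x => kfun s true x ^+ hT k * kfun s false x ^+ hS k))
  * (v0 (gwt s) (Vc S q M) ^+ e1 * d0 (gwt s) (Dc S p M) ^+ e2).
Proof.
pose f i x := if insub i is Some k then kfun s true x ^+ hT k * kfun s false x ^+ hS k else 1 : R.
have fE (k : 'I_n) x : f k x = kfun s true x ^+ hT k * kfun s false x ^+ hS k by rewrite /f valK.
have := av_prod_uniq (gwt s) (cfg0 S M) (sum_gwt _ _ _ _ _ _) n (index_iota 0 n) f (iota_uniq _ _).
rewrite big_mkord => e3.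
transitivity (av (gwt s) n (fun t => \prod_(i <- index_iota 0 n) f i (t i)) (cfg0 S M)
  * (v0 (gwt s) (Vc S q M) ^+ e1 * d0 (gwt s) (Dc S p M) ^+ e2)).
  rewrite -avZr; congr (av _ _ _ _); apply/funext => t; rewrite kvals_statement big_mkord; congr (_ * _).
  by apply: eq_bigr => k _; rewrite fE.
rewrite e3; last by apply/allP => i; rewrite mem_index_iota.
congr (_ * _); apply: eq_bigr => k _; congr (wavg _ _); apply/funext => x; exact: fE.
Qed.

(** Pulling the power of sqrt N out of the integral requires [G] to be tame; this is deduced from
    the scaled quantity by multiplying back with a power of [dl]. *)
Lemma mm_scaled b kds m (G : seq R -> R) : all (kind_ok b) kds ->
  (forall s, av (gwt s) b (kvals (gwt s) (Vc S q M) (Dc S p M) kds) (cfg0 S M) = r ^+ m * G s) ->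
  mm S beta h D p q M b kds = r ^+ m * gauss_iter (N * N) G.
Proof.
move=> kb key; rewrite -gauss_iterZ; first by apply: gauss_iter_ext => s _; exact: key.
have tk := tame_scale _ (dl M ^+ m) _ (tame_kvals S beta h D p q M b kds kb).
apply: tame_ext tk => s; rewrite key mulrA -exprMn (mulrC (dl M)) r_dl.
by rewrite expr1n mul1r.
Qed.

Local Notation H1 := (\sum_(k < n) hT k + \sum_(k < n) hS k + e1 + e2)%N.

Lemma mm_statement : mm S beta h D p q M n statement_kinds =
  r ^+ H1 * nu S beta h D N n (fun g tau =>
           (\prod_(k < n) Tk S beta h D N g n tau k ^+ hT k)
           * (\prod_(l < n) Sk S beta h D N g n tau l ^+ hS l)
           * Tbar S beta h D N g q ^+ e1 * Sbar S beta h D N g p ^+ e2).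
Proof.
set F := (X in nu _ _ _ _ _ _ X); set kds := statement_kinds.
have key s : av (gwt s) n (kvals (gwt s) (Vc S q M) (Dc S p M) kds) (cfg0 S M) =
    r ^+ H1 * gavg S beta h D N (gdis N s) n (F (gdis N s)).
  rewrite av_kvals_statement -gavg_prod /gavg mulr_sumr; apply: eq_bigr => tau _.
  rewrite [RHS]mulrA; congr (_ * _).
  under eq_bigr => k _ do rewrite kfun_T kfun_S !(exprMn _ r) mulrACA.
  rewrite v0_Tbar d0_Sbar !(exprMn _ r) !big_split /= -!expr_sum /F !exprD; ring.
apply: (mm_scaled n kds _ (fun s => gavg S beta h D N (gdis N s) n (F (gdis N s)))) => //.
exact: statement_kinds_ok.
Qed.

Lemma mm_overlap : mm S beta h D p q M n overlap_kinds =
  r ^+ (e1 + e2) * nu S beta h D N 0 (fun g _ =>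
           Tbar S beta h D N g q ^+ e1 * Sbar S beta h D N g p ^+ e2).
Proof.
set F := (X in nu _ _ _ _ _ _ X).
apply: (mm_scaled n overlap_kinds _ (fun s => gavg S beta h D N (gdis N s) 0 (F (gdis N s)))).
  by rewrite /overlap_kinds all_cat !all_nseq !orbT.
move=> s; transitivity (v0 (gwt s) (Vc S q M) ^+ e1 * d0 (gwt s) (Dc S p M) ^+ e2).
  rewrite -[RHS](av_cst (gwt s) n _ (cfg0 S M)); last exact: sum_gwt.
  by congr (av _ _ _ _); apply/funext => t; exact: kvals_overlap.
rewrite v0_Tbar d0_Sbar !(exprMn _ r).
have e := gavg_prod s 0 (fun _ _ => 1) (Tbar S beta h D N (gdis N s) q ^+ e1 * Sbar S beta h D N (gdis N s) p ^+ e2).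
transitivity (r ^+ (e1 + e2) * (Tbar S beta h D N (gdis N s) q ^+ e1 * Sbar S beta h D N (gdis N s) p ^+ e2)).
  by rewrite exprD mulrACA.
congr (_ * _); move: e; rewrite [X in _ = X * _]big_ord0 [X in _ = X]mul1r => <-.
by apply: eq_bigr => tau _; rewrite !big_ord0 mul1r.
Qed.

End Kinds.
End FrozenModel.

Section Conclusion.
Context {R : realType}.

Lemma unscale_bound (x C d r : R) m : 0 < r -> r * d = 1 ->
  `|r ^+ m * x| <= C * d -> `|x| <= C * r ^- m.+1.
Proof.
move=> r0 rd; have -> : d = r^-1 by apply: (mulfI (lt0r_neq0 r0)); rewrite rd divff ?gt_eqF.
rewrite normrM ger0_norm ?exprn_ge0 ?(ltW r0) // => H.
by rewrite exprS invfM mulrA ler_pdivlMr ?exprn_gt0 // mulrC.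
Qed.

Variables (S : nat) (beta h D p q : R).
Hypothesis beta0 : 0 < beta.
Hypothesis betaS : beta * S%:R ^+ 2 <= 200%:R^-1.
Local Notation acov := (acov S beta h D p q).

Lemma cov_factor_scale M L11 L12 L21 L22 (r := Num.sqrt M.+1%:R) :
  is_cov_factor L11 L12 L21 L22 (A1sq S beta h D p q M.+1) (B1sq S beta h D p q M.+1) (C1sq S beta h D p q M.+1) ->
  is_cov_factor (r * L11) (r * L12) (r * L21) (r * L22) (acov true true) (acov false false) (acov true false).
Proof.
have r2 : r ^+ 2 = M.+1%:R by rewrite sqr_sqrtr.
have n0 : M.+1%:R != 0 :> R by rewrite pnatr_eq0.
have h3 := lt0r_neq0 (M3_gt0 S beta h D p q beta0 betaS).
have hc := lt0r_neq0 (Mc_gt0 S beta h D p q beta0 betaS).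
move=> [ea [ec eb]]; split; [|split].
- transitivity (r ^+ 2 * (L11 ^+ 2 + L12 ^+ 2)); first by ring.
  by rewrite ea r2 /A1sq /acov; move: (M.+1%:R) n0 => w n0; move: (M3 _ _ _ _ _ _) (Mc _ _ _ _ _ _) h3 hc => x y x0 y0; field; rewrite ?x0 ?y0 ?n0.
- transitivity (r ^+ 2 * (L11 * L21 + L12 * L22)); first by ring.
  by rewrite ec r2 /C1sq /acov; move: (M.+1%:R) n0 => w n0; move: (Mc _ _ _ _ _ _) hc => y y0; field; rewrite ?y0 ?n0.
- transitivity (r ^+ 2 * (L21 ^+ 2 + L22 ^+ 2)); first by ring.
  by rewrite eb r2 /B1sq /acov; move: (M.+1%:R) n0 => w n0; move: (Mc _ _ _ _ _ _) hc => y y0; field; rewrite ?y0 ?n0.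
Qed.

End Conclusion.

Theorem theorem4p5 (R : realType) (S : nat) (h D : R) :
  (1 <= S)%N -> 0 <= h ->
  exists beta0 : R, 0 < beta0 /\
  forall beta : R, 0 < beta -> beta < beta0 ->
  forall p q : R, fixed_point S beta h D p q ->
  forall (n : nat) (hT hS : 'I_n -> nat) (e1 e2 : nat),
  exists C : R, forall N : nat, (2 <= N)%N ->
  forall L11 L12 L21 L22 : R,
    is_cov_factor L11 L12 L21 L22
      (A1sq S beta h D p q N) (B1sq S beta h D p q N) (C1sq S beta h D p q N) ->
    `| nu S beta h D N n (fun g tau =>
           (\prod_(k < n) Tk S beta h D N g n tau k ^+ hT k)
           * (\prod_(l < n) Sk S beta h D N g n tau l ^+ hS l)
           * Tbar S beta h D N g q ^+ e1 * Sbar S beta h D N g p ^+ e2)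
       - (\prod_(k < n) gmom L11 L12 L21 L22 (hT k) (hS k))
         * nu S beta h D N 0 (fun g _ =>
             Tbar S beta h D N g q ^+ e1 * Sbar S beta h D N g p ^+ e2) |
    <= C * Num.sqrt (N%:R) ^- (\sum_(k < n) hT k + \sum_(k < n) hS k + e1 + e2).+1.
Proof.
move=> S1 _; have S2 : 0 < S%:R ^+ 2 :> R by rewrite exprn_gt0 // ltr0n.
(* The threshold of the moment bounds, determined by [S] and common to all exponents. *)
exists ((200%:R * S%:R ^+ 2)^-1); split; first by rewrite invr_gt0 mulr_gt0.
move=> beta b0 bS p q fp n hT hS e1 e2.
have betaS : beta * S%:R ^+ 2 <= 200%:R^-1.
  by rewrite -ler_pdivlMr // -invfM ltW.
pose a := acov S beta h D p q.
(* A factor of the N-free covariance is fixed before the constant. If none exists, rescaling shows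
   that Sigma_1 has no factor for any N, and the claim is vacuous. *)
have [[K11 [K12 [K21 [K22 KK]]]]|nofactor] := pselect (exists L11 L12 L21 L22 : R,
  is_cov_factor L11 L12 L21 L22 (a true true) (a false false) (a true false)); last first.
  exists 0 => -[//|M] _ L11 L12 L21 L22 /(cov_factor_scale _ _ _ _ _ _ b0 betaS) HL.
  by case: nofactor; do 4 eexists; exact: HL.
have kok := statement_kinds_ok n hT hS e1 e2.
have [C C0 HC] := gaussian_limit S beta h D p q fp b0 betaS (gmom K11 K12 K21 K22)
  (gmom00 _ _ _ _) (gmomSl _ _ _ _ _ _ _ KK) (gmomSr _ _ _ _ _ _ _ KK) n _ kok.
exists C => -[//|M] _ L11 L12 L21 L22 /(cov_factor_scale _ _ _ _ _ _ b0 betaS) HL.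
have r0 : 0 < Num.sqrt M.+1%:R :> R by rewrite sqrtr_gt0.
apply: (unscale_bound _ _ (dl M) _ _ r0 (r_dl M)).
move: (HC M); rewrite overlaps_statement mm_statement mm_overlap.
(* [K] and sqrt N times [L] factor the same matrix, hence have the same moments; this introduces the
   powers of sqrt N that match those in front of the two averages. *)
have gE u v : gmom K11 K12 K21 K22 u v = Num.sqrt M.+1%:R ^+ (u + v) * gmom L11 L12 L21 L22 u v.
  rewrite -gmom_scale; apply: (wick_unique _ _ _ _ _ _ (gmomSl _ _ _ _ _ _ _ KK)
    (gmomSr _ _ _ _ _ _ _ KK) (gmomSl _ _ _ _ _ _ _ HL) (gmomSr _ _ _ _ _ _ _ HL)).
  by rewrite !gmom00.
have -> : gweight (gmom K11 K12 K21 K22) n (statement_kinds n hT hS e1 e2) =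
  Num.sqrt M.+1%:R ^+ (\sum_(k < n) hT k + \sum_(k < n) hS k) * \prod_(k < n) gmom L11 L12 L21 L22 (hT k) (hS k).
  rewrite -big_split expr_sum -big_split; apply: eq_bigr => k _.
  by rewrite !count_statement gE.
set x := nu _ _ _ _ _ _ _; set y := nu _ _ _ _ _ _ _; set z := \prod_(k < n) _.
rewrite mulrACA -exprD addnA -mulrBr; exact.
Qed.
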